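(* Let $0<a\le\infty$ and let $k(t)$ be in $\mathcal{K}_a$. Then for all positive integers $n$ and $m$, $$\mathrm{f.p.}\!\int_0^a \frac{k(t)\ln^n t}{t^{m}}\,dt=\operatorname*{reglim}_{\lambda\to m}\mathcal{M}_a^*[k(t)\ln^n t;1-\lambda].$$
   Context: Class $\mathcal{K}_a$ ($0<a\le\infty$): functions $k(t)$ of a real variable such that (1) $k(0)\ne 0$; (2) $k(t)$ is the restriction to $[0,a)$ of a complex function $k(z)$ (the complex extension) that is analytic at every point of $[0,a)$; (3) the Mellin transform $\mathcal{M}_a[k(t);1-\lambda]=\int_0^a k(t)t^{-\lambda}\,dt$ exists for $d<\operatorname{Re}(\lambda)<1$ for some $d<1$ (the strip of analyticity; $d=-\infty$ if $a<\infty$, while $d$ may be finite or $-\infty$ if $a=\infty$). $\mathcal{M}_a[k(t)\ln^n t;1-\lambda]=\int_0^a k(t)\ln^n t\;t^{-\lambda}\,dt$ for $d<\operatorname{Re}(\lambda)<1$, and $\mathcal{M}_a^*[k(t)\ln^n t;1-\lambda]$ denotes its analytic continuation (in $\lambda$) to the region $\operatorname{Re}(\lambda)\ge 1$, isolated singularities excepted. Regularized limit: if $w$ is analytic in a punctured disk around $\lambda_0$ with Laurent expansion $\sum_{k\in\mathbb{Z}}a_k(\lambda-\lambda_0)^k$ there, and $w_P(\lambda|\lambda_0)=\sum_{k\ge1}a_{-k}(\lambda-\lambda_0)^{-k}$ is its principal part, then $\operatorname{reglim}_{\lambda\to\lambda_0}w(\lambda)=\lim_{\lambda\to\lambda_0}[w(\lambda)-w_P(\lambda|\lambda_0)]$.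 Finite-part integral: for finite $a$ write, for small $\epsilon>0$, $\int_\epsilon^a k(t)\ln^n t\;t^{-\lambda}\,dt=C_\epsilon+D_\epsilon$, where $C_\epsilon$ is the group of terms that converge as $\epsilon\to0^+$ and $D_\epsilon$ is the group of terms that have no finite limit, consisting only of such terms in powers of $\epsilon$ (possibly with complex exponents) and $\ln\epsilon$, with no constant term. Then $\mathrm{f.p.}\!\int_0^a k(t)\ln^n t\;t^{-\lambda}\,dt=\lim_{\epsilon\to0}C_\epsilon$. For $a=\infty$, $\mathrm{f.p.}\!\int_0^\infty=\lim_{a\to\infty}\mathrm{f.p.}\!\int_0^a$. *)

(* Defs.v *)
From Stdlib Require Import Reals ZArith List.
From Coquelicot Require Export Coquelicot.
Open Scope C_scope.

Definition Cexp (z : C) : C := (exp (Re z) * cos (Im z), exp (Re z) * sin (Im z))%R.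

(** [t ^ z] for real [t > 0] and complex [z]; junk for [t <= 0]. *)
Definition Rcpow (t : R) (z : C) : C := Cexp (z * RtoC (ln t)).

(** [f] is the sum of a convergent power series near [z0] (this includes a full
    complex neighbourhood of [z0]). *)
Definition analytic_at (f : C -> C) (z0 : C) : Prop :=
  exists c : nat -> C,
    locally z0 (fun z =>
      is_pseries (K := C_AbsRing) (V := C_NormedModule) c (z - z0) (f z)).

(** Approach to an upper endpoint [a], [0 < a <= +oo], from below. *)
Definition to_upper (a : Rbar) : (R -> Prop) -> Prop :=
  match a with
  | Finite b => at_left b
  | _ => Rbar_locally a
  end.

(** [l = int_0^a f], as an integral improper at both ends. *)
Definition is_int0 (f : R -> C) (a : Rbar) (l : C) : Prop :=
  is_RInt_gen (V := C_R_NormedModule) f (at_right 0) (to_upper a) l.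

(** The Mellin transform of [f] at [s], truncated at [a],
    exists and equals [l]. *)
Definition is_Mellin (a : Rbar) (f : R -> C) (s l : C) : Prop :=
  is_int0 (fun t => f t * Rcpow t (s - 1)) a l.

Definition mul_ln (n : nat) (k : R -> C) (t : R) : C := k t * RtoC (ln t ^ n).

(** [k] belongs to K_a, with strip of analyticity [d < Re lambda < 1]. *)
Definition class_K (a d : Rbar) (k : R -> C) : Prop :=
  k 0%R <> 0
  /\ (exists kz : C -> C, forall t : R, (0 <= t)%R -> Rbar_lt t a ->
        k t = kz (RtoC t) /\ analytic_at kz (RtoC t))
  /\ Rbar_lt d 1%R
  /\ (is_finite a -> d = m_infty)
  /\ (forall lam : C, Rbar_lt d (Re lam) -> (Re lam < 1)%R ->
        exists l : C, is_Mellin a k (1 - lam) l).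

(** [W] is the analytic continuation of [lambda |-> M_a[f; 1 - lambda]] from
    the strip [d < Re lambda < 1] to [Re lambda >= 1] with isolated
    singularities excepted: every point of the region has a punctured
    neighbourhood on which [W] is analytic.  The value of [W] at a singularity
    is irrelevant. *)
Definition is_Mellin_continuation
    (a d : Rbar) (f : R -> C) (W : C -> C) : Prop :=
  (forall lam : C, Rbar_lt d (Re lam) -> (Re lam < 1)%R ->
     is_Mellin a f (1 - lam) (W lam))
  /\ (forall lam0 : C, (1 <= Re lam0)%R -> locally' lam0 (analytic_at W)).

(** On [0 < |l - l0| < r], [w] has the Laurent expansion with coefficients [c];
    [wP] is the sum of its principal part. *)
Definition is_Laurent (w : C -> C) (l0 : C) (r : R) (c : Z -> C) (wP : C -> C)
    : Prop :=
  forall l : C, (0 < Cmod (l - l0) < r)%R ->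
    is_series (K := C_AbsRing) (V := C_NormedModule)
      (fun j : nat => c (- Z.of_nat (S j))%Z * (/ (l - l0)) ^ S j) (wP l)
    /\ is_pseries (K := C_AbsRing) (V := C_NormedModule)
         (fun j : nat => c (Z.of_nat j)) (l - l0) (w l - wP l).

Definition is_reglim (w : C -> C) (l0 v : C) : Prop :=
  exists (r : R) (c : Z -> C) (wP : C -> C),
    (0 < r)%R
    /\ (forall l : C, (0 < Cmod (l - l0) < r)%R -> analytic_at w l)
    /\ is_Laurent w l0 r c wP
    /\ filterlim (fun l => w l - wP l) (locally' l0) (locally v).

(** The term [c * eps ^ s * (ln eps) ^ j]. *)
Definition pl_term (p : C * C * nat) (eps : R) : C :=
  let '(c, s, j) := p in c * Rcpow eps s * RtoC (ln eps ^ j).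

(** In particular a constant term ([s = 0], [j = 0]) is never divergent. *)
Definition divergent_term (p : C * C * nat) : Prop :=
  ~ exists l : C, filterlim (pl_term p) (at_right 0) (locally l).

Definition pl_sum (D : list (C * C * nat)) (eps : R) : C :=
  fold_right Cplus 0 (map (fun p => pl_term p eps) D).

(** [v] is the finite part of [int_0^b f] for finite [b > 0]. *)
Definition is_fp_fin (f : R -> C) (b : R) (v : C) : Prop :=
  exists (Ceps : R -> C) (D : list (C * C * nat)),
    List.Forall divergent_term D
    /\ at_right 0 (fun eps =>
         is_RInt_gen (V := C_R_NormedModule) f (at_point eps) (at_left b)
           (Ceps eps + pl_sum D eps))
    /\ filterlim Ceps (at_right 0) (locally v).

Definition is_fp (f : R -> C) (a : Rbar) (v : C) : Prop :=
  match a with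
  | Finite b => is_fp_fin f b v
  | _ => filterlimi (is_fp_fin f) (Rbar_locally a) (locally v)
  end.

(* Main.v *)
Require Import Defs.
From Stdlib Require Import Reals.
From Coquelicot Require Import Coquelicot.
From Stdlib Require Import ZArith List Lra Lia Classical ClassicalEpsilon.

(** Why the theorem holds.  Fix a small [b > 0], let [c_j] be the Taylor
    coefficients of [k] at 0 and [P] its Taylor polynomial with [M] terms.  Cut the
    Mellin integral at [b], subtract [P] from [k] on [[0,b]], and write the integral
    of [P] over [[0,b]] as the one over [[0,1]] minus the one over [[b,1]].  As
    [int_0^1 t^(s-1) (ln t)^n dt = (-1)^n n! / s^(n+1)] for [Re s > 0]
    ([mellin_pole]), this gives in the strip

      [W(l) = int_b^a k (ln t)^n t^(-l) dt + int_0^b (k - P) (ln t)^n t^(-l) dt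
              - int_b^1 P (ln t)^n t^(-l) dt + sum_(j<M) c_j (-1)^n n! / (j+1-l)^(n+1)],

    and the right-hand side makes sense for [Re l + 1 <= M]: it is the continuation
    ([mellin_cont], where [left_part] is minus everything but the first integral).
    At [l = m] the only singular term is the one with [j + 1 = m], and it is purely
    polar; so the regularized limit is the same expression at [l = m] with that
    term deleted ([reglim_intro]).

    The finite part is the same number.  Decompose the integral from [eps] to [a] in
    the same way: the pieces converge, except for the integrals from [eps] to 1 of
    [c_j t^(j-m) (ln t)^n].  An explicit primitive splits each of them into divergent
    terms, a vanishing term and the constant [c_j (-1)^n n! / (j+1-m)^(n+1)]; for
    [j + 1 = m] the primitive is [(ln t)^(n+1) / (n+1)] and there is no constant
    ([monomial_fp], [is_fp_fin_left_part]).

    Three analytic facts support this.  Integrals of [h(t) t^(-l)] that converge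
    absolutely, with some margin, are sums of power series in [l]
    ([powint_analytic]): expand [t^(-l)] and integrate termwise, with a geometric
    bound on the remainder.  At the upper endpoint the convergence is only
    conditional, and integration by parts reduces it to the absolute case
    ([powint_upper]).  Finally, any continuation agrees with the one above near
    [l = m] ([continuation_unique]); this is the identity theorem, obtained
    directly from the isolation of the zeros of a power series. *)

(** * Neighbourhoods and limits in the complex plane *)

Lemma locally_C (z : C) (P : C -> Prop) :
  locally z P <-> exists r : R, 0 < r /\ forall w : C, Cmod (w - z) < r -> P w.
Proof.
  split.
  - intros [e He]. exists e. split; [apply cond_pos|].
    intros w Hw. apply He.
    apply C_NormedModule_mixin_compat1. exact Hw.
  - intros [r [Hr H]].
    assert (He : 0 < r / sqrt 2) by (apply Rdiv_lt_0_compat; [easy|apply Rlt_sqrt2_0]).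
    exists (mkposreal _ He). intros w Hw. apply H.
    apply C_NormedModule_mixin_compat2 in Hw. simpl in Hw.
    replace (sqrt 2 * (r / sqrt 2)) with r in Hw; [exact Hw|].
    field. apply Rgt_not_eq, Rlt_sqrt2_0.
Qed.

Lemma locally_C_elim (z : C) (P : C -> Prop) :
  locally z P -> exists r : R, 0 < r /\ forall w : C, Cmod (w - z) < r -> P w.
Proof. apply locally_C. Qed.

Lemma locally_C_intro (z : C) (r : R) (P : C -> Prop) :
  0 < r -> (forall w : C, Cmod (w - z) < r -> P w) -> locally z P.
Proof. intros Hr H. apply locally_C. now exists r. Qed.

Lemma filterlim_C {T : Type} (F : (T -> Prop) -> Prop) {FF : Filter F}
  (f : T -> C) (l : C) :
  filterlim f F (locally l) <->
  forall e : R, 0 < e -> F (fun x => Cmod (f x - l) < e).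
Proof.
  split.
  - intros H e He.
    apply (H (fun w => Cmod (w - l) < e)). apply locally_C. exists e. auto.
  - intros H P HP. apply locally_C in HP. destruct HP as [r [Hr HP]].
    unfold filtermap. generalize (H r Hr). apply filter_imp. auto.
Qed.

Lemma Cmod_sym (x y : C) : Cmod (x - y) = Cmod (y - x).
Proof. rewrite <- Cmod_opp. f_equal. ring. Qed.

Lemma Cmod_triangle_sub (x y z : C) : Cmod (x - z) <= Cmod (x - y) + Cmod (y - z).
Proof. replace (x - z)%C with ((x - y) + (y - z))%C by ring. apply Cmod_triangle. Qed.

Lemma Cmod_lt_eq0 (x : C) : (forall e, 0 < e -> Cmod x <= e) -> x = 0%C.
Proof.
  intros H. apply Cmod_eq_0. apply Rle_antisym; [|apply Cmod_ge_0].
  apply le_epsilon. intros e He. rewrite Rplus_0_l. now apply H.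
Qed.

(** * Complex-valued integrals of a real variable *)

Notation is_CInt := (@is_RInt C_R_NormedModule).
Notation is_CInt_gen := (@is_RInt_gen C_R_NormedModule).
Notation Ccont := (@continuous R_UniformSpace C_UniformSpace).

Lemma is_CInt_unique (f : R -> C) (a b : R) (I J : C) :
  is_CInt f a b I -> is_CInt f a b J -> I = J.
Proof.
  intros H1 H2.
  rewrite <- (is_RInt_unique (V := C_R_CompleteNormedModule) f a b I H1).
  now apply (is_RInt_unique (V := C_R_CompleteNormedModule)).
Qed.

Lemma is_CInt_comp (f : R -> C) (a b : R) (I : C) :
  is_CInt f a b I <->
  is_RInt (fun t => Re (f t)) a b (Re I) /\ is_RInt (fun t => Im (f t)) a b (Im I).
Proof.
  split.
  - intros H. split.
    + apply (is_RInt_fct_extend_fst (U := R_NormedModule) (V := R_NormedModule) f a b I H).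
    + apply (is_RInt_fct_extend_snd (U := R_NormedModule) (V := R_NormedModule) f a b I H).
  - intros [H1 H2]. destruct I as [I1 I2].
    apply (is_RInt_fct_extend_pair (U := R_NormedModule) (V := R_NormedModule) f a b I1 I2 H1 H2).
Qed.

Lemma is_CInt_scal (c : C) (f : R -> C) (a b : R) (I : C) :
  is_CInt f a b I -> is_CInt (fun t => c * f t)%C a b (c * I)%C.
Proof.
  rewrite !is_CInt_comp. intros [H1 H2]. split; simpl.
  - apply (is_RInt_minus (V := R_NormedModule) (fun t => Re c * Re (f t)) (fun t => Im c * Im (f t)));
      apply (is_RInt_scal (V := R_NormedModule)); assumption.
  - apply (is_RInt_plus (V := R_NormedModule) (fun t => Re c * Im (f t)) (fun t => Im c * Re (f t)));
      apply (is_RInt_scal (V := R_NormedModule)); assumption.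
Qed.

Lemma ex_CInt_cont (f : R -> C) (a b : R) :
  (forall t, Rmin a b <= t <= Rmax a b -> Ccont f t) ->
  exists I : C, is_CInt f a b I.
Proof. intros H. apply (ex_RInt_continuous (V := C_R_CompleteNormedModule) f a b H). Qed.

(** The improper integrals below all start at a fixed interior point, so that a
    single limit is involved. *)
Lemma is_CInt_gen_point (f : R -> C) (b : R) (F : (R -> Prop) -> Prop) {FF : Filter F} (l : C) :
  is_CInt_gen f (at_point b) F l <->
  forall e, 0 < e -> F (fun y => exists I : C, is_CInt f b y I /\ Cmod (I - l) < e).
Proof.
  split.
  - intros H e He.
    specialize (H (fun w => Cmod (w - l) < e)).
    assert (HL : locally l (fun w => Cmod (w - l) < e)) by (apply locally_C; exists e; auto).
    specialize (H HL). unfold filtermapi in H.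
    destruct H as [Q R0 HQ HR H].
    generalize HR. apply filter_imp. intros y Hy.
    apply (H b y HQ Hy).
  - intros H P HP. apply locally_C in HP. destruct HP as [r [Hr HP]].
    unfold filtermapi.
    exists (fun x => x = b) (fun y => exists I : C, is_CInt f b y I /\ Cmod (I - l) < r).
    + reflexivity.
    + now apply H.
    + intros x y -> [I [H1 H2]]. exists I. auto.
Qed.

Lemma is_CInt_gen_unique (f : R -> C) (b : R) (F : (R -> Prop) -> Prop) {FF : ProperFilter F} (l l' : C) :
  is_CInt_gen f (at_point b) F l -> is_CInt_gen f (at_point b) F l' -> l = l'.
Proof.
  rewrite !(is_CInt_gen_point _ _ F). intros H H'.
  cut (l - l' = 0)%C. { intros E. replace l with (l - l' + l')%C by ring. rewrite E. ring. }
  apply Cmod_lt_eq0. intros e He.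
  assert (He2 : 0 < e / 2) by lra.
  destruct (filter_ex _ (filter_and _ _ (H _ He2) (H' _ He2))) as [y [[I [H1 H2]] [J [H3 H4]]]].
  rewrite (is_CInt_unique _ _ _ _ _ H3 H1) in H4.
  eapply Rle_trans; [apply (Cmod_triangle_sub l I l')|]. rewrite (Cmod_sym l I). lra.
Qed.

Lemma is_CInt_gen_scal (c : C) (f : R -> C) (b : R) (F : (R -> Prop) -> Prop) {FF : Filter F} (l : C) :
  is_CInt_gen f (at_point b) F l ->
  is_CInt_gen (fun t => c * f t)%C (at_point b) F (c * l)%C.
Proof.
  rewrite !(is_CInt_gen_point _ _ F). intros H e He.
  assert (Hc := Cmod_ge_0 c).
  assert (He2 : 0 < e / (Cmod c + 1)) by (apply Rdiv_lt_0_compat; lra).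
  generalize (H _ He2). apply filter_imp. intros y [I [H1 H2]].
  exists (c * I)%C. split; [now apply is_CInt_scal|].
  replace (c * I - c * l)%C with (c * (I - l))%C by ring. rewrite Cmod_mult.
  apply Rle_lt_trans with ((Cmod c) * (e / (Cmod c + 1))).
  - apply Rmult_le_compat_l; lra.
  - replace e with ((Cmod c + 1) * (e / (Cmod c + 1))) at 2 by (field; lra). nra.
Qed.

Lemma is_CInt_gen_plus (f g : R -> C) (b : R) (F : (R -> Prop) -> Prop) {FF : Filter F} (l m : C) :
  is_CInt_gen f (at_point b) F l -> is_CInt_gen g (at_point b) F m ->
  is_CInt_gen (fun t => f t + g t)%C (at_point b) F (l + m)%C.
Proof. intros H1 H2. apply (is_RInt_gen_plus (V := C_R_NormedModule) f g l m H1 H2). Qed.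

Lemma is_CInt_gen_minus (f g : R -> C) (b : R) (F : (R -> Prop) -> Prop) {FF : Filter F} (l m : C) :
  is_CInt_gen f (at_point b) F l -> is_CInt_gen g (at_point b) F m ->
  is_CInt_gen (fun t => f t - g t)%C (at_point b) F (l - m)%C.
Proof. intros H1 H2. apply (is_RInt_gen_minus (V := C_R_NormedModule) f g l m H1 H2). Qed.

Definition interval_set (D : R -> Prop) : Prop :=
  forall x y z, D x -> D y -> Rmin x y <= z <= Rmax x y -> D z.

Lemma is_CInt_gen_ext (D : R -> Prop) (f g : R -> C) (b : R) (F : (R -> Prop) -> Prop) {FF : Filter F} (l : C) :
  interval_set D -> D b -> F D -> (forall t, D t -> f t = g t) ->
  is_CInt_gen f (at_point b) F l -> is_CInt_gen g (at_point b) F l.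
Proof.
  intros HD Hb HF Hfg. rewrite !(is_CInt_gen_point _ _ F). intros H e He.
  generalize (filter_and _ _ HF (H e He)). apply filter_imp.
  intros y [Hy [I [H1 H2]]]. exists I. split; [|easy].
  eapply (is_RInt_ext (V := C_R_NormedModule)); [|exact H1].
  intros t Ht. apply Hfg. apply (HD b y); [easy..|lra].
Qed.

Lemma norm_CInt_le (f : R -> C) (G : R -> R) (x y : R) (I : C) (J : R) :
  (forall t, Rmin x y <= t <= Rmax x y -> Cmod (f t) <= G t) ->
  is_CInt f x y I -> is_RInt G x y J -> Cmod I <= Rabs J.
Proof.
  intros H HI HJ. destruct (Rle_dec x y) as [Hxy|Hxy].
  - apply Rle_trans with J; [|apply Rle_abs].
    rewrite Cmod_norm.
    apply (norm_RInt_le (V := C_R_NormedModule) f G x y I J Hxy); [|easy..].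
    intros t Ht. rewrite <- Cmod_norm. apply H. now rewrite Rmin_left, Rmax_right.
  - apply Rnot_le_lt in Hxy.
    apply (is_RInt_swap (V := C_R_NormedModule)) in HI.
    apply (is_RInt_swap (V := R_NormedModule)) in HJ.
    replace (Cmod I) with (Cmod (- I)%C) by apply Cmod_opp.
    replace (Rabs J) with (Rabs (- J)) by apply Rabs_Ropp.
    apply Rle_trans with (- J)%R; [|apply Rle_abs].
    rewrite Cmod_norm.
    apply (norm_RInt_le (V := C_R_NormedModule) f G y x (- I)%C (- J) (Rlt_le _ _ Hxy)); [|easy..].
    intros t Ht. rewrite <- Cmod_norm. apply H.
    rewrite Rmin_right, Rmax_left; lra.
Qed.

Lemma CInt_gen_cauchy (f : R -> C) (b : R) (F : (R -> Prop) -> Prop) {FF : ProperFilter F} :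
  (forall e, 0 < e -> exists P : R -> Prop, F P /\ forall y y', P y -> P y' ->
     exists I I' : C, is_CInt f b y I /\ is_CInt f b y' I' /\ Cmod (I' - I) < e) ->
  exists l : C, is_CInt_gen f (at_point b) F l.
Proof.
  intros H.
  set (Phi := fun y => RInt (V := C_R_CompleteNormedModule) f b y : C).
  assert (HPhi : forall y I, is_CInt f b y I -> Phi y = I).
  { intros y I HI. apply (is_RInt_unique (V := C_R_CompleteNormedModule) f b y I HI). }
  assert (HC : exists l : C_R_CompleteNormedModule, filterlim Phi F (locally l)).
  { apply (filterlim_locally_cauchy (U := C_R_CompleteNormedModule) (F := F)).
    intros e. destruct (H e (cond_pos e)) as [P [HP HPP]].
    exists P. split; [easy|]. intros u v Hu Hv.
    destruct (HPP u v Hu Hv) as [I [I' [H1 [H2 H3]]]].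
    rewrite (HPhi _ _ H1), (HPhi _ _ H2).
    apply C_NormedModule_mixin_compat1. exact H3. }
  destruct HC as [l Hl]. exists l.
  apply (is_CInt_gen_point f b F l). intros e He.
  apply (proj1 (filterlim_C F Phi l)) with (e := e) in Hl; [|easy].
  destruct (H 1 Rlt_0_1) as [P [HP HPP]].
  generalize (filter_and _ _ HP Hl). apply filter_imp. intros y [Hy Hy'].
  destruct (HPP y y Hy Hy) as [I [_ [H1 _]]].
  exists I. split; [easy|]. now rewrite <- (HPhi _ _ H1).
Qed.

(** The tails of the integral of [f] are bounded by those of the integral of [G],
    so that the Cauchy criterion passes from [G] to [f]. *)
Lemma CInt_gen_dominated (D : R -> Prop) (f : R -> C) (G : R -> R) (b : R)
  (F : (R -> Prop) -> Prop) {FF : ProperFilter F} (J : R) :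
  interval_set D -> D b -> F D ->
  (forall t, D t -> Ccont f t) ->
  (forall t, D t -> Cmod (f t) <= G t) ->
  is_RInt_gen (V := R_NormedModule) G (at_point b) F J ->
  exists l : C, is_CInt_gen f (at_point b) F l /\ Cmod l <= Rabs J.
Proof.
  intros HD Hb HF Hf HG HJ.
  assert (HJ' : forall e, 0 < e -> F (fun y => exists K, is_RInt (V := R_NormedModule) G b y K /\ Rabs (K - J) < e)).
  { intros e He.
    assert (HL : locally J (fun w => Rabs (w - J) < e)) by (exists (mkposreal e He); intros w Hw; exact Hw).
    destruct (HJ _ HL) as [Q S HQ HS H].
    generalize HS. apply filter_imp. intros y Hy. apply (H b y HQ Hy). }
  assert (Hex : forall x y, D x -> D y -> exists I : C, is_CInt f x y I).
  { intros x y Hx Hy. apply ex_CInt_cont. intros t Ht. apply Hf. now apply (HD x y). }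
  destruct (CInt_gen_cauchy f b F) as [l Hl].
  - intros e He.
    exists (fun y => D y /\ exists K, is_RInt (V := R_NormedModule) G b y K /\ Rabs (K - J) < e / 2).
    split; [apply filter_and; [easy|apply HJ'; lra]|].
    intros y y' [Dy [K [HK HKe]]] [Dy' [K' [HK' HKe']]].
    destruct (Hex b y Hb Dy) as [I HI]. destruct (Hex y y' Dy Dy') as [I2 HI2].
    exists I, (I + I2)%C. split; [easy|]. split.
    + apply (is_RInt_Chasles (V := C_R_NormedModule) f b y y' I I2 HI HI2).
    + replace (I + I2 - I)%C with I2 by ring.
      apply Rle_lt_trans with (Rabs (K' - K)).
      * apply (norm_CInt_le f G y y' I2 (K' - K)); [|easy|].
        -- intros t Ht. apply HG. now apply (HD y y').
        -- replace (K' - K)%R with (plus (opp K) K').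
           2: unfold plus, opp; simpl; ring.
           apply (is_RInt_Chasles (V := R_NormedModule) G y b y'); [|easy].
           now apply (is_RInt_swap (V := R_NormedModule)).
      * unfold Rabs in *. repeat destruct Rcase_abs; lra.
  - exists l. split; [easy|].
    apply le_epsilon. intros e He.
    assert (He2 : 0 < e / 2) by lra.
    rewrite (is_CInt_gen_point _ _ F) in Hl.
    destruct (filter_ex _ (filter_and _ _ HF (filter_and _ _ (Hl _ He2) (HJ' _ He2))))
      as [y [Dy [[I [HI HIe]] [K [HK HKe]]]]].
    assert (HIK : Cmod I <= Rabs K).
    { apply (norm_CInt_le f G b y); [|easy..]. intros t Ht. apply HG. now apply (HD b y). }
    assert (Cmod l <= Cmod (l - I) + Cmod I).
    { replace l with ((l - I) + I)%C at 1 by ring. apply Cmod_triangle. }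
    rewrite (Cmod_sym l I) in H.
    unfold Rabs in *. repeat destruct Rcase_abs; lra.
Qed.

(** * Continuity and derivatives through real and imaginary parts *)

Lemma Ccont_comp (f : R -> C) (t : R) :
  Ccont f t <->
  continuous (fun x => Re (f x)) t /\ continuous (fun x => Im (f x)) t.
Proof.
  unfold continuous. split.
  - intros H. split; apply filterlim_locally; intros e;
      pose proof (proj1 (filterlim_locally (U := C_UniformSpace) f (f t)) H e) as He;
      revert He; apply filter_imp; intros x [H1 H2]; assumption.
  - intros [H1 H2]. apply (filterlim_locally (U := C_UniformSpace) f (f t)). intros e.
    rewrite filterlim_locally in H1. rewrite filterlim_locally in H2.
    generalize (filter_and _ _ (H1 e) (H2 e)). apply filter_imp.
    intros x [A B]. split; assumption.
Qed.

Lemma Ccont_plus (f g : R -> C) (t : R) :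
  Ccont f t -> Ccont g t -> Ccont (fun x => f x + g x)%C t.
Proof.
  rewrite !Ccont_comp. intros [H1 H2] [H3 H4]. split; simpl.
  - now apply (continuous_plus (V := R_NormedModule) (fun x => Re (f x)) (fun x => Re (g x))).
  - now apply (continuous_plus (V := R_NormedModule) (fun x => Im (f x)) (fun x => Im (g x))).
Qed.

Lemma Ccont_mult (f g : R -> C) (t : R) :
  Ccont f t -> Ccont g t -> Ccont (fun x => f x * g x)%C t.
Proof.
  rewrite !Ccont_comp. intros [H1 H2] [H3 H4]. split; simpl.
  - apply (continuous_minus (V := R_NormedModule) (fun x => Re (f x) * Re (g x)) (fun x => Im (f x) * Im (g x)));
     apply (continuous_mult (K := R_AbsRing)); assumption.
  - apply (continuous_plus (V := R_NormedModule) (fun x => Re (f x) * Im (g x)) (fun x => Im (f x) * Re (g x)));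
     apply (continuous_mult (K := R_AbsRing)); assumption.
Qed.

Lemma Ccont_const (c : C) (t : R) : Ccont (fun _ => c) t.
Proof. apply continuous_const. Qed.

Lemma Ccont_RtoC (u : R -> R) (t : R) :
  continuous u t -> Ccont (fun x => RtoC (u x)) t.
Proof.
  intros H. apply Ccont_comp. split; simpl; [exact H|].
  apply continuous_const.
Qed.

Lemma Ccont_opp (f : R -> C) (t : R) : Ccont f t -> Ccont (fun x => - f x)%C t.
Proof.
  rewrite !Ccont_comp. intros [H1 H2]. split; simpl.
  - now apply (continuous_opp (V := R_NormedModule) (fun x => Re (f x))).
  - now apply (continuous_opp (V := R_NormedModule) (fun x => Im (f x))).
Qed.

Lemma Ccont_minus (f g : R -> C) (t : R) :
  Ccont f t -> Ccont g t -> Ccont (fun x => f x - g x)%C t.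
Proof. intros Hf Hg. apply Ccont_plus; [easy|]. now apply Ccont_opp. Qed.

Lemma Ccont_ext_loc (f g : R -> C) (t : R) :
  locally t (fun x => f x = g x) -> Ccont f t -> Ccont g t.
Proof. apply (continuous_ext_loc (T := R_UniformSpace) (U := C_UniformSpace)). Qed.

Definition is_Cderive (f : R -> C) (t : R) (l : C) : Prop :=
  is_derive (fun x => Re (f x)) t (Re l) /\ is_derive (fun x => Im (f x)) t (Im l).

Lemma is_Cderive_cont (f : R -> C) (t : R) (l : C) : is_Cderive f t l -> Ccont f t.
Proof.
  intros [H1 H2]. apply Ccont_comp.
  split; apply (ex_derive_continuous (K := R_AbsRing) (V := R_NormedModule)); eexists; eassumption.
Qed.

Lemma is_Cderive_plus (f g : R -> C) (t : R) (l m : C) :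
  is_Cderive f t l -> is_Cderive g t m -> is_Cderive (fun x => f x + g x)%C t (l + m)%C.
Proof.
  intros [H1 H2] [H3 H4]. split; simpl.
  - now apply (is_derive_plus (K := R_AbsRing) (V := R_NormedModule) (fun x => Re (f x)) (fun x => Re (g x))).
  - now apply (is_derive_plus (K := R_AbsRing) (V := R_NormedModule) (fun x => Im (f x)) (fun x => Im (g x))).
Qed.

Lemma is_Cderive_minus (f g : R -> C) (t : R) (l m : C) :
  is_Cderive f t l -> is_Cderive g t m -> is_Cderive (fun x => f x - g x)%C t (l - m)%C.
Proof.
  intros [H1 H2] [H3 H4]. split; simpl.
  - now apply (is_derive_minus (K := R_AbsRing) (V := R_NormedModule) (fun x => Re (f x)) (fun x => Re (g x))).
  - now apply (is_derive_minus (K := R_AbsRing) (V := R_NormedModule) (fun x => Im (f x)) (fun x => Im (g x))).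
Qed.

Lemma is_Cderive_mult (f g : R -> C) (t : R) (l m : C) :
  is_Cderive f t l -> is_Cderive g t m ->
  is_Cderive (fun x => f x * g x)%C t (l * g t + f t * m)%C.
Proof.
  assert (Hm : forall u v : R -> R, forall a b, is_derive u t a -> is_derive v t b ->
    is_derive (fun x => u x * v x) t (a * v t + u t * b)).
  { intros u v a b Hu Hv. apply (is_derive_mult (K := R_AbsRing) u v t a b Hu Hv).
    intros; apply Rmult_comm. }
  intros [H1 H2] [H3 H4]. split; simpl.
  - replace (_ + _)%R with ((Re l * Re (g t) + Re (f t) * Re m) - (Im l * Im (g t) + Im (f t) * Im m)).
    2: unfold Re, Im; ring.
    apply (is_derive_minus (K := R_AbsRing) (V := R_NormedModule)
      (fun x => Re (f x) * Re (g x)) (fun x => Im (f x) * Im (g x))); now apply Hm.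
  - replace (_ + _)%R with ((Re l * Im (g t) + Re (f t) * Im m) + (Im l * Re (g t) + Im (f t) * Re m)).
    2: unfold Re, Im; ring.
    apply (is_derive_plus (K := R_AbsRing) (V := R_NormedModule)
      (fun x => Re (f x) * Im (g x)) (fun x => Im (f x) * Re (g x))); now apply Hm.
Qed.

Lemma is_Cderive_const (c : C) (t : R) : is_Cderive (fun _ => c) t 0%C.
Proof. split; apply (is_derive_const (K := R_AbsRing) (V := R_NormedModule)). Qed.

Lemma is_Cderive_RtoC (u : R -> R) (t l : R) :
  is_derive u t l -> is_Cderive (fun x => RtoC (u x)) t (RtoC l).
Proof. intros H. split; simpl; [exact H|]. apply (is_derive_const (K := R_AbsRing) (V := R_NormedModule)). Qed.

Lemma is_Cderive_eq (f : R -> C) (t : R) (l m : C) : is_Cderive f t l -> l = m -> is_Cderive f t m.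
Proof. now intros H <-. Qed.

Lemma is_CInt_derive (f df : R -> C) (a b : R) :
  (forall t, Rmin a b <= t <= Rmax a b -> is_Cderive f t (df t)) ->
  (forall t, Rmin a b <= t <= Rmax a b -> Ccont df t) ->
  is_CInt df a b (f b - f a)%C.
Proof.
  intros H1 H2. apply is_CInt_comp. split.
  - apply (is_RInt_derive (V := R_CompleteNormedModule) (fun x => Re (f x)) (fun x => Re (df x))).
    + intros t Ht. apply (H1 t Ht).
    + intros t Ht. apply (proj1 (Ccont_comp _ _) (H2 t Ht)).
  - apply (is_RInt_derive (V := R_CompleteNormedModule) (fun x => Im (f x)) (fun x => Im (df x))).
    + intros t Ht. apply (H1 t Ht).
    + intros t Ht. apply (proj1 (Ccont_comp _ _) (H2 t Ht)).
Qed.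

(** * Complex exponentials and powers *)

Lemma Cexp_plus (z w : C) : Cexp (z + w) = (Cexp z * Cexp w)%C.
Proof.
  destruct z as [a b], w as [c d]. unfold Cexp, Cmult, Cplus, Re, Im. simpl.
  rewrite exp_plus, cos_plus, sin_plus. f_equal; ring.
Qed.

Lemma Cexp_0 : Cexp 0 = 1%C.
Proof.
  unfold Cexp, Re, Im. simpl. rewrite exp_0, cos_0, sin_0. unfold RtoC. f_equal; ring.
Qed.

Lemma Cmod_Cexp (z : C) : Cmod (Cexp z) = exp (Re z).
Proof.
  unfold Cexp, Cmod. simpl.
  replace (_ + _)%R with ((exp (Re z))²).
  - apply sqrt_Rsqr. left. apply exp_pos.
  - pose proof (sin2_cos2 (Im z)) as E. unfold Rsqr in *. nra.
Qed.

Lemma is_Cderive_Cexp (w : C) (u : R -> R) (t l : R) :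
  is_derive u t l ->
  is_Cderive (fun x => Cexp (w * RtoC (u x))) t (w * RtoC l * Cexp (w * RtoC (u t)))%C.
Proof.
  intros H.
  assert (E : forall f x df, is_derive f x df -> x = u t -> is_derive (fun y => f (u y)) t (l * df)).
  { intros f x df Hf ->. apply (is_derive_comp (K := R_AbsRing) (V := R_NormedModule) f u t df l Hf H). }
  destruct w as [a b]. split; simpl.
  - apply (is_derive_ext (fun x => exp (a * u x) * cos (b * u x))).
    { intros x. replace (a * u x - b * 0) with (a * u x) by ring.
      replace (a * 0 + b * u x) with (b * u x) by ring. reflexivity. }
    unfold Re, Im. simpl.
    replace (a * u t - b * 0) with (a * u t) by ring.
    replace (a * 0 + b * u t) with (b * u t) by ring.
    match goal with |- is_derive _ _ ?v => replace v with
     (l * (a * exp (a * u t) * cos (b * u t) - b * exp (a * u t) * sin (b * u t))) by ring end.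
    apply (E (fun y => exp (a * y) * cos (b * y)) (u t)); [|easy].
    auto_derive; [easy|ring].
  - apply (is_derive_ext (fun x => exp (a * u x) * sin (b * u x))).
    { intros x. replace (a * u x - b * 0) with (a * u x) by ring.
      replace (a * 0 + b * u x) with (b * u x) by ring. reflexivity. }
    unfold Re, Im. simpl.
    replace (a * u t - b * 0) with (a * u t) by ring.
    replace (a * 0 + b * u t) with (b * u t) by ring.
    match goal with |- is_derive _ _ ?v => replace v with
     (l * (a * exp (a * u t) * sin (b * u t) + b * exp (a * u t) * cos (b * u t))) by ring end.
    apply (E (fun y => exp (a * y) * sin (b * y)) (u t)); [|easy].
    auto_derive; [easy|ring].
Qed.

Lemma exp_le_mono (x y : R) : x <= y -> exp x <= exp y.
Proof. intros [H| ->]; [left; now apply exp_increasing|right; easy]. Qed.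

Lemma Rcpow_plus (t : R) (z w : C) : Rcpow t (z + w) = (Rcpow t z * Rcpow t w)%C.
Proof. unfold Rcpow. rewrite <- Cexp_plus. f_equal. ring. Qed.

Lemma Rcpow_0 (t : R) : Rcpow t 0 = 1%C.
Proof. unfold Rcpow. rewrite Cmult_0_l. apply Cexp_0. Qed.

Lemma Rcpow_1 (t : R) : 0 < t -> Rcpow t 1 = RtoC t.
Proof.
  intros Ht. unfold Rcpow. rewrite Cmult_1_l. unfold Cexp, Re, Im. simpl.
  rewrite exp_ln, cos_0, sin_0 by easy. unfold RtoC. f_equal; ring.
Qed.

Lemma Rcpow_at_1 (z : C) : Rcpow 1 z = 1%C.
Proof. unfold Rcpow. rewrite ln_1, Cmult_0_r. apply Cexp_0. Qed.

Lemma Rcpow_nat (t : R) (j : nat) : 0 < t -> Rcpow t (RtoC (INR j)) = RtoC (t ^ j).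
Proof.
  intros Ht. induction j as [|j IH].
  - apply Rcpow_0.
  - rewrite S_INR, RtoC_plus, Rcpow_plus, IH, Rcpow_1 by easy.
    rewrite <- RtoC_mult. f_equal. simpl. ring.
Qed.

Lemma Rcpow_opp (t : R) (z : C) : (Rcpow t z * Rcpow t (- z))%C = 1%C.
Proof. rewrite <- Rcpow_plus, Cplus_opp_r. apply Rcpow_0. Qed.

Lemma Rcpow_opp_nat (t : R) (j : nat) : 0 < t -> Rcpow t (- RtoC (INR j)) = (/ RtoC (t ^ j))%C.
Proof.
  intros Ht. pose proof (Rcpow_opp t (RtoC (INR j))) as E. rewrite Rcpow_nat in E by easy.
  assert (Hn : RtoC (t ^ j) <> 0%C).
  { intros H. apply RtoC_inj in H. apply pow_lt with (n := j) in Ht. lra. }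
  transitivity (/ RtoC (t ^ j) * (RtoC (t ^ j) * Rcpow t (- RtoC (INR j))))%C.
  - field. exact Hn.
  - rewrite E. ring.
Qed.

Lemma Cmod_Rcpow (t : R) (z : C) : Cmod (Rcpow t z) = Rpower t (Re z).
Proof.
  unfold Rcpow. rewrite Cmod_Cexp. unfold Rpower. f_equal. unfold Re. simpl. ring.
Qed.

Lemma is_Cderive_Rcpow (s : C) (t : R) :
  0 < t -> is_Cderive (fun x => Rcpow x s) t (s * Rcpow t (s - 1))%C.
Proof.
  intros Ht. eapply is_Cderive_eq.
  - apply (is_Cderive_Cexp s ln t (/ t)). now apply is_derive_ln.
  - replace (s - 1)%C with (s + - RtoC (INR 1))%C by (change (INR 1) with 1; ring).
    rewrite Rcpow_plus, Rcpow_opp_nat by easy. fold (Rcpow t s).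
    rewrite pow_1. rewrite RtoC_inv by lra. ring.
Qed.

Lemma Ccont_Rcpow (s : C) (t : R) : 0 < t -> Ccont (fun x => Rcpow x s) t.
Proof. intros Ht. eapply is_Cderive_cont. now apply is_Cderive_Rcpow. Qed.

Lemma is_derive_ln_pow (n : nat) (t : R) :
  0 < t -> is_derive (fun x => ln x ^ n) t (INR n * ln t ^ pred n * / t).
Proof.
  intros Ht. auto_derive; [easy|]. field. lra.
Qed.

Lemma Ccont_ln_pow (n : nat) (t : R) : 0 < t -> Ccont (fun x => RtoC (ln x ^ n)) t.
Proof.
  intros Ht. eapply is_Cderive_cont. apply is_Cderive_RtoC. now apply is_derive_ln_pow.
Qed.

(** * Taylor remainder of the exponential *)

(** The sum of the first [N] terms, which may be empty, unlike [sum_n]. *)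
Fixpoint csum (u : nat -> C) (N : nat) : C :=
  match N with O => 0%C | S N => (csum u N + u N)%C end.

Lemma csum_ext (u v : nat -> C) (N : nat) :
  (forall j, (j < N)%nat -> u j = v j) -> csum u N = csum v N.
Proof.
  induction N as [|N IH]; intros H; [easy|]. simpl. rewrite IH, H; [easy|lia|].
  intros; apply H; lia.
Qed.

Lemma csum_scal (c : C) (u : nat -> C) (N : nat) :
  csum (fun j => c * u j)%C N = (c * csum u N)%C.
Proof. induction N as [|N IH]; simpl; [ring|]. rewrite IH. ring. Qed.

Lemma csum_head (u : nat -> C) (N : nat) :
  csum u (S N) = (u O + csum (fun j => u (S j)) N)%C.
Proof. induction N as [|N IH]; simpl; [ring|]. simpl in IH. rewrite IH. ring. Qed.

Definition exp_taylor (w : C) (N : nat) (t : R) : C :=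
  csum (fun j => w ^ j * RtoC (t ^ j / INR (fact j)))%C N.

Lemma exp_taylor_derive (w : C) (N : nat) (t : R) :
  is_Cderive (exp_taylor w (S N)) t (w * exp_taylor w N t)%C.
Proof.
  unfold exp_taylor. induction N as [|N IH].
  - simpl. eapply is_Cderive_eq.
    + apply (is_Cderive_plus (fun _ => 0%C) (fun _ => _)); apply is_Cderive_const.
    + ring.
  - cbn [csum]. cbn [csum] in IH. eapply is_Cderive_eq.
    + apply is_Cderive_plus; [exact IH|].
      apply is_Cderive_mult; [apply is_Cderive_const|].
      apply (is_Cderive_RtoC (fun t => t ^ S N / INR (fact (S N))) t (t ^ N / INR (fact N))).
      assert (Hf : INR (fact N) <> 0) by apply INR_fact_neq_0.
      assert (HN : INR (S N) <> 0) by (apply not_0_INR; lia).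
      replace (INR (fact (S N))) with (INR (S N) * INR (fact N)) by (rewrite fact_simpl, mult_INR; easy).
      set (n1 := INR (S N)) in *. set (f1 := INR (fact N)) in *.
      replace (t ^ N / f1) with (n1 * t ^ N / (n1 * f1)) by (field; auto).
      apply (is_derive_ext (fun x => / (n1 * f1) * x ^ S N)).
      { intros x. change (/ (n1 * f1) * x ^ S N = x ^ S N / (n1 * f1)). field. auto. }
      auto_derive; [easy|]. change (match N with O => 1 | S _ => INR N + 1 end) with n1. cbn [pred]. field. auto.
    + cbn beta. change (w ^ S N)%C with (w * w ^ N)%C. ring.
Qed.

(** The remainder of order [N+1] is the integral of [w] times that of order [N];
    the bound then follows by induction.  The two parameters [q] and [y] leave
    room for a geometric factor. *)
Lemma Cexp_taylor_bound (w : C) (q y : R) (N : nat) :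
  0 <= q <= 1 -> 0 <= y -> Cmod w <= q * y ->
  forall t, 0 <= t ->
  Cmod (Cexp (w * RtoC t) - exp_taylor w N t) <= q ^ N * exp (y * t).
Proof.
  intros Hq Hy Hw. induction N as [|N IH]; intros t Ht.
  - unfold exp_taylor. simpl csum. replace (Cexp (w * RtoC t) - 0)%C with (Cexp (w * RtoC t)) by ring.
    rewrite Cmod_Cexp. simpl. rewrite Rmult_1_l.
    apply exp_le_mono. 
    assert (Re w <= y).
    { apply Rle_trans with (Cmod w); [|nra]. eapply Rle_trans; [apply Rle_abs|apply re_le_Cmod]. }
    unfold Re in H. nra.
  - assert (HI : is_CInt (fun s => w * (Cexp (w * RtoC s) - exp_taylor w N s))%C 0 t
       ((Cexp (w * RtoC t) - exp_taylor w (S N) t) - (Cexp (w * RtoC 0) - exp_taylor w (S N) 0))%C).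
    { assert (HD : forall M s, is_Cderive (fun s => Cexp (w * RtoC s) - exp_taylor w (S M) s)%C s
        (w * (Cexp (w * RtoC s) - exp_taylor w M s))%C).
      { intros M s. eapply is_Cderive_eq.
        - apply (is_Cderive_minus (fun s => Cexp (w * RtoC s)) (exp_taylor w (S M))).
          + apply (is_Cderive_Cexp w (fun x => x) s 1). apply (is_derive_id (K := R_AbsRing)).
          + apply exp_taylor_derive.
        - ring. }
      apply (is_CInt_derive (fun s => Cexp (w * RtoC s) - exp_taylor w (S N) s)%C).
      - intros s _. apply HD.
      - intros s _. apply Ccont_mult; [apply Ccont_const|]. apply Ccont_minus.
        + eapply is_Cderive_cont. apply (is_Cderive_Cexp w (fun x => x) s 1). apply (is_derive_id (K := R_AbsRing)).
        + destruct N as [|N].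
          * apply (Ccont_const 0%C).
          * eapply is_Cderive_cont. apply exp_taylor_derive. }
    assert (E0 : (Cexp (w * RtoC 0) - exp_taylor w (S N) 0)%C = 0%C).
    { rewrite Cmult_0_r, Cexp_0. unfold exp_taylor. rewrite csum_head.
      rewrite (csum_ext _ (fun j => 0 * 0)%C).
      - rewrite csum_scal. change (w ^ O)%C with (RtoC 1).
        replace (0 ^ 0 / INR (fact 0))%R with 1%R by (simpl; field). ring.
      - intros j _. unfold Rdiv. simpl (0 ^ S j). rewrite !Rmult_0_l. ring. }
    rewrite E0 in HI.
    assert (HJ : is_RInt (V := R_NormedModule) (fun s => q ^ S N * (y * exp (y * s))) 0 t
       (q ^ S N * exp (y * t) - q ^ S N * exp (y * 0))%R).
    { generalize (q ^ S N); intros Q. apply (is_RInt_derive (V := R_CompleteNormedModule) (fun s => Q * exp (y * s))).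
      - intros s _. auto_derive; [easy|]. ring.
      - intros s _. apply (ex_derive_continuous (K := R_AbsRing) (V := R_NormedModule)). auto_derive. easy. }
    pose proof (fun HA => norm_CInt_le _ _ 0 t _ _ HA HI HJ) as HB.
    match type of HB with ?A -> _ => assert (HA : A) end.
    { intros s Hs. rewrite Rmin_left, Rmax_right in Hs by easy.
      rewrite Cmod_mult. simpl (q ^ S N).
      replace (q * q ^ N * (y * exp (y * s))) with ((q * y) * (q ^ N * exp (y * s))) by ring.
      apply Rmult_le_compat; [apply Cmod_ge_0..|exact Hw|]. now apply IH. }
    specialize (HB HA). rewrite Rmult_0_r, exp_0 in HB.
    replace (Cexp (w * RtoC t) - exp_taylor w (S N) t - 0)%C with (Cexp (w * RtoC t) - exp_taylor w (S N) t)%C in HB by ring.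
    eapply Rle_trans; [exact HB|].
    assert (0 <= q ^ S N) by (apply pow_le; lra).
    assert (1 <= exp (y * t)). { rewrite <- exp_0. apply exp_le_mono. nra. }
    rewrite Rabs_pos_eq; nra.
Qed.

(** * Complex power series *)

Notation is_Cpseries := (@is_pseries C_AbsRing C_NormedModule).
Notation is_Cseries := (@is_series C_AbsRing C_NormedModule).

Lemma sum_n_csum (u : nat -> C) (N : nat) :
  @sum_n C_AbelianMonoid u N = csum u (S N).
Proof.
  induction N as [|N IH].
  - rewrite sum_O. simpl. ring.
  - rewrite sum_Sn, IH. reflexivity.
Qed.

Lemma is_Cseries_csum (u : nat -> C) (l : C) :
  is_Cseries u l <->
  forall e, 0 < e -> exists N0, forall N, (N0 <= N)%nat -> Cmod (csum u N - l) < e.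
Proof.
  unfold is_series.
  split.
  - intros H e He.
    apply (filterlim_C Hierarchy.eventually (fun N => @sum_n C_AbelianMonoid u N) l) with (e := e) in H; [|easy].
    destruct H as [N0 H]. exists (S N0). intros [|N] HN; [lia|].
    rewrite <- sum_n_csum. apply H. lia.
  - intros H.
    apply (filterlim_C Hierarchy.eventually (fun N => @sum_n C_AbelianMonoid u N) l). intros e He.
    destruct (H e He) as [N0 H0]. exists N0. intros N HN. rewrite sum_n_csum. apply H0. lia.
Qed.

Lemma is_Cpseries_csum (c : nat -> C) (z l : C) :
  is_Cpseries c z l <->
  forall e, 0 < e -> exists N0, forall N, (N0 <= N)%nat ->
    Cmod (csum (fun j => z ^ j * c j)%C N - l) < e.
Proof.
  rewrite <- is_Cseries_csum. unfold is_pseries.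
  reflexivity.
Qed.

Lemma pow_lt_eps (q B e : R) :
  0 <= q < 1 -> 0 < e -> exists N0, forall N, (N0 <= N)%nat -> B * q ^ N < e.
Proof.
  intros Hq He.
  assert (HB := Rabs_pos B).
  destruct (pow_lt_1_zero q) with (y := e / (Rabs B + 1)) as [N0 H].
  - rewrite Rabs_pos_eq; lra.
  - apply Rdiv_lt_0_compat; lra.
  - exists N0. intros N HN. specialize (H N HN).
    assert (0 <= q ^ N) by (apply pow_le; lra).
    rewrite Rabs_pos_eq in H by easy.
    apply Rle_lt_trans with ((Rabs B + 1) * q ^ N).
    + apply Rmult_le_compat_r; [easy|]. pose proof (Rle_abs B). lra.
    + replace e with ((Rabs B + 1) * (e / (Rabs B + 1))) by (field; lra).
      apply Rmult_lt_compat_l; lra.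
Qed.

Lemma is_Cpseries_geom (c : nat -> C) (z l : C) (q B : R) :
  0 <= q < 1 ->
  (forall N, Cmod (l - csum (fun j => z ^ j * c j)%C N) <= B * q ^ N) ->
  is_Cpseries c z l.
Proof.
  intros Hq H. apply is_Cpseries_csum. intros e He.
  destruct (pow_lt_eps q B e Hq He) as [N0 H0].
  exists N0. intros N HN. rewrite Cmod_sym.
  eapply Rle_lt_trans; [apply H|]. now apply H0.
Qed.

(** * Closure properties of analyticity *)

Lemma analytic_at_ext_loc (f g : C -> C) (z0 : C) :
  locally z0 (fun z => f z = g z) -> analytic_at f z0 -> analytic_at g z0.
Proof.
  intros He [c Hc]. exists c. generalize (filter_and _ _ He Hc).
  apply filter_imp. intros z [<- H]. exact H.
Qed.

Lemma analytic_at_plus (f g : C -> C) (z0 : C) :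
  analytic_at f z0 -> analytic_at g z0 -> analytic_at (fun z => f z + g z)%C z0.
Proof.
  intros [c Hc] [d Hd]. exists (PS_plus (V := C_NormedModule) c d).
  generalize (filter_and _ _ Hc Hd). apply filter_imp. intros z [H1 H2].
  apply (is_pseries_plus (K := C_AbsRing) (V := C_NormedModule) c d (z - z0)%C (f z) (g z) H1 H2).
Qed.

Lemma analytic_at_scal (a : C) (f : C -> C) (z0 : C) :
  analytic_at f z0 -> analytic_at (fun z => a * f z)%C z0.
Proof.
  intros [c Hc]. exists (PS_scal (V := C_NormedModule) a c).
  revert Hc. apply filter_imp. intros z H.
  apply (is_pseries_scal (K := C_AbsRing) (V := C_NormedModule) a c (z - z0)%C (f z)); [|easy].
  apply Cmult_comm.
Qed.

Lemma analytic_at_minus (f g : C -> C) (z0 : C) :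
  analytic_at f z0 -> analytic_at g z0 -> analytic_at (fun z => f z - g z)%C z0.
Proof.
  intros Hf Hg.
  apply (analytic_at_ext_loc (fun z => f z + (-1) * g z)%C).
  - apply filter_forall. intros z. ring.
  - apply analytic_at_plus; [easy|]. now apply analytic_at_scal.
Qed.

Lemma csum_const_head (u : nat -> C) (N : nat) :
  (forall j, (0 < j)%nat -> u j = 0%C) -> csum u (S N) = u O.
Proof.
  intros H. rewrite csum_head. rewrite (csum_ext _ (fun j => 0 * 0)%C).
  - rewrite csum_scal. ring.
  - intros j _. rewrite H by lia. ring.
Qed.

Lemma analytic_at_const (a z0 : C) : analytic_at (fun _ => a) z0.
Proof.
  exists (fun j => match j with O => a | S _ => 0%C end).
  apply filter_forall. intros z. apply is_Cpseries_csum. intros e He.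
  exists 1%nat. intros [|N] HN; [lia|].
  rewrite csum_const_head.
  - simpl. replace (1 * a - a)%C with (RtoC 0) by ring. now rewrite Cmod_0.
  - intros [|j] Hj; [lia|]. ring.
Qed.

Lemma analytic_at_linear_mult (s : C) (f : C -> C) (z0 : C) :
  analytic_at f z0 -> analytic_at (fun z => (z - s) * f z)%C z0.
Proof.
  intros Hf.
  apply (analytic_at_ext_loc (fun z => (z - z0) * f z + (z0 - s) * f z)%C).
  - apply filter_forall. intros z. ring.
  - apply analytic_at_plus; [|now apply analytic_at_scal].
    destruct Hf as [c Hc]. exists (PS_incr_1 (V := C_NormedModule) c).
    revert Hc. apply filter_imp. intros z H.
    apply (is_pseries_incr_1 (K := C_AbsRing) (V := C_NormedModule) c (z - z0)%C (f z) H).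
Qed.

Lemma analytic_at_csum (f : nat -> C -> C) (N : nat) (z0 : C) :
  (forall j, (j < N)%nat -> analytic_at (f j) z0) ->
  analytic_at (fun z => csum (fun j => f j z) N) z0.
Proof.
  induction N as [|N IH]; intros H; simpl.
  - apply analytic_at_const.
  - apply analytic_at_plus; [apply IH; intros; apply H; lia|apply H; lia].
Qed.

(** * Integrals against [t^(-l)] are analytic in [l] *)

Lemma pow_fact_le_exp (x : R) (j : nat) : 0 <= x -> x ^ j / INR (fact j) <= exp x.
Proof.
  intros Hx. eapply Rle_trans; [|apply (exp_ge_taylor x j Hx)].
  assert (Hp : forall i, 0 <= x ^ i / INR (fact i)).
  { intros i. apply Rdiv_le_0_compat; [now apply pow_le|apply INR_fact_lt_0]. }
  destruct j as [|j]; [simpl; lra|].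
  rewrite tech5. apply Rle_trans with (0 + x ^ S j / INR (fact (S j))); [lra|].
  apply Rplus_le_compat_r. apply cond_pos_sum. exact Hp.
Qed.

Lemma Rabs_pow_le_exp (x d : R) (j : nat) :
  0 < d -> Rabs x ^ j <= INR (fact j) / d ^ j * exp (d * Rabs x).
Proof.
  intros Hd.
  assert (Hf := INR_fact_lt_0 j). assert (Hdj := pow_lt d j Hd).
  assert (H : (d * Rabs x) ^ j / INR (fact j) <= exp (d * Rabs x)).
  { apply pow_fact_le_exp. apply Rmult_le_pos; [lra|apply Rabs_pos]. }
  rewrite Rpow_mult_distr in H.
  replace (Rabs x ^ j) with (INR (fact j) / d ^ j * (d ^ j * Rabs x ^ j / INR (fact j))).
  2: field; split; lra.
  apply Rmult_le_compat_l; [|easy]. left. now apply Rdiv_lt_0_compat.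
Qed.

Definition powint (h : R -> C) (b : R) (F : (R -> Prop) -> Prop) (l : C) : C :=
  RInt_gen (V := C_R_CompleteNormedModule) (fun t => h t * Rcpow t (- l))%C (at_point b) F.

Definition is_powint (h : R -> C) (b : R) (F : (R -> Prop) -> Prop) (l w : C) : Prop :=
  is_CInt_gen (fun t => h t * Rcpow t (- l))%C (at_point b) F w.

Lemma powint_unique (h : R -> C) (b : R) (F : (R -> Prop) -> Prop) {FF : ProperFilter F} (l w : C) :
  is_powint h b F l w -> powint h b F l = w.
Proof.
  intros H. unfold powint.
  apply (is_RInt_gen_unique (V := C_R_CompleteNormedModule) (Fa := at_point b) (Fb := F) _ w H).
Qed.

Lemma powint_correct (h : R -> C) (b : R) (F : (R -> Prop) -> Prop) {FF : ProperFilter F} (l w : C) :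
  is_powint h b F l w -> is_powint h b F l (powint h b F l).
Proof. intros H. now rewrite (powint_unique h b F l w H). Qed.

Lemma is_CInt_gen_csum (f : nat -> R -> C) (I : nat -> C) (b : R) (F : (R -> Prop) -> Prop) {FF : Filter F} (N : nat) :
  (forall j, is_CInt_gen (f j) (at_point b) F (I j)) ->
  is_CInt_gen (fun t => csum (fun j => f j t) N) (at_point b) F (csum I N).
Proof.
  intros H. induction N as [|N IH]; simpl.
  - apply (is_CInt_gen_point (fun _ => 0%C) b F 0%C). intros e He. apply filter_forall. intros y.
    exists (RtoC 0). split.
    + replace (RtoC 0) with (RtoC 0 - RtoC 0)%C by ring.
      apply (is_CInt_derive (fun _ => RtoC 0) (fun _ => (RtoC 0 - RtoC 0)%C)).
      * intros t _. eapply is_Cderive_eq; [apply is_Cderive_const|ring].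
      * intros t _. apply Ccont_const.
    + replace (0 - 0)%C with (RtoC 0) by ring. now rewrite Cmod_0.
  - apply is_CInt_gen_plus; [easy|apply IH|apply H].
Qed.

(** Expand [t^(-l) = t^(-l0) exp(-(l-l0) ln t)] and integrate termwise.  The
    factor [exp(d |ln t|)] in the dominating function pays for the powers of
    [ln t] in every coefficient, and makes the integrated Taylor remainder
    geometrically small for [|l-l0| < d]. *)
Lemma powint_analytic (D : R -> Prop) (h : R -> C) (G : R -> R) (b : R)
  (F : (R -> Prop) -> Prop) {FF : ProperFilter F} (J : R) (l0 : C) (d : R) :
  0 < d -> interval_set D -> D b -> F D ->
  (forall t, D t -> 0 < t) ->
  (forall t, D t -> Ccont h t) ->
  (forall t, D t -> Cmod (h t) * Cmod (Rcpow t (- l0)) * exp (d * Rabs (ln t)) <= G t) ->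
  is_RInt_gen (V := R_NormedModule) G (at_point b) F J ->
  analytic_at (powint h b F) l0 /\
  forall l, Cmod (l - l0) < d -> is_powint h b F l (powint h b F l).
Proof.
  intros Hd HD Hb HF Hpos Hh HG HJ.
  set (g := fun t => (h t * Rcpow t (- l0))%C).
  assert (Hg : forall t, D t -> Ccont g t).
  { intros t Ht. apply Ccont_mult; [now apply Hh|apply Ccont_Rcpow; now apply Hpos]. }
  assert (HgG : forall t, D t -> Cmod (g t) * exp (d * Rabs (ln t)) <= G t).
  { intros t Ht. unfold g. rewrite Cmod_mult. now apply HG. }
  set (u := fun (j : nat) t => (g t * RtoC ((- ln t) ^ j / INR (fact j)))%C).
  assert (Hu : forall j t, D t -> Ccont (u j) t).
  { intros j t Ht. apply Ccont_mult; [now apply Hg|].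
    apply (Ccont_ext_loc (fun x => RtoC ((-1) ^ j / INR (fact j)) * RtoC (ln x ^ j))%C).
    - apply filter_forall. intros x. rewrite <- RtoC_mult. f_equal.
      replace (- ln x) with ((-1) * ln x) by ring. rewrite Rpow_mult_distr.
      field. apply INR_fact_neq_0.
    - apply Ccont_mult; [apply Ccont_const|apply Ccont_ln_pow; now apply Hpos]. }
  assert (Hc : forall j, exists c : C, is_CInt_gen (u j) (at_point b) F c).
  { intros j.
    destruct (CInt_gen_dominated D (u j) (fun t => / d ^ j * G t) b F (/ d ^ j * J)%R) as [c [Hc _]]; try assumption.
    - intros t Ht. now apply Hu.
    - intros t Ht. unfold u. rewrite Cmod_mult, Cmod_R.
      assert (Hf := INR_fact_lt_0 j). assert (Hdj := pow_lt d j Hd).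
      unfold Rdiv. rewrite Rabs_mult, <- RPow_abs, Rabs_Ropp, (Rabs_pos_eq (/ _)).
      2: left; now apply Rinv_0_lt_compat.
      apply Rle_trans with (/ d ^ j * (Cmod (g t) * exp (d * Rabs (ln t)))).
      2: apply Rmult_le_compat_l; [left; now apply Rinv_0_lt_compat|now apply HgG].
      replace (/ d ^ j * (Cmod (g t) * exp (d * Rabs (ln t)))) with
        (Cmod (g t) * (/ INR (fact j) * (INR (fact j) / d ^ j * exp (d * Rabs (ln t))))) by (field; lra).
      apply Rmult_le_compat_l; [apply Cmod_ge_0|].
      rewrite (Rmult_comm _ (/ _)).
      apply Rmult_le_compat_l; [left; now apply Rinv_0_lt_compat|].
      now apply Rabs_pow_le_exp.
    - apply (is_RInt_gen_scal (V := R_NormedModule) G (/ d ^ j) J HJ).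
    - now exists c. }
  set (c := fun j => proj1_sig (constructive_indefinite_description _ (Hc j))).
  assert (Hc' : forall j, is_CInt_gen (u j) (at_point b) F (c j)).
  { intros j. unfold c. destruct (constructive_indefinite_description _ (Hc j)) as [x Hx]. exact Hx. }
  assert (Hsplit : forall l t, (h t * Rcpow t (- l))%C = (g t * Cexp (- (l - l0) * RtoC (ln t)))%C).
  { intros l t. unfold g. rewrite <- Cmult_assoc. f_equal. fold (Rcpow t (- (l - l0))).
    rewrite <- Rcpow_plus. f_equal. ring. }
  assert (Hcont : forall l t, D t -> Ccont (fun t => h t * Rcpow t (- l))%C t).
  { intros l t Ht. apply Ccont_mult; [now apply Hh|apply Ccont_Rcpow; now apply Hpos]. }
  assert (Hrem : forall l t N, D t -> Cmod (l - l0) < d ->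
     Cmod (h t * Rcpow t (- l) - csum (fun j => (l - l0) ^ j * u j t)%C N)
     <= (Cmod (l - l0) / d) ^ N * G t).
  { intros l t N Ht Hl.
    assert (E : csum (fun j => (l - l0) ^ j * u j t)%C N =
                (g t * exp_taylor (- (l - l0) * RtoC (ln t)) N 1)%C).
    { unfold exp_taylor. rewrite <- csum_scal. apply csum_ext. intros j _. unfold u.
      replace (- (l - l0) * RtoC (ln t))%C with ((l - l0) * RtoC (- ln t))%C by (rewrite RtoC_opp; ring).
      rewrite Cpow_mult_l, <- RtoC_pow, pow1.
      replace ((- ln t) ^ j / INR (fact j))%R with ((- ln t) ^ j * (1 / INR (fact j)))%R
        by (field; apply INR_fact_neq_0).
      rewrite RtoC_mult. ring. }
    rewrite E, Hsplit.
    replace (g t * Cexp (- (l - l0) * RtoC (ln t)) - g t * exp_taylor (- (l - l0) * RtoC (ln t)) N 1)%C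
      with (g t * (Cexp (- (l - l0) * RtoC (ln t) * RtoC 1) - exp_taylor (- (l - l0) * RtoC (ln t)) N 1))%C.
    2: rewrite Cmult_1_r; ring.
    rewrite Cmod_mult.
    apply Rle_trans with (Cmod (g t) * ((Cmod (l - l0) / d) ^ N * exp (d * Rabs (ln t) * 1))).
    - apply Rmult_le_compat_l; [apply Cmod_ge_0|].
      assert (H0 := Cmod_ge_0 (l - l0)).
      apply Cexp_taylor_bound; [| | |lra].
      + split; [now apply Rdiv_le_0_compat|]. apply Rmult_le_reg_r with d; [easy|].
        unfold Rdiv. rewrite Rmult_assoc, Rinv_l; lra.
      + apply Rmult_le_pos; [lra|apply Rabs_pos].
      + rewrite Cmod_mult, Cmod_opp, Cmod_R. right. field. lra.
    - rewrite Rmult_1_r.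
      replace (Cmod (g t) * ((Cmod (l - l0) / d) ^ N * exp (d * Rabs (ln t))))
        with ((Cmod (l - l0) / d) ^ N * (Cmod (g t) * exp (d * Rabs (ln t)))) by ring.
      apply Rmult_le_compat_l; [|now apply HgG].
      apply pow_le. apply Rdiv_le_0_compat; [apply Cmod_ge_0|easy]. }
  assert (Hex : forall l, Cmod (l - l0) < d -> is_powint h b F l (powint h b F l)).
  { intros l Hl.
    destruct (CInt_gen_dominated D (fun t => h t * Rcpow t (- l))%C G b F J) as [w [Hw _]]; try assumption.
    - intros t Ht. now apply Hcont.
    - intros t Ht. pose proof (Hrem l t O Ht Hl) as H. simpl in H.
      replace (h t * Rcpow t (- l) - 0)%C with (h t * Rcpow t (- l))%C in H by ring. lra.
    - now apply (powint_correct h b F l w). }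
  split; [|exact Hex].
  exists c. apply (locally_C_intro l0 d); [easy|]. intros l Hl.
  assert (H0 := Cmod_ge_0 (l - l0)).
  apply (is_Cpseries_geom c (l - l0) _ (Cmod (l - l0) / d) (Rabs J)).
  { split; [now apply Rdiv_le_0_compat|]. apply Rmult_lt_reg_r with d; [easy|].
    unfold Rdiv. rewrite Rmult_assoc, Rinv_l; lra. }
  intros N.
  assert (Hr : is_CInt_gen (fun t => h t * Rcpow t (- l) - csum (fun j => (l - l0) ^ j * u j t) N)%C
     (at_point b) F (powint h b F l - csum (fun j => (l - l0) ^ j * c j) N)%C).
  { apply is_CInt_gen_minus; [typeclasses eauto|now apply Hex|].
    apply (is_CInt_gen_csum (fun j t => (l - l0) ^ j * u j t)%C); [typeclasses eauto|]. intros j.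
    apply is_CInt_gen_scal; [typeclasses eauto|apply Hc']. }
  set (q := (Cmod (l - l0) / d) ^ N) in *.
  destruct (CInt_gen_dominated D (fun t => h t * Rcpow t (- l) - csum (fun j => (l - l0) ^ j * u j t) N)%C
     (fun t => q * G t) b F (q * J)%R) as [w [Hw Hw']]; try assumption.
  - intros t Ht. apply Ccont_minus; [now apply Hcont|].
    clear -Ht Hu. induction N as [|N IH]; simpl; [apply (Ccont_const 0%C)|].
    apply Ccont_plus; [easy|]. apply Ccont_mult; [apply Ccont_const|now apply Hu].
  - intros t Ht. now apply Hrem.
  - apply (is_RInt_gen_scal (V := R_NormedModule) G q J HJ).
  - rewrite (is_CInt_gen_unique _ b F _ _ Hr Hw).
    eapply Rle_trans; [exact Hw'|]. rewrite Rabs_mult, (Rabs_pos_eq q); [lra|].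
    apply pow_le. now apply Rdiv_le_0_compat.
Qed.

(** * Power series near their centre and the identity theorem *)

Lemma bounded_of_eventually (u : nat -> R) (A : R) (N0 : nat) :
  (forall j, (N0 <= j)%nat -> u j <= A) -> exists B, 0 <= B /\ forall j, u j <= B.
Proof.
  revert u. induction N0 as [|N0 IH]; intros u H.
  - exists (Rmax A 0). split; [apply Rmax_r|]. intros j.
    eapply Rle_trans; [apply H; lia|apply Rmax_l].
  - destruct (IH (fun j => u (S j))) as [B [HB H']].
    + intros j Hj. apply H. lia.
    + exists (Rmax B (u O)). split; [eapply Rle_trans; [exact HB|apply Rmax_l]|].
      intros [|j]; [apply Rmax_r|]. eapply Rle_trans; [apply H'|apply Rmax_l].
Qed.

Lemma Cpseries_coef_bound (c : nat -> C) (z l : C) :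
  is_Cpseries c z l -> exists B, 0 <= B /\ forall j, Cmod (c j) * Cmod z ^ j <= B.
Proof.
  intros H. destruct (proj1 (is_Cpseries_csum _ _ _) H 1 Rlt_0_1) as [N0 H0].
  apply (bounded_of_eventually _ 2 N0). intros j Hj.
  rewrite <- Cmod_pow, <- Cmod_mult.
  pose proof (H0 j Hj) as H1. pose proof (H0 (S j) ltac:(lia)) as H2. simpl in H2.
  set (s := csum (fun j => z ^ j * c j)%C j) in *.
  replace (c j * z ^ j)%C with ((s + z ^ j * c j - l) + (l - s))%C by ring.
  eapply Rle_trans; [apply Cmod_triangle|]. rewrite (Cmod_sym l s). lra.
Qed.

(** Compare the tail with a geometric series of ratio at most [1/2]. *)
Lemma Cpseries_tail (c : nat -> C) (z l : C) (r B : R) :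
  0 < r -> (forall j, Cmod (c j) * r ^ j <= B) -> Cmod z <= r / 2 -> is_Cpseries c z l ->
  forall M, Cmod (l - csum (fun j => z ^ j * c j)%C M) <= 2 * B * (Cmod z / r) ^ M.
Proof.
  intros Hr HB Hz Hl M.
  set (s := csum (fun j => z ^ j * c j)%C) in *. set (x := Cmod z / r).
  assert (HzM := Cmod_ge_0 z).
  assert (Hx : 0 <= x <= / 2).
  { unfold x. split; [now apply Rdiv_le_0_compat|]. apply Rmult_le_reg_r with r; [easy|].
    unfold Rdiv. rewrite Rmult_assoc, Rinv_l; lra. }
  assert (HB0 : 0 <= B).
  { eapply Rle_trans; [|apply (HB O)]. simpl. pose proof (Cmod_ge_0 (c O)). lra. }
  assert (HxM : 0 <= x ^ M) by (apply pow_le; lra).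
  assert (Hterm : forall j, Cmod (z ^ j * c j) <= B * x ^ j).
  { intros j. rewrite Cmod_mult, Cmod_pow. unfold x, Rdiv. rewrite Rpow_mult_distr, pow_inv.
    assert (0 < r ^ j) by now apply pow_lt.
    replace (Cmod z ^ j * Cmod (c j)) with (Cmod (c j) * r ^ j * (Cmod z ^ j * / r ^ j)) by (field; lra).
    apply Rmult_le_compat_r; [|apply HB].
    apply Rmult_le_pos; [now apply pow_le|left; now apply Rinv_0_lt_compat]. }
  assert (Hk : forall k, Cmod (s (M + k)%nat - s M) <= B * x ^ M * (2 - 2 * (/ 2) ^ k)).
  { induction k as [|k IH].
    - rewrite Nat.add_0_r. replace (s M - s M)%C with (RtoC 0) by ring. rewrite Cmod_0. simpl. lra.
    - rewrite Nat.add_succ_r. unfold s. simpl csum. fold s.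
      replace (s (M + k)%nat + z ^ (M + k) * c (M + k)%nat - s M)%C
        with ((s (M + k)%nat - s M) + z ^ (M + k) * c (M + k)%nat)%C by ring.
      eapply Rle_trans; [apply Cmod_triangle|].
      specialize (Hterm (M + k)%nat). rewrite pow_add in Hterm.
      assert (x ^ k <= (/ 2) ^ k) by (apply pow_incr; lra).
      assert (x ^ M * x ^ k <= x ^ M * (/ 2) ^ k) by (apply Rmult_le_compat_l; lra).
      assert (B * (x ^ M * x ^ k) <= B * (x ^ M * (/ 2) ^ k)) by (apply Rmult_le_compat_l; lra).
      simpl. lra. }
  apply le_epsilon. intros e He.
  destruct (proj1 (is_Cpseries_csum _ _ _) Hl e He) as [N0 H0].
  specialize (H0 (M + N0)%nat ltac:(lia)). fold s in H0. specialize (Hk N0).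
  eapply Rle_trans; [apply (Cmod_triangle_sub _ (s (M + N0)%nat))|].
  rewrite (Cmod_sym l).
  assert (0 <= B * x ^ M * (2 * (/ 2) ^ N0)).
  { apply Rmult_le_pos; [now apply Rmult_le_pos|]. assert (0 <= (/ 2) ^ N0) by (apply pow_le; lra). lra. }
  lra.
Qed.

Lemma analytic_at_taylor (f : C -> C) (z0 : C) :
  analytic_at f z0 -> exists (c : nat -> C) (r B : R), 0 < r /\ 0 <= B /\
    forall z, Cmod (z - z0) < r -> is_Cpseries c (z - z0)%C (f z) /\
      forall M, Cmod (f z - csum (fun j => (z - z0) ^ j * c j)%C M) <= B * (Cmod (z - z0) / r) ^ M.
Proof.
  intros [c Hc]. apply locally_C_elim in Hc. destruct Hc as [r [Hr Hc]].
  assert (E : Cmod (z0 + RtoC (r / 2) - z0) = r / 2).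
  { replace (z0 + RtoC (r / 2) - z0)%C with (RtoC (r / 2)) by ring. rewrite Cmod_R. apply Rabs_pos_eq. lra. }
  destruct (Cpseries_coef_bound c _ _ (Hc (z0 + RtoC (r / 2))%C ltac:(lra))) as [B [HB0 HB]].
  rewrite E in HB.
  exists c, (r / 4), (2 * B). split; [lra|]. split; [lra|]. intros z Hz.
  split; [apply Hc; lra|]. intros M.
  eapply Rle_trans; [apply (Cpseries_tail c (z - z0) (f z) (r / 2) B)|]; try assumption; try lra.
  - apply Hc. lra.
  - apply Rmult_le_compat_l; [lra|]. apply pow_incr.
    assert (H0 := Cmod_ge_0 (z - z0)). split; [apply Rdiv_le_0_compat; lra|].
    apply Rmult_le_compat_l; [easy|]. apply Rinv_le_contravar; lra.
Qed.

Lemma analytic_at_lim (f : C -> C) (z0 : C) (c : nat -> C) :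
  locally z0 (fun z => is_Cpseries c (z - z0)%C (f z)) ->
  c O = f z0 /\ filterlim f (locally z0) (locally (f z0)).
Proof.
  intros Hc.
  assert (Hc' := Hc). apply locally_C_elim in Hc'. destruct Hc' as [r0 [Hr0 Hc']].
  assert (E0 : c O = f z0).
  { assert (H0 : Cmod (z0 - z0) < r0) by (replace (z0 - z0)%C with (RtoC 0) by ring; rewrite Cmod_0; lra).
    specialize (Hc' z0 H0).
    cut (c O - f z0 = 0)%C. { intros E. replace (c O) with (c O - f z0 + f z0)%C by ring. rewrite E. ring. }
    apply Cmod_lt_eq0. intros e He.
    destruct (proj1 (is_Cpseries_csum _ _ _) Hc' e He) as [N0 HN].
    specialize (HN (S N0) ltac:(lia)). rewrite csum_const_head in HN.
    - simpl in HN. rewrite Cmult_1_l in HN. lra.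
    - intros [|j] Hj; [lia|]. replace (z0 - z0)%C with (RtoC 0) by ring. simpl. ring. }
  split; [easy|].
  assert (E : Cmod (z0 + RtoC (r0 / 2) - z0) = r0 / 2).
  { replace (z0 + RtoC (r0 / 2) - z0)%C with (RtoC (r0 / 2)) by ring. rewrite Cmod_R. apply Rabs_pos_eq. lra. }
  destruct (Cpseries_coef_bound c _ _ (Hc' (z0 + RtoC (r0 / 2))%C ltac:(lra))) as [B [HB0 HB]].
  rewrite E in HB.
  apply (filterlim_C (locally z0) f (f z0)). intros e He.
  set (K := 2 * B / (r0 / 2) + 1).
  assert (HK : 0 < K).
  { unfold K. assert (0 <= 2 * B / (r0 / 2)) by (apply Rdiv_le_0_compat; lra). lra. }
  apply (locally_C_intro z0 (Rmin (r0 / 4) (e / K))).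
  { apply Rmin_pos; [lra|now apply Rdiv_lt_0_compat]. }
  intros z Hz.
  assert (Hz1 : Cmod (z - z0) < r0 / 4) by (eapply Rlt_le_trans; [exact Hz|apply Rmin_l]).
  assert (Hz2 : Cmod (z - z0) < e / K) by (eapply Rlt_le_trans; [exact Hz|apply Rmin_r]).
  pose proof (Cpseries_tail c (z - z0) (f z) (r0 / 2) B ltac:(lra) HB ltac:(lra) (Hc' z ltac:(lra)) 1%nat) as HT.
  simpl in HT. rewrite E0 in HT.
  replace (f z - (0 + 1 * f z0))%C with (f z - f z0)%C in HT by ring.
  assert (H0 := Cmod_ge_0 (z - z0)).
  apply Rle_lt_trans with (K * Cmod (z - z0)).
  - eapply Rle_trans; [exact HT|]. unfold K.
    apply Rle_trans with (2 * B / (r0 / 2) * Cmod (z - z0)); [right; field; lra|].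
    apply Rmult_le_compat_r; lra.
  - replace e with (K * (e / K)) by (field; lra). apply Rmult_lt_compat_l; lra.
Qed.

Lemma least_nat (P : nat -> Prop) :
  (exists n, P n) -> exists n, P n /\ forall j, (j < n)%nat -> ~ P j.
Proof.
  intros [n Hn]. revert Hn. induction n as [n IH] using lt_wf_ind. intros Hn.
  destruct (classic (exists j, (j < n)%nat /\ P j)) as [[j [Hj HP]]|H].
  - now apply (IH j).
  - exists n. split; [easy|]. intros j Hj HP. apply H. now exists j.
Qed.

(** Near the centre the first nonzero coefficient dominates the rest of the
    series. *)
Lemma analytic_zero_or_isolated (f : C -> C) (z0 : C) :
  analytic_at f z0 ->
  locally z0 (fun z => f z = 0%C) \/
  exists r, 0 < r /\ forall z, 0 < Cmod (z - z0) < r -> f z <> 0%C.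
Proof.
  intros Hf. destruct (analytic_at_taylor f z0 Hf) as [c [r [B [Hr [HB H]]]]].
  destruct (classic (exists j, c j <> 0%C)) as [Hex|Hall].
  - right. destruct (least_nat _ Hex) as [M [HM Hmin]].
    assert (HcM : 0 < Cmod (c M)) by now apply Cmod_gt_0.
    assert (Hmin' : forall j, (j < M)%nat -> c j = 0%C).
    { intros j Hj. apply NNPP. now apply Hmin. }
    assert (HrM : 0 < r ^ S M) by now apply pow_lt.
    exists (Rmin r (Cmod (c M) * r ^ S M / (B + 1))). split.
    { apply Rmin_pos; [easy|]. apply Rdiv_lt_0_compat; [now apply Rmult_lt_0_compat|lra]. }
    intros z [Hz0 Hz] Hfz.
    assert (Hz1 : Cmod (z - z0) < r) by (eapply Rlt_le_trans; [exact Hz|apply Rmin_l]).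
    assert (Hz2 : Cmod (z - z0) < Cmod (c M) * r ^ S M / (B + 1)) by (eapply Rlt_le_trans; [exact Hz|apply Rmin_r]).
    destruct (H z Hz1) as [_ HT]. specialize (HT (S M)). cbn [csum] in HT.
    rewrite (csum_ext _ (fun j => 0 * 0)%C), csum_scal in HT.
    2:{ intros j Hj. rewrite Hmin' by easy. ring. }
    rewrite Hfz in HT.
    replace (0 - (0 * csum (fun _ => 0) M + (z - z0) ^ M * c M))%C with (- ((z - z0) ^ M * c M))%C in HT by ring.
    rewrite Cmod_opp, Cmod_mult, Cmod_pow in HT.
    unfold Rdiv in HT. rewrite Rpow_mult_distr, pow_inv in HT.
    set (x := Cmod (z - z0)) in *.
    assert (HxM : 0 < x ^ M) by now apply pow_lt.
    assert (HT' : Cmod (c M) <= B * x / r ^ S M).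
    { apply Rmult_le_reg_l with (x ^ M); [easy|]. eapply Rle_trans; [exact HT|].
      right. simpl (x ^ S M). field. lra. }
    assert (HT2 : Cmod (c M) * r ^ S M <= B * x).
    { apply Rmult_le_compat_r with (r := r ^ S M) in HT'; [|lra].
      replace (B * x / r ^ S M * r ^ S M) with (B * x) in HT' by (field; lra). easy. }
    assert (HT3 : (B + 1) * x < Cmod (c M) * r ^ S M).
    { apply Rmult_lt_compat_l with (r := B + 1) in Hz2; [|lra].
      replace ((B + 1) * (Cmod (c M) * r ^ S M / (B + 1))) with (Cmod (c M) * r ^ S M) in Hz2 by (field; lra). easy. }
    lra.
  - left. apply (locally_C_intro z0 r); [easy|]. intros z Hz.
    destruct (H z Hz) as [_ HT]. apply Cmod_lt_eq0. intros e He.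
    assert (H0 := Cmod_ge_0 (z - z0)).
    destruct (pow_lt_eps (Cmod (z - z0) / r) B e) as [N0 HN].
    + split; [now apply Rdiv_le_0_compat|]. apply Rmult_lt_reg_r with r; [easy|].
      unfold Rdiv. rewrite Rmult_assoc, Rinv_l; lra.
    + easy.
    + specialize (HN N0 (Nat.le_refl _)). specialize (HT N0).
      rewrite (csum_ext _ (fun j => 0 * 0)%C), csum_scal in HT.
      2:{ intros j Hj. replace (c j) with (RtoC 0); [ring|]. symmetry. apply NNPP. intros Hn. apply Hall. now exists j. }
      replace (f z - 0 * csum (fun _ => 0) N0)%C with (f z) in HT by ring. lra.
Qed.

(** Connectedness of a segment, in the form that suits propagation along a path:
    take the supremum of the initial segments on which [P] holds. *)
Lemma real_induction (P : R -> Prop) (a b : R) :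
  a <= b -> P a ->
  (forall x, a <= x < b -> P x -> exists d, 0 < d /\ forall y, x < y < x + d -> P y) ->
  (forall x, a < x <= b -> (forall y, a <= y < x -> P y) -> P x) ->
  P b.
Proof.
  intros Hab Ha Hopen Hclosed.
  set (E := fun x => a <= x <= b /\ forall y, a <= y <= x -> P y).
  destruct (completeness E) as [s [Hub Hlub]].
  - exists b. intros x [Hx _]. lra.
  - exists a. split; [lra|]. intros y Hy. now replace y with a by lra.
  - assert (Hsa : a <= s).
    { apply Hub. split; [lra|]. intros y Hy. now replace y with a by lra. }
    assert (Hsb : s <= b) by (apply Hlub; intros x [Hx _]; lra).
    assert (Hbelow : forall y, a <= y < s -> P y).
    { intros y Hy. apply NNPP. intros Hn.
      assert (s <= y); [|lra]. apply Hlub. intros x [Hx HP].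
      apply Rnot_lt_le. intros Hlt. apply Hn. apply HP. lra. }
    assert (Hs : P s).
    { destruct (Req_dec s a) as [->|Hne]; [easy|]. apply Hclosed; [lra|easy]. }
    destruct (Req_dec s b) as [<-|Hne]; [easy|].
    destruct (Hopen s) as [d [Hd HP]]; [lra|easy|].
    set (s' := Rmin b (s + d / 2)).
    assert (s < s') by (apply Rmin_glb_lt; lra).
    assert (s' <= s + d / 2) by apply Rmin_r.
    assert (s' <= b) by apply Rmin_l.
    assert (s' <= s); [|lra]. apply Hub. split; [lra|].
    intros y Hy. destruct (Rlt_dec y s) as [|Hys]; [now apply Hbelow|].
    destruct (Req_dec y s) as [->|]; [easy|]. apply HP. lra.
Qed.

(** The points of the segment near which [f] vanishes form an open set; it is also
    closed, because zeros accumulating at a point are not isolated there. *)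
Lemma identity_segment (f : C -> C) (p q : C) :
  (forall t, 0 <= t <= 1 -> analytic_at f (p + RtoC t * (q - p))) ->
  locally p (fun z => f z = 0%C) -> locally q (fun z => f z = 0%C).
Proof.
  intros Han Hp.
  destruct (classic (q - p = 0)%C) as [E|Hne].
  { replace q with p; [easy|]. replace q with (p + (q - p))%C by ring. rewrite E. ring. }
  apply Cmod_gt_0 in Hne. set (L := Cmod (q - p)) in *.
  assert (Hdist : forall s t, Cmod (p + RtoC s * (q - p) - (p + RtoC t * (q - p))) = Rabs (s - t) * L).
  { intros s t. replace (p + RtoC s * (q - p) - (p + RtoC t * (q - p)))%C with (RtoC (s - t) * (q - p))%C
      by (rewrite RtoC_minus; ring). now rewrite Cmod_mult, Cmod_R. }
  replace q with (p + RtoC 1 * (q - p))%C by ring.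
  apply (real_induction (fun t => locally (p + RtoC t * (q - p))%C (fun z => f z = 0%C)) 0 1); [lra| | |].
  - now replace (p + RtoC 0 * (q - p))%C with p by ring.
  - intros t Ht Hl. apply locally_C_elim in Hl. destruct Hl as [r [Hr Hl]].
    exists (r / L). split; [now apply Rdiv_lt_0_compat|]. intros y Hy.
    assert (HyL : Rabs (y - t) * L < r).
    { rewrite Rabs_pos_eq by lra. replace r with (r / L * L) by (field; lra).
      apply Rmult_lt_compat_r; lra. }
    apply (locally_C_intro _ (r - Rabs (y - t) * L)); [lra|].
    intros w Hw. apply Hl. eapply Rle_lt_trans; [apply (Cmod_triangle_sub _ (p + RtoC y * (q - p)))|].
    rewrite Hdist. lra.
  - intros t Ht Hall.
    destruct (analytic_zero_or_isolated f (p + RtoC t * (q - p)) ltac:(apply Han; lra)) as [H|[r [Hr H]]]; [easy|].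
    exfalso.
    set (y := Rmax 0 (t - r / L / 2)).
    assert (HrL : 0 < r / L) by now apply Rdiv_lt_0_compat.
    assert (Hy1 : 0 <= y) by apply Rmax_l.
    assert (Hy2 : t - r / L / 2 <= y) by apply Rmax_r.
    assert (Hy3 : y < t) by (apply Rmax_lub_lt; lra).
    apply (H (p + RtoC y * (q - p))%C).
    + rewrite Hdist. rewrite Rabs_left by lra. split; [apply Rmult_lt_0_compat; lra|].
      apply Rle_lt_trans with (r / L / 2 * L).
      * apply Rmult_le_compat_r; lra.
      * replace (r / L / 2 * L) with (r / 2) by (field; lra). lra.
    + specialize (Hall y ltac:(lra)). now apply locally_singleton in Hall.
Qed.

(** A punctured disc is not star-shaped, but two of its points are joined by a
    segment avoiding the centre unless they lie on opposite rays; then one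
    detours through a quarter turn of the first point. *)
Lemma identity_punctured_disc (f : C -> C) (z0 p q : C) (r : R) :
  (forall z, 0 < Cmod (z - z0) < r -> analytic_at f z) ->
  0 < Cmod (p - z0) < r -> 0 < Cmod (q - z0) < r ->
  locally p (fun z => f z = 0%C) -> locally q (fun z => f z = 0%C).
Proof.
  intros Han Hp Hq Hfp.
  assert (Hseg : forall u v, Cmod (u - z0) < r -> Cmod (v - z0) < r ->
    (forall t, 0 <= t <= 1 -> (u + RtoC t * (v - u) - z0 <> 0)%C) ->
    locally u (fun z => f z = 0%C) -> locally v (fun z => f z = 0%C)).
  { intros u v Hu Hv Hav. apply identity_segment. intros t Ht. apply Han. split.
    - apply Cmod_gt_0. now apply Hav.
    - replace (u + RtoC t * (v - u) - z0)%C with (RtoC (1 - t) * (u - z0) + RtoC t * (v - z0))%C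
        by (rewrite RtoC_minus; ring).
      eapply Rle_lt_trans; [apply Cmod_triangle|]. rewrite !Cmod_mult, !Cmod_R, !Rabs_pos_eq by lra.
      destruct (Req_dec t 0) as [->|]; [lra|].
      apply Rlt_le_trans with ((1 - t) * r + t * r); [|lra].
      apply Rplus_le_lt_compat; [apply Rmult_le_compat_l|apply Rmult_lt_compat_l]; lra. }
  destruct (classic (exists t, 0 <= t <= 1 /\ (p + RtoC t * (q - p) - z0 = 0)%C)) as [[t [Ht E]]|Hn].
  2:{ apply (Hseg p q); [lra|lra| |easy]. intros t Ht E. apply Hn. now exists t. }
  assert (Hpn : (p - z0)%C <> 0%C) by (apply Cmod_gt_0; lra).
  assert (Hqn : (q - z0)%C <> 0%C) by (apply Cmod_gt_0; lra).
  set (u := (p - z0)%C) in *. set (v := (q - z0)%C) in *.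
  assert (E' : (RtoC (1 - t) * u + RtoC t * v)%C = 0%C).
  { rewrite <- E. unfold u, v. rewrite RtoC_minus. ring. }
  assert (Ht0 : t <> 0).
  { intros ->. apply Hpn. rewrite <- E'. rewrite Rminus_0_r. ring. }
  assert (Ht1 : t <> 1).
  { intros ->. apply Hqn. rewrite <- E'. replace (1 - 1) with 0 by ring. ring. }
  set (s := (1 - t) / t).
  assert (Hs : 0 < s) by (apply Rdiv_lt_0_compat; lra).
  assert (Ev : v = (- RtoC s * u)%C).
  { assert (Htc : RtoC t <> 0%C) by (intros H; apply RtoC_inj in H; lra).
    unfold s. rewrite RtoC_div by easy.
    transitivity (/ RtoC t * ((RtoC (1 - t) * u + RtoC t * v) - RtoC (1 - t) * u))%C; [field; easy|].
    rewrite E'. field. easy. }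
  assert (Hnz : forall a b : R, a <> 0 \/ b <> 0 -> ((RtoC a + RtoC b * Ci) * u)%C <> 0%C).
  { intros a b Hab. apply Cmult_neq_0; [|easy]. intros H.
    assert (Ha : Re (RtoC a + RtoC b * Ci) = 0) by now rewrite H.
    assert (Hb : Im (RtoC a + RtoC b * Ci) = 0) by now rewrite H.
    unfold Re, Im in *. simpl in *. destruct Hab; lra. }
  (* q lies on the ray opposite to p: go through the quarter turn w of p *)
  set (w := (z0 + Ci * u)%C).
  assert (Hw : Cmod (w - z0) < r).
  { unfold w. replace (z0 + Ci * u - z0)%C with (Ci * u)%C by ring. rewrite Cmod_mult, Cmod_Ci. lra. }
  apply (Hseg w q); [easy|apply Hq| |].
  - intros x Hx. replace (w + RtoC x * (q - w) - z0)%C with ((RtoC (- x * s) + RtoC (1 - x) * Ci) * u)%C.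
    + apply Hnz. destruct (Req_dec x 0) as [->|Hx0]; [right; intros ?; lra|]. left.
      assert (0 < x * s) by (apply Rmult_lt_0_compat; lra). intros ?; lra.
    + replace q with (z0 + v)%C by (unfold v; ring). rewrite Ev. unfold w.
      rewrite RtoC_mult, RtoC_minus, RtoC_opp. ring.
  - apply (Hseg p w); [apply Hp|easy| |easy].
    intros x Hx. replace (p + RtoC x * (w - p) - z0)%C with ((RtoC (1 - x) + RtoC x * Ci) * u)%C.
    + apply Hnz. destruct (Req_dec x 0) as [->|]; [left|right]; intros ?; lra.
    + replace p with (z0 + u)%C by (unfold u; ring). unfold w. rewrite RtoC_minus. ring.
Qed.

(** Isolated singularities do not obstruct the propagation of zeros: near each
    point of the real segment the function lives on a punctured disc. *)
Lemma identity_real_axis (f : C -> C) (x0 x1 : R) :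
  x0 <= x1 ->
  (forall x, x0 <= x <= x1 -> locally' (RtoC x) (analytic_at f)) ->
  locally (RtoC x0) (fun z => f z = 0%C) ->
  exists r, 0 < r /\ forall z, 0 < Cmod (z - RtoC x1) < r -> f z = 0%C.
Proof.
  intros Hx Han H0.
  apply (real_induction (fun x => exists r, 0 < r /\ forall z, 0 < Cmod (z - RtoC x) < r -> f z = 0%C) x0 x1); [easy| | |].
  - apply locally_C_elim in H0. destruct H0 as [r [Hr H0]]. exists r. split; [easy|]. intros z Hz. apply H0. lra.
  - intros x _ [r [Hr Hz]]. exists r. split; [easy|]. intros y Hy.
    exists (Rmin (y - x) (r - (y - x))). split; [apply Rmin_pos; lra|]. intros z [Hz1 Hz2]. apply Hz.
    assert (H1 : Cmod (z - RtoC y) < y - x) by (eapply Rlt_le_trans; [exact Hz2|apply Rmin_l]).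
    assert (H2 : Cmod (z - RtoC y) < r - (y - x)) by (eapply Rlt_le_trans; [exact Hz2|apply Rmin_r]).
    assert (E : Cmod (RtoC y - RtoC x) = y - x) by (rewrite <- RtoC_minus, Cmod_R; apply Rabs_pos_eq; lra).
    pose proof (Cmod_triangle_sub (RtoC y) z (RtoC x)) as T1. rewrite (Cmod_sym (RtoC y) z) in T1.
    pose proof (Cmod_triangle_sub z (RtoC y) (RtoC x)) as T2. lra.
  - intros x Hx' Hall.
    specialize (Han x ltac:(lra)). apply locally_C_elim in Han. destruct Han as [r [Hr Han]].
    assert (Han' : forall z, 0 < Cmod (z - RtoC x) < r -> analytic_at f z).
    { intros z [Hz1 Hz2]. apply Han; [easy|]. intros ->. replace (RtoC x - RtoC x)%C with (RtoC 0) in Hz1 by ring.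
      rewrite Cmod_0 in Hz1. lra. }
    set (y := Rmax x0 (x - r / 2)).
    assert (Hy1 : x0 <= y) by apply Rmax_l.
    assert (Hy2 : x - r / 2 <= y) by apply Rmax_r.
    assert (Hy3 : y < x) by (apply Rmax_lub_lt; lra).
    destruct (Hall y ltac:(lra)) as [rho [Hrho Hfy]].
    set (e := Rmin rho (x - y) / 2).
    assert (He1 : e <= rho / 2) by (unfold e; pose proof (Rmin_l rho (x - y)); lra).
    assert (He2 : e <= (x - y) / 2) by (unfold e; pose proof (Rmin_r rho (x - y)); lra).
    assert (He0 : 0 < e) by (unfold e; assert (0 < Rmin rho (x - y)) by (apply Rmin_pos; lra); lra).
    assert (Hp : locally (RtoC (y + e)) (fun z => f z = 0%C)).
    { apply (locally_C_intro _ e); [easy|]. intros z Hz. apply Hfy.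
      assert (E : Cmod (RtoC (y + e) - RtoC y) = e).
      { rewrite <- RtoC_minus, Cmod_R. replace (y + e - y) with e by ring. apply Rabs_pos_eq. lra. }
      pose proof (Cmod_triangle_sub z (RtoC (y + e)) (RtoC y)) as T1.
      pose proof (Cmod_triangle_sub (RtoC (y + e)) z (RtoC y)) as T2.
      rewrite (Cmod_sym _ z) in T2. lra. }
    exists r. split; [easy|]. intros z Hz.
    apply (locally_singleton z (fun z => f z = 0%C)).
    apply (identity_punctured_disc f (RtoC x) (RtoC (y + e)) z r); try assumption.
    rewrite <- RtoC_minus, Cmod_R, Rabs_left by lra. lra.
Qed.

(** * Poles *)

Lemma Cminus_neq0 (x y : C) : x <> y -> (x - y)%C <> 0%C.
Proof. intros H E. apply H. replace x with (x - y + y)%C by ring. rewrite E. ring. Qed.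

(** Dividing the power series by the nonzero constant-plus-linear factor
    [w - (l - l0)], [w = s - l0], amounts to the recursion
    [g_j = (c_j + g_(j-1)) / w] for the coefficients. *)
Lemma analytic_at_div_linear (f : C -> C) (s l0 : C) :
  s <> l0 -> analytic_at f l0 -> analytic_at (fun l => f l * / (s - l))%C l0.
Proof.
  intros Hs [c Hc].
  set (w := (s - l0)%C). assert (Hw : w <> 0%C) by now apply Cminus_neq0.
  assert (HwM : 0 < Cmod w) by now apply Cmod_gt_0.
  apply locally_C_elim in Hc. destruct Hc as [r [Hr Hc]].
  set (rho := Rmin (r / 2) (Cmod w / 2)).
  assert (Hrho : 0 < rho) by (apply Rmin_pos; lra).
  assert (Hrho1 : rho <= r / 2) by apply Rmin_l.
  assert (Hrho2 : rho <= Cmod w / 2) by apply Rmin_r.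
  assert (E : Cmod (l0 + RtoC rho - l0) = rho).
  { replace (l0 + RtoC rho - l0)%C with (RtoC rho) by ring. rewrite Cmod_R. apply Rabs_pos_eq. lra. }
  destruct (Cpseries_coef_bound c _ _ (Hc (l0 + RtoC rho)%C ltac:(lra))) as [B [HB0 HB]].
  rewrite E in HB.
  set (g := fix g (j : nat) : C := match j with O => c O / w | S i => (c (S i) + g i) / w end%C).
  assert (Hg : forall j, Cmod (g j) * rho ^ j <= 2 * B / Cmod w).
  { assert (HBw : 0 <= B / Cmod w) by now apply Rdiv_le_0_compat.
    induction j as [|j IH].
    - simpl g. rewrite Cmod_div by easy. specialize (HB O). simpl in *.
      apply Rle_trans with (B / Cmod w); [|unfold Rdiv in *; lra].
      rewrite Rmult_1_r in *. apply Rmult_le_compat_r; [left; now apply Rinv_0_lt_compat|easy].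
    - change (g (S j)) with ((c (S j) + g j) / w)%C. rewrite Cmod_div by easy.
      apply Rle_trans with ((Cmod (c (S j)) * rho ^ S j + rho * (Cmod (g j) * rho ^ j)) / Cmod w).
      + replace (Cmod (c (S j) + g j) / Cmod w * rho ^ S j) with (Cmod (c (S j) + g j) * rho ^ S j / Cmod w) by (field; lra).
        apply Rmult_le_compat_r; [left; now apply Rinv_0_lt_compat|].
        replace (rho * (Cmod (g j) * rho ^ j)) with (Cmod (g j) * rho ^ S j) by (simpl; ring).
        rewrite <- Rmult_plus_distr_r. apply Rmult_le_compat_r; [apply pow_le; lra|apply Cmod_triangle].
      + apply Rmult_le_reg_r with (Cmod w); [easy|].
        unfold Rdiv. rewrite !Rmult_assoc, Rinv_l, !Rmult_1_r by lra.
        assert (0 <= Cmod (g j) * rho ^ j) by (apply Rmult_le_pos; [apply Cmod_ge_0|apply pow_le; lra]).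
        assert (rho * (Cmod (g j) * rho ^ j) <= Cmod w / 2 * (2 * B / Cmod w)) by (apply Rmult_le_compat; lra).
        replace (Cmod w / 2 * (2 * B / Cmod w)) with B in H0 by (field; lra).
        specialize (HB (S j)). lra. }
  exists g. apply (locally_C_intro l0 rho); [easy|]. intros l Hl.
  set (u := (l - l0)%C) in *.
  assert (Hwu : (w - u)%C <> 0%C).
  { apply Cminus_neq0. intros Ewu. rewrite <- Ewu in Hl. lra. }
  replace (s - l)%C with (w - u)%C by (unfold w, u; ring).
  apply is_Cpseries_csum. intros e He.
  assert (Hwu' : 0 < Cmod (w - u)) by now apply Cmod_gt_0.
  assert (Hu0 := Cmod_ge_0 u).
  assert (Hpart : forall N, ((w - u) * csum (fun j => u ^ j * g j) (S N))%C =
     (csum (fun j => u ^ j * c j) (S N) - g N * u ^ S N)%C).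
  { induction N as [|N IH].
    - simpl. field. easy.
    - cbn [csum]. cbn [csum] in IH. rewrite Cmult_plus_distr_l, IH.
      change (g (S N)) with ((c (S N) + g N) / w)%C. cbn [Cpow]. field. easy. }
  specialize (Hc l ltac:(unfold u in Hl; lra)). fold u in Hc.
  destruct (proj1 (is_Cpseries_csum _ _ _) Hc (e / 2 * Cmod (w - u)) ltac:(apply Rmult_lt_0_compat; lra)) as [N0 HN0].
  assert (Hq : 0 <= Cmod u / rho < 1).
  { split; [now apply Rdiv_le_0_compat|]. apply Rmult_lt_reg_r with rho; [easy|].
    unfold Rdiv. rewrite Rmult_assoc, Rinv_l; lra. }
  destruct (pow_lt_eps (Cmod u / rho) (rho * (2 * B / Cmod w)) (e / 2 * Cmod (w - u)) Hq ltac:(apply Rmult_lt_0_compat; lra)) as [N1 HN1].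
  exists (S (N0 + N1)). intros [|N] HN; [lia|].
  specialize (HN0 (S N) ltac:(lia)). specialize (HN1 (S N) ltac:(lia)).
  apply Rmult_lt_reg_l with (Cmod (w - u)); [easy|].
  rewrite <- Cmod_mult.
  replace ((w - u) * (csum (fun j => u ^ j * g j) (S N) - f l * / (w - u)))%C
    with ((w - u) * csum (fun j => u ^ j * g j) (S N) - f l)%C by (field; easy).
  rewrite Hpart.
  replace (csum (fun j => u ^ j * c j) (S N) - g N * u ^ S N - f l)%C
    with ((csum (fun j => u ^ j * c j) (S N) - f l) + - (g N * u ^ S N))%C by ring.
  eapply Rle_lt_trans; [apply Cmod_triangle|]. rewrite Cmod_opp, Cmod_mult, Cmod_pow.
  assert (Cmod (g N) * Cmod u ^ S N <= rho * (2 * B / Cmod w) * (Cmod u / rho) ^ S N).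
  { replace (Cmod (g N) * Cmod u ^ S N) with (rho * (Cmod (g N) * rho ^ N) * (Cmod u / rho) ^ S N).
    - apply Rmult_le_compat_r; [apply pow_le; lra|]. apply Rmult_le_compat_l; [lra|apply Hg].
    - unfold Rdiv. rewrite Rpow_mult_distr, pow_inv. assert (0 < rho ^ N) by now apply pow_lt. simpl. field. lra. }
  lra.
Qed.

(** Value at [Re s > 0] of [int_0^1 t^(s-1) (ln t)^n dt]. *)
Definition mellin_pole (n : nat) (s : C) : C :=
  (RtoC ((-1) ^ n * INR (fact n)) * (/ s) ^ S n)%C.

Lemma mellin_pole_analytic (n : nat) (s l0 : C) :
  s <> l0 -> analytic_at (fun l => mellin_pole n (s - l)) l0.
Proof.
  intros Hs. unfold mellin_pole. apply analytic_at_scal.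
  induction (S n) as [|p IH].
  - apply (analytic_at_const 1%C).
  - apply (analytic_at_ext_loc (fun l => (/ (s - l)) ^ p * / (s - l))%C).
    + apply filter_forall. intros l. simpl. ring.
    + now apply analytic_at_div_linear.
Qed.

(** * Primitives *)

Fixpoint pow_ln_prim (n : nat) (s : C) (t : R) : C :=
  match n with
  | O => Rcpow t s * / s
  | S p => (Rcpow t s * RtoC (ln t ^ n) - RtoC (INR n) * pow_ln_prim p s t) * / s
  end%C.

Lemma is_Cderive_scal_r (f : R -> C) (a : C) (t : R) (l : C) :
  is_Cderive f t l -> is_Cderive (fun x => f x * a)%C t (l * a)%C.
Proof.
  intros H. eapply is_Cderive_eq.
  - apply is_Cderive_mult; [exact H|apply is_Cderive_const].
  - cbn beta. ring.
Qed.

Lemma Rcpow_pred (s : C) (t : R) : 0 < t -> Rcpow t (s - 1) = (Rcpow t s * RtoC (/ t))%C.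
Proof.
  intros Ht. replace (s - 1)%C with (s + - RtoC (INR 1))%C by (change (INR 1) with 1; ring).
  rewrite Rcpow_plus, Rcpow_opp_nat, pow_1, RtoC_inv by lra. reflexivity.
Qed.

Lemma pow_ln_prim_derive (n : nat) (s : C) (t : R) :
  s <> 0%C -> 0 < t ->
  is_Cderive (pow_ln_prim n s) t (Rcpow t (s - 1) * RtoC (ln t ^ n))%C.
Proof.
  intros Hs Ht. induction n as [|n IH].
  - simpl. eapply is_Cderive_eq.
    + apply is_Cderive_scal_r. now apply is_Cderive_Rcpow.
    + field. easy.
  - cbn [pow_ln_prim]. eapply is_Cderive_eq.
    + apply is_Cderive_scal_r. apply is_Cderive_minus.
      * apply is_Cderive_mult; [now apply is_Cderive_Rcpow|].
        apply is_Cderive_RtoC. apply (is_derive_ln_pow (S n) t Ht).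
      * apply is_Cderive_mult; [apply is_Cderive_const|exact IH].
    + cbn beta. cbn [pred]. rewrite !(Rcpow_pred s t Ht), !RtoC_mult. field. easy.
Qed.

Lemma pow_ln_prim_1 (n : nat) (s : C) : pow_ln_prim n s 1 = mellin_pole n s.
Proof.
  unfold mellin_pole. induction n as [|n IH].
  - simpl. rewrite Rcpow_at_1. replace (1 * 1)%R with 1 by ring. ring.
  - cbn [pow_ln_prim]. rewrite Rcpow_at_1, IH, ln_1, fact_simpl, mult_INR.
    rewrite pow_i by lia. rewrite <- !tech_pow_Rmult.
    rewrite !RtoC_mult. change (RtoC (-1)) with (RtoC (- (1))). rewrite RtoC_opp.
    cbn [Cpow]. ring.
Qed.

Lemma is_RInt_gen_prim (D : R -> Prop) (G P : R -> R) (b : R)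
  (F : (R -> Prop) -> Prop) {FF : Filter F} (L : R) :
  interval_set D -> D b -> F D ->
  (forall t, D t -> is_derive P t (G t)) -> (forall t, D t -> continuous G t) ->
  filterlim P F (locally L) ->
  is_RInt_gen (V := R_NormedModule) G (at_point b) F (L - P b)%R.
Proof.
  intros HD Hb HF HP HG HL Q HQ.
  assert (HQ' : locally L (fun x => Q (x - P b)%R)).
  { destruct HQ as [e He]. exists e. intros x Hx. apply He.
    change (Rabs ((x - P b) - (L - P b)) < e). change (Rabs (x - L) < e) in Hx.
    now replace (x - P b - (L - P b)) with (x - L) by ring. }
  exists (fun x => x = b) (fun y => D y /\ Q (P y - P b)%R).
  - reflexivity.
  - apply filter_and; [easy|]. apply (HL _ HQ').
  - intros x y -> [Dy Qy]. exists (P y - P b)%R. split; [|easy].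
    apply (is_RInt_derive (V := R_CompleteNormedModule) P G b y).
    + intros t Ht. apply HP. now apply (HD b y).
    + intros t Ht. apply HG. now apply (HD b y).
Qed.

Lemma is_CInt_gen_prim (D : R -> Prop) (G P : R -> C) (b : R)
  (F : (R -> Prop) -> Prop) {FF : Filter F} (L : C) :
  interval_set D -> D b -> F D ->
  (forall t, D t -> is_Cderive P t (G t)) -> (forall t, D t -> Ccont G t) ->
  filterlim P F (locally L) ->
  is_CInt_gen G (at_point b) F (L - P b)%C.
Proof.
  intros HD Hb HF HP HG HL. apply (is_CInt_gen_point G b F). intros e He.
  generalize (filter_and _ _ HF (proj1 (filterlim_C F P L) HL e He)).
  apply filter_imp. intros y [Dy Hy]. exists (P y - P b)%C. split.
  - apply is_CInt_derive; intros t Ht; [apply HP|apply HG]; now apply (HD b y).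
  - now replace (P y - P b - (L - P b))%C with (P y - L)%C by ring.
Qed.

(** * Size of powers and logarithms *)

Lemma Cbounded_segment (f : R -> C) (x y : R) :
  (forall t, x <= t <= y -> Ccont f t) -> exists M, 0 <= M /\ forall t, x <= t <= y -> Cmod (f t) <= M.
Proof.
  intros H. destruct (bounded_continuity (V := C_R_NormedModule) f x y H) as [M HM].
  exists (Rmax M 0). split; [apply Rmax_r|]. intros t Ht.
  eapply Rle_trans; [|apply Rmax_l]. left. rewrite Cmod_norm. now apply HM.
Qed.

Lemma at_right_0_small (P : R -> Prop) (x : R) :
  0 < x -> (forall t, 0 < t < x -> P t) -> at_right 0 P.
Proof.
  intros Hx H. exists (mkposreal x Hx). intros t Ht Ht0. apply H. split; [easy|].
  change (Rabs (t - 0) < x) in Ht. rewrite Rminus_0_r, Rabs_pos_eq in Ht; lra.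
Qed.

Lemma ln_to_minus_infty (X : R) : at_right 0 (fun t => 0 < t /\ ln t < X).
Proof.
  apply (at_right_0_small _ (exp X)); [apply exp_pos|]. intros t Ht. split; [lra|].
  rewrite <- (ln_exp X). apply ln_increasing; lra.
Qed.

Lemma Cmod_ln_pow_le (t d : R) (n : nat) :
  0 < d -> Cmod (RtoC (ln t ^ n)) <= INR (fact n) / d ^ n * exp (d * Rabs (ln t)).
Proof. intros Hd. rewrite Cmod_R, <- RPow_abs. now apply Rabs_pow_le_exp. Qed.

Lemma Rcpow_ln_vanishes (n : nat) (s : C) :
  0 < Re s -> filterlim (fun t => Rcpow t s * RtoC (ln t ^ n))%C (at_right 0) (locally (RtoC 0)).
Proof.
  intros Hs. apply (filterlim_C (at_right 0)). intros e He.
  set (d := Re s / 2). assert (Hd : 0 < d) by (unfold d; lra).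
  set (K := INR (fact n) / d ^ n).
  assert (HK : 0 < K) by (apply Rdiv_lt_0_compat; [apply INR_fact_lt_0|now apply pow_lt]).
  generalize (filter_and _ _ (ln_to_minus_infty 0) (ln_to_minus_infty (ln (e / K) / d))).
  apply filter_imp. intros t [[Ht H0] [_ H1]].
  replace (Rcpow t s * RtoC (ln t ^ n) - 0)%C with (Rcpow t s * RtoC (ln t ^ n))%C by ring.
  rewrite Cmod_mult, Cmod_Rcpow. unfold Rpower.
  apply Rle_lt_trans with (exp (Re s * ln t) * (K * exp (d * Rabs (ln t)))).
  - apply Rmult_le_compat_l; [left; apply exp_pos|]. now apply Cmod_ln_pow_le.
  - rewrite Rabs_left by easy.
    replace (exp (Re s * ln t) * (K * exp (d * - ln t))) with (K * exp (d * ln t)).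
    + assert (HeK : 0 < e / K) by now apply Rdiv_lt_0_compat.
      replace e with (K * exp (ln (e / K))) by (rewrite exp_ln by easy; field; lra).
      apply Rmult_lt_compat_l; [easy|]. apply exp_increasing.
      apply Rmult_lt_compat_l with (r := d) in H1; [|easy].
      replace (d * (ln (e / K) / d)) with (ln (e / K)) in H1 by (field; lra). easy.
    + rewrite (Rmult_comm K), (Rmult_comm K), <- Rmult_assoc, <- exp_plus. f_equal. f_equal. unfold d. field.
Qed.

Lemma filterlim_C_plus {T : Type} (F : (T -> Prop) -> Prop) {FF : Filter F} (f g : T -> C) (l m : C) :
  filterlim f F (locally l) -> filterlim g F (locally m) ->
  filterlim (fun x => f x + g x)%C F (locally (l + m)%C).
Proof.
  intros H1 H2. apply (filterlim_C F). intros e He.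
  assert (He2 : 0 < e / 2) by lra.
  generalize (filter_and _ _ (proj1 (filterlim_C F f l) H1 _ He2) (proj1 (filterlim_C F g m) H2 _ He2)).
  apply filter_imp. intros x [A B].
  replace (f x + g x - (l + m))%C with ((f x - l) + (g x - m))%C by ring.
  eapply Rle_lt_trans; [apply Cmod_triangle|]. lra.
Qed.

Lemma filterlim_C_scal {T : Type} (F : (T -> Prop) -> Prop) {FF : Filter F} (f : T -> C) (c l : C) :
  filterlim f F (locally l) -> filterlim (fun x => c * f x)%C F (locally (c * l)%C).
Proof.
  intros H. apply (filterlim_C F). intros e He. assert (Hc := Cmod_ge_0 c).
  assert (He2 : 0 < e / (Cmod c + 1)) by (apply Rdiv_lt_0_compat; lra).
  generalize (proj1 (filterlim_C F f l) H _ He2).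
  apply filter_imp. intros x A.
  replace (c * f x - c * l)%C with (c * (f x - l))%C by ring. rewrite Cmod_mult.
  apply Rle_lt_trans with (Cmod c * (e / (Cmod c + 1))); [apply Rmult_le_compat_l; lra|].
  replace e with ((Cmod c + 1) * (e / (Cmod c + 1))) at 2 by (field; lra).
  apply Rmult_lt_compat_r; [apply Rdiv_lt_0_compat; lra|lra].
Qed.

Lemma filterlim_C_const {T : Type} (F : (T -> Prop) -> Prop) {FF : Filter F} (l : C) :
  filterlim (fun _ : T => l) F (locally l).
Proof. apply (filterlim_const (U := C_UniformSpace)). Qed.

Lemma filterlim_C_eq {T : Type} (F : (T -> Prop) -> Prop) {FF : Filter F} (f g : T -> C) (l m : C) :
  F (fun x => f x = g x) -> l = m -> filterlim f F (locally l) -> filterlim g F (locally m).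
Proof. intros H <- Hf. apply (filterlim_ext_loc (U := C_UniformSpace) f g H Hf). Qed.

Lemma pow_ln_prim_vanishes (n : nat) (s : C) :
  0 < Re s -> filterlim (pow_ln_prim n s) (at_right 0) (locally (RtoC 0)).
Proof.
  intros Hs. induction n as [|n IH].
  - apply (filterlim_C_eq (at_right 0) (fun t => / s * (Rcpow t s * RtoC (ln t ^ O)))%C _ (/ s * RtoC 0)%C); [|ring|].
    + apply filter_forall. intros t. simpl. ring.
    + apply filterlim_C_scal; [typeclasses eauto|]. now apply Rcpow_ln_vanishes.
  - apply (filterlim_C_eq (at_right 0)
      (fun t => / s * (Rcpow t s * RtoC (ln t ^ S n) + (- RtoC (INR (S n))) * pow_ln_prim n s t))%C _
      (/ s * (RtoC 0 + (- RtoC (INR (S n))) * RtoC 0))%C); [|ring|].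
    + apply filter_forall. intros t. cbn [pow_ln_prim]. ring.
    + apply filterlim_C_scal; [typeclasses eauto|]. apply filterlim_C_plus; [typeclasses eauto|now apply Rcpow_ln_vanishes|].
      apply filterlim_C_scal; [typeclasses eauto|easy].
Qed.

(** * The integral towards the upper endpoint *)

Global Instance to_upper_proper (a : Rbar) : ProperFilter (to_upper a).
Proof.
  destruct a as [a| |]; simpl.
  - apply at_left_proper_filter.
  - apply (Rbar_locally_filter p_infty).
  - apply (Rbar_locally_filter m_infty).
Qed.

Definition inside (a : Rbar) (t : R) : Prop := 0 < t /\ Rbar_lt t a.

Lemma inside_open (a : Rbar) (t : R) : inside a t -> locally t (inside a).
Proof.
  intros [H0 Ha]. apply filter_and.
  - exists (mkposreal t H0). intros y Hy. change (Rabs (y - t) < t) in Hy.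
    apply Rabs_def2 in Hy. lra.
  - destruct a as [a| |]; simpl in *; [|now apply filter_forall|easy].
    assert (Hp : 0 < a - t) by lra.
    exists (mkposreal _ Hp). intros y Hy. change (Rabs (y - t) < a - t) in Hy.
    apply Rabs_def2 in Hy. lra.
Qed.

Lemma inside_interval (a : Rbar) : interval_set (inside a).
Proof.
  intros x y z [Hx Hxa] [Hy Hya] Hz. split.
  - assert (0 < Rmin x y) by now apply Rmin_pos. lra.
  - destruct a as [a| |]; simpl in *; [|easy|easy].
    assert (Rmax x y < a) by now apply Rmax_lub_lt. lra.
Qed.

Lemma from_interval (a : Rbar) (b : R) : interval_set (fun t => b <= t /\ Rbar_lt t a).
Proof.
  intros x y z [Hx Hxa] [Hy Hya] Hz. split.
  - assert (b <= Rmin x y) by now apply Rmin_glb. lra.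
  - destruct a as [a| |]; simpl in *; [|easy|easy].
    assert (Rmax x y < a) by now apply Rmax_lub_lt. lra.
Qed.

Lemma to_upper_from (a : Rbar) (b : R) :
  Rbar_lt b a -> to_upper a (fun t => b <= t /\ Rbar_lt t a).
Proof.
  intros Hb. destruct a as [a| |]; simpl in *; [| |easy].
  - assert (Hp : 0 < a - b) by lra.
    exists (mkposreal _ Hp). intros y Hy Hya. change (Rabs (y - a) < a - b) in Hy.
    apply Rabs_def2 in Hy. lra.
  - exists b. intros x Hx. split; [lra|easy].
Qed.

Lemma to_upper_elim (a : Rbar) (b : R) (P : R -> Prop) :
  Rbar_lt b a -> to_upper a P ->
  exists y, b <= y /\ Rbar_lt y a /\ forall t, y <= t -> Rbar_lt t a -> P t.
Proof.
  intros Hb. destruct a as [a| |]; simpl in *; [| |easy].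
  - intros [e He]. assert (He0 := cond_pos e). exists (Rmax b (a - e / 2)). split; [apply Rmax_l|].
    split; [apply Rmax_lub_lt; lra|]. intros t Ht Hta. apply He; [|easy].
    change (Rabs (t - a) < e). assert (a - e / 2 <= t) by (eapply Rle_trans; [apply Rmax_r|exact Ht]).
    rewrite Rabs_left by lra. lra.
  - intros [M HM]. exists (Rmax b (M + 1)). split; [apply Rmax_l|]. split; [easy|].
    intros t Ht _. apply HM. assert (M + 1 <= t) by (eapply Rle_trans; [apply Rmax_r|exact Ht]). lra.
Qed.

Lemma C_primitive (a : Rbar) (g : R -> C) (b : R) :
  inside a b -> (forall t, inside a t -> Ccont g t) ->
  exists K : R -> C, forall t, inside a t -> is_CInt g b t (K t) /\ is_Cderive K t (g t).
Proof.
  intros Hb Hg.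
  exists (fun t => RInt (V := C_R_CompleteNormedModule) g b t).
  assert (HI : forall t, inside a t -> is_CInt g b t (RInt (V := C_R_CompleteNormedModule) g b t)).
  { intros t Ht. apply (RInt_correct (V := C_R_CompleteNormedModule)).
    apply (ex_CInt_cont g b t).
    intros x Hx. apply Hg. now apply (inside_interval a b t). }
  intros t Ht. split; [now apply HI|].
  assert (Hc := proj1 (Ccont_comp _ _) (Hg t Ht)). destruct Hc as [Hc1 Hc2].
  split.
  - apply (is_derive_RInt (V := R_NormedModule) (fun x => Re (g x)) _ b t); [|exact Hc1].
    generalize (inside_open a t Ht). apply filter_imp. intros y Hy.
    apply (proj1 (is_CInt_comp _ _ _ _) (HI y Hy)).
  - apply (is_derive_RInt (V := R_NormedModule) (fun x => Im (g x)) _ b t); [|exact Hc2].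
    generalize (inside_open a t Ht). apply filter_imp. intros y Hy.
    apply (proj1 (is_CInt_comp _ _ _ _) (HI y Hy)).
Qed.

Lemma exp_neg_ln_limit (a : Rbar) (eta b : R) :
  0 < eta -> 0 < b -> Rbar_lt b a ->
  exists L : R, filterlim (fun t => exp (- eta * ln t)) (to_upper a) (locally L).
Proof.
  intros He Hb Hba. destruct a as [a| |]; simpl in *; [| |easy].
  - exists (exp (- eta * ln a)).
    assert (Hc : continuous (fun t => exp (- eta * ln t)) a).
    { apply (ex_derive_continuous (K := R_AbsRing) (V := R_NormedModule)). auto_derive. lra. }
    intros P HP. apply filter_le_within. now apply Hc.
  - exists 0. apply (filterlim_locally (U := R_UniformSpace) (fun t => exp (- eta * ln t)) 0). intros e.
    exists (exp (- ln e / eta)). intros t Ht.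
    change (Rabs (exp (- eta * ln t) - 0) < e). rewrite Rminus_0_r, Rabs_pos_eq by (left; apply exp_pos).
    assert (He0 := cond_pos e).
    rewrite <- (exp_ln e) by easy. apply exp_increasing.
    assert (Hlt : - ln e / eta < ln t).
    { rewrite <- (ln_exp (- ln e / eta)). apply ln_increasing; [apply exp_pos|easy]. }
    apply Rmult_lt_compat_l with (r := eta) in Hlt; [|easy].
    replace (eta * (- ln e / eta)) with (- ln e) in Hlt by (field; lra). lra.
Qed.

Lemma abs_ln_le (b t : R) : 0 < b -> b < 1 -> b <= t -> Rabs (ln t) <= ln t - 2 * ln b.
Proof.
  intros Hb Hb1 Ht.
  assert (ln b < 0) by (rewrite <- ln_1; apply ln_increasing; lra).
  assert (ln b <= ln t) by (destruct Ht as [Ht| ->]; [left; now apply ln_increasing|right; easy]).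
  unfold Rabs. destruct Rcase_abs; lra.
Qed.

(** The gap [eta = Re l0 - sigma] pays for everything.  As [t >= b], [|ln t|] is at
    most [ln t - 2 ln b], so a quarter of [eta] absorbs the power of the logarithm
    and another quarter the factor [exp(d |ln t|)] needed for analyticity; the
    integrand remains dominated by [t^(-1 - eta/2)]. *)
Lemma powint_upper_abs (a : Rbar) (b : R) (K : R -> C) (B sigma : R) (i : nat) (l0 : C) :
  0 < b -> b < 1 -> Rbar_lt b a -> sigma < Re l0 ->
  (forall t, inside a t -> Ccont K t) ->
  (forall t, b <= t -> Rbar_lt t a -> Cmod (K t) <= B) ->
  let h := fun t => (K t * RtoC (ln t ^ i) * (Rcpow t (RtoC sigma) * RtoC (/ t)))%C in
  analytic_at (powint h b (to_upper a)) l0 /\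
  exists d, 0 < d /\ forall l, Cmod (l - l0) < d -> is_powint h b (to_upper a) l (powint h b (to_upper a) l).
Proof.
  intros Hb Hb1 Hba Hs HK HB h.
  set (eta := Re l0 - sigma). assert (Heta : 0 < eta) by (unfold eta; lra).
  set (d := eta / 4). assert (Hd : 0 < d) by (unfold d; lra).
  set (K0 := INR (fact i) / d ^ i).
  assert (HK0 : 0 < K0) by (apply Rdiv_lt_0_compat; [apply INR_fact_lt_0|now apply pow_lt]).
  set (C0 := B * K0 * exp (- 4 * d * ln b)).
  destruct (exp_neg_ln_limit a (eta / 2) b ltac:(lra) Hb Hba) as [L HL].
  destruct (powint_analytic (fun t => b <= t /\ Rbar_lt t a) h
     (fun t => C0 * (exp (- (eta / 2) * ln t) / t)) b (to_upper a)
     (C0 * (- 2 / eta * L - (- 2 / eta * exp (- (eta / 2) * ln b)))) l0 d) as [H1 H2].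
  - easy.
  - apply from_interval.
  - split; [lra|easy].
  - now apply to_upper_from.
  - intros t [Ht _]. lra.
  - intros t [Ht Hta]. assert (Ht0 : 0 < t) by lra.
    apply Ccont_mult; [apply Ccont_mult; [apply HK; split; easy|now apply Ccont_ln_pow]|].
    apply Ccont_mult; [now apply Ccont_Rcpow|]. apply Ccont_RtoC.
    apply (ex_derive_continuous (K := R_AbsRing) (V := R_NormedModule)). auto_derive. lra.
  - intros t [Ht Hta]. assert (Ht0 : 0 < t) by lra.
    unfold h. rewrite !Cmod_mult, !Cmod_Rcpow.
    rewrite (Cmod_R (/ t)), (Rabs_pos_eq (/ t)) by (left; now apply Rinv_0_lt_compat).
    assert (HB0 : 0 <= B) by (eapply Rle_trans; [apply Cmod_ge_0|apply (HB t Ht Hta)]).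
    apply Rle_trans with (B * (K0 * exp (d * Rabs (ln t))) * (Rpower t (Re (RtoC sigma)) * / t) * Rpower t (Re (- l0)) * exp (d * Rabs (ln t))).
    + apply Rmult_le_compat_r; [left; apply exp_pos|].
      apply Rmult_le_compat_r; [left; apply exp_pos|].
      apply Rmult_le_compat_r.
      { apply Rmult_le_pos; [left; apply exp_pos|left; now apply Rinv_0_lt_compat]. }
      apply Rmult_le_compat; [apply Cmod_ge_0|apply Cmod_ge_0|now apply HB|now apply Cmod_ln_pow_le].
    + unfold Rpower. change (Re (RtoC sigma)) with sigma. change (Re (- l0)) with (- Re l0).
      replace (B * (K0 * exp (d * Rabs (ln t))) * (exp (sigma * ln t) * / t) * exp (- Re l0 * ln t) * exp (d * Rabs (ln t)))
        with (B * K0 * / t * exp (2 * d * Rabs (ln t) + (- eta) * ln t)).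
      2:{ replace (2 * d * Rabs (ln t) + - eta * ln t)
            with (d * Rabs (ln t) + sigma * ln t + - Re l0 * ln t + d * Rabs (ln t)) by (unfold eta; ring).
          rewrite !exp_plus. ring. }
      unfold C0. replace (B * K0 * exp (-4 * d * ln b) * (exp (- (eta / 2) * ln t) / t))
        with (B * K0 * / t * exp (-4 * d * ln b + - (eta / 2) * ln t)).
      2:{ rewrite exp_plus. field. lra. }
      apply Rmult_le_compat_l.
      { apply Rmult_le_pos; [apply Rmult_le_pos; lra|left; now apply Rinv_0_lt_compat]. }
      apply exp_le_mono. pose proof (abs_ln_le b t Hb Hb1 Ht) as Hln.
      assert (2 * d * Rabs (ln t) <= 2 * d * (ln t - 2 * ln b)) by (apply Rmult_le_compat_l; lra).
      replace eta with (4 * d) by (unfold d; field). lra.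
  - apply (is_RInt_gen_scal (V := R_NormedModule) (fun t => exp (- (eta / 2) * ln t) / t) C0).
    apply (is_RInt_gen_prim (fun t => b <= t /\ Rbar_lt t a) _ (fun t => - 2 / eta * exp (- (eta / 2) * ln t)) b (to_upper a)).
    + apply from_interval.
    + split; [lra|easy].
    + now apply to_upper_from.
    + intros t [Ht _]. auto_derive; [lra|]. field. lra.
    + intros t [Ht _]. apply (ex_derive_continuous (K := R_AbsRing) (V := R_NormedModule)). auto_derive. lra.
    + apply (filterlim_comp _ _ _ (fun t => exp (- (eta / 2) * ln t)) (fun x => - 2 / eta * x) _ (locally L)); [exact HL|].
      apply (filterlim_scal_r (K := R_AbsRing) (V := R_NormedModule)).
  - split; [exact H1|]. now exists d.
Qed.

Lemma powint_proper_analytic (h : R -> C) (b : R) (l0 : C) :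
  0 < b < 1 -> (forall t, 0 < t -> Ccont h t) ->
  analytic_at (powint h b (at_point 1)) l0 /\
  forall l, is_powint h b (at_point 1) l (powint h b (at_point 1) l).
Proof.
  intros Hb Hh.
  assert (Hex : forall l, is_powint h b (at_point 1) l (powint h b (at_point 1) l)).
  { intros l. destruct (ex_CInt_cont (fun t => h t * Rcpow t (- l))%C b 1) as [I HI].
    - intros t Ht. rewrite Rmin_left, Rmax_right in Ht by lra.
      apply Ccont_mult; [apply Hh; lra|apply Ccont_Rcpow; lra].
    - apply (powint_correct h b (at_point 1) l I).
      apply (is_RInt_gen_at_point (V := C_R_NormedModule)). exact HI. }
  split; [|exact Hex].
  set (D := fun t => b <= t <= 1).
  assert (HD : interval_set D).
  { intros x y z Hx Hy Hz. unfold D in *.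
    assert (b <= Rmin x y) by (apply Rmin_glb; lra). assert (Rmax x y <= 1) by (apply Rmax_lub; lra). lra. }
  destruct (Cbounded_segment (fun t => h t * Rcpow t (- l0))%C b 1) as [M [HM0 HM]].
  { intros t Ht. apply Ccont_mult; [apply Hh; lra|apply Ccont_Rcpow; lra]. }
  apply (powint_analytic D h (fun _ => M * exp (Rabs (ln b))) b (at_point 1)
    (M * exp (Rabs (ln b)) * (1 - b)) l0 1).
  - lra.
  - exact HD.
  - unfold D. lra.
  - unfold D, at_point. lra.
  - unfold D. intros; lra.
  - intros t Ht. apply Hh. unfold D in Ht. lra.
  - intros t Ht. rewrite <- Cmod_mult. apply Rmult_le_compat; [apply Cmod_ge_0|left; apply exp_pos|now apply HM|].
    apply exp_le_mono. rewrite Rmult_1_l.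
    assert (ln b <= ln t) by (destruct (proj1 Ht) as [H| <-]; [left; now apply ln_increasing|right; easy]).
    assert (ln t <= 0).
    { rewrite <- ln_1. destruct (proj2 Ht) as [H'| ->]; [left; apply ln_increasing; unfold D in Ht; lra|right; easy]. }
    rewrite !Rabs_left1 by lra. lra.
  - apply is_RInt_gen_at_point.
    replace (M * exp (Rabs (ln b)) * (1 - b)) with (scal (1 - b) (M * exp (Rabs (ln b)))) by (unfold scal; simpl; unfold mult; simpl; ring).
    apply (is_RInt_const (V := R_NormedModule)).
Qed.

(** [b^(-l) = 1 + l * int_b^1 t^(-1) t^(-l) dt], an integral already known to be
    analytic in [l]. *)
Lemma Rcpow_analytic (b : R) (s l0 : C) :
  0 < b < 1 -> analytic_at (fun l => Rcpow b (s - l)) l0.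
Proof.
  intros Hb.
  assert (HG : forall t, 0 < t -> Ccont (fun t => RtoC (/ t)) t).
  { intros t Ht. apply Ccont_RtoC. apply (ex_derive_continuous (K := R_AbsRing) (V := R_NormedModule)). auto_derive. lra. }
  destruct (powint_proper_analytic (fun t => RtoC (/ t)) b l0 Hb HG) as [H1 H2].
  set (J := powint (fun t => RtoC (/ t)) b (at_point 1)) in *.
  apply (analytic_at_ext_loc (fun l => Rcpow b s * (1 + (l - 0) * J l))%C).
  - apply filter_forall. intros l. specialize (H2 l).
    unfold Cminus at 2. rewrite Rcpow_plus. f_equal.
    assert (HP : is_CInt (fun t => - l * (RtoC (/ t) * Rcpow t (- l)))%C b 1 (Rcpow 1 (- l) - Rcpow b (- l))%C).
    { apply (is_CInt_derive (fun t => Rcpow t (- l))); intros t Ht; rewrite Rmin_left, Rmax_right in Ht by lra.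
      - eapply is_Cderive_eq; [apply is_Cderive_Rcpow; lra|]. rewrite Rcpow_pred by lra. ring.
      - apply Ccont_mult; [apply Ccont_const|]. apply Ccont_mult; [apply HG; lra|apply Ccont_Rcpow; lra]. }
    assert (HP' : is_CInt (fun t => - l * (RtoC (/ t) * Rcpow t (- l)))%C b 1 (- l * J l)%C).
    { apply is_CInt_scal. apply (is_RInt_gen_at_point (V := C_R_NormedModule)). exact H2. }
    pose proof (is_CInt_unique _ b 1 _ _ HP HP') as E. rewrite Rcpow_at_1 in E.
    transitivity (1 - (- l * J l))%C; [ring|]. rewrite <- E. ring.
  - apply analytic_at_scal. apply analytic_at_plus; [apply (analytic_at_const 1%C)|].
    now apply analytic_at_linear_mult.
Qed.

(** Only conditional convergence is available at [a].  Integration by parts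
    against [K0 - L], where [K0] is the primitive of [k t^(-sigma)] and [L] its
    limit, produces absolutely convergent integrals and removes the boundary
    term at [a]. *)
Lemma powint_upper (a : Rbar) (b : R) (k : R -> C) (sigma : R) (L : C) (n : nat) (l0 : C) :
  0 < b -> b < 1 -> Rbar_lt b a -> sigma < Re l0 ->
  (forall t, inside a t -> Ccont k t) ->
  is_powint k b (to_upper a) (RtoC sigma) L ->
  analytic_at (powint (mul_ln n k) b (to_upper a)) l0 /\
  is_powint (mul_ln n k) b (to_upper a) l0 (powint (mul_ln n k) b (to_upper a) l0).
Proof.
  intros Hb Hb1 Hba Hs Hk HL.
  set (g := fun t => (k t * Rcpow t (- RtoC sigma))%C).
  assert (Hin : inside a b) by (split; [easy|easy]).
  assert (Hg : forall t, inside a t -> Ccont g t).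
  { intros t Ht. apply Ccont_mult; [now apply Hk|apply Ccont_Rcpow, Ht]. }
  destruct (C_primitive a g b Hin Hg) as [K0 HK0].
  set (K := fun t => (K0 t - L)%C).
  assert (HKd : forall t, inside a t -> is_Cderive K t (g t)).
  { intros t Ht. eapply is_Cderive_eq.
    - apply (is_Cderive_minus K0 (fun _ => L)); [apply HK0, Ht|apply is_Cderive_const].
    - ring. }
  assert (HKc : forall t, inside a t -> Ccont K t).
  { intros t Ht. eapply is_Cderive_cont. now apply HKd. }
  assert (HKb : K b = (- L)%C).
  { unfold K. replace (K0 b) with (RtoC 0); [ring|].
    apply (is_CInt_unique g b b); [|apply HK0, Hin].
    apply (is_RInt_point (V := C_R_NormedModule)). }
  assert (HKlim : forall e, 0 < e -> to_upper a (fun y => inside a y /\ Cmod (K y) < e)).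
  { intros e He. 
    generalize (filter_and _ _ (to_upper_from a b Hba) (proj1 (is_CInt_gen_point g b (to_upper a) L) HL e He)).
    apply filter_imp. intros y [[Hy Hya] [I [HI HIe]]].
    assert (Hiy : inside a y) by (split; [lra|easy]). split; [easy|].
    unfold K. now rewrite (is_CInt_unique g b y _ _ (proj1 (HK0 y Hiy)) HI). }
  assert (HB : exists B, 0 <= B /\ forall t, b <= t -> Rbar_lt t a -> Cmod (K t) <= B).
  { destruct (to_upper_elim a b _ Hba (HKlim 1 Rlt_0_1)) as [y [Hy [Hya Hyt]]].
    destruct (Cbounded_segment K b y) as [M [HM0 HM]].
    - intros t Ht. apply HKc. apply (inside_interval a b y); [easy|split; [lra|easy]|].
      now rewrite Rmin_left, Rmax_right.
    - exists (Rmax M 1). split; [eapply Rle_trans; [exact HM0|apply Rmax_l]|].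
      intros t Ht Hta. destruct (Rle_dec t y) as [Hle|Hgt].
      + eapply Rle_trans; [apply HM; lra|apply Rmax_l].
      + eapply Rle_trans; [|apply Rmax_r]. left. apply Hyt; [lra|easy]. }
  destruct HB as [B [HB0 HB]].
  set (h := fun (i : nat) t => (K t * RtoC (ln t ^ i) * (Rcpow t (RtoC sigma) * RtoC (/ t)))%C).
  destruct (powint_upper_abs a b K B sigma n l0 Hb Hb1 Hba Hs HKc HB) as [A1 [d1 [Hd1 A1']]].
  destruct (powint_upper_abs a b K B sigma (pred n) l0 Hb Hb1 Hba Hs HKc HB) as [A2 [d2 [Hd2 A2']]].
  fold (h n) in A1, A1'. fold (h (pred n)) in A2, A2'.
  set (Phi := fun l => (L * RtoC (ln b ^ n) * Rcpow b (RtoC sigma - l)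
      + ((l - RtoC sigma) * powint (h n) b (to_upper a) l - RtoC (INR n) * powint (h (pred n)) b (to_upper a) l))%C).
  assert (HPhi : forall l, Cmod (l - l0) < Rmin (Rmin d1 d2) (Re l0 - sigma) ->
     is_powint (mul_ln n k) b (to_upper a) l (Phi l)).
  { intros l Hl.
    assert (Hl1 : Cmod (l - l0) < d1) by (eapply Rlt_le_trans; [exact Hl|]; eapply Rle_trans; [apply Rmin_l|apply Rmin_l]).
    assert (Hl2 : Cmod (l - l0) < d2) by (eapply Rlt_le_trans; [exact Hl|]; eapply Rle_trans; [apply Rmin_l|apply Rmin_r]).
    assert (Hl3 : Cmod (l - l0) < Re l0 - sigma) by (eapply Rlt_le_trans; [exact Hl|apply Rmin_r]).
    assert (Hre : sigma < Re l).
    { pose proof (re_le_Cmod (l - l0)) as Hr. change (Re (l - l0)) with (Re l - Re l0) in Hr.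
      assert (Hr2 : Rabs (Re l - Re l0) < Re l0 - sigma) by lra. apply Rabs_def2 in Hr2. lra. }
    specialize (A1' l Hl1). specialize (A2' l Hl2).
    set (phi := fun t => (Rcpow t (RtoC sigma - l) * RtoC (ln t ^ n))%C).
    (* K tends to 0 at a, so a bound on phi kills the boundary term there *)
    set (eta := Re l - sigma). assert (Heta : 0 < eta) by (unfold eta; lra).
    set (K1 := INR (fact n) / eta ^ n).
    assert (HK1 : 0 < K1) by (apply Rdiv_lt_0_compat; [apply INR_fact_lt_0|now apply pow_lt]).
    assert (Hphi : forall t, b <= t -> Cmod (phi t) <= K1 * exp (- 2 * eta * ln b)).
    { intros t Ht. unfold phi. rewrite Cmod_mult, Cmod_Rcpow. unfold Rpower.
      change (Re (RtoC sigma - l)) with (sigma - Re l).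
      apply Rle_trans with (exp ((sigma - Re l) * ln t) * (K1 * exp (eta * Rabs (ln t)))).
      - apply Rmult_le_compat_l; [left; apply exp_pos|now apply Cmod_ln_pow_le].
      - replace (exp ((sigma - Re l) * ln t) * (K1 * exp (eta * Rabs (ln t))))
          with (K1 * exp ((sigma - Re l) * ln t + eta * Rabs (ln t))) by (rewrite exp_plus; ring).
        apply Rmult_le_compat_l; [lra|]. apply exp_le_mono.
        pose proof (abs_ln_le b t Hb Hb1 Ht) as Hln.
        assert (eta * Rabs (ln t) <= eta * (ln t - 2 * ln b)) by (apply Rmult_le_compat_l; lra).
        unfold eta in *. lra. }
    assert (Hbd : is_CInt_gen (fun t => (k t * RtoC (ln t ^ n)) * Rcpow t (- l) +
        ((RtoC sigma - l) * (h n t * Rcpow t (- l)) + RtoC (INR n) * (h (pred n) t * Rcpow t (- l))))%C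
        (at_point b) (to_upper a) (0 - K b * phi b)%C).
    { apply (is_CInt_gen_prim (fun t => b <= t /\ Rbar_lt t a) _ (fun t => K t * phi t)%C b (to_upper a) 0%C).
      - apply from_interval.
      - split; [lra|easy].
      - now apply to_upper_from.
      - intros t [Ht Hta]. assert (Hit : inside a t) by (split; [lra|easy]). assert (Ht0 : 0 < t) by lra.
        eapply is_Cderive_eq.
        + apply is_Cderive_mult; [now apply HKd|]. apply is_Cderive_mult; [now apply is_Cderive_Rcpow|].
          apply is_Cderive_RtoC. now apply is_derive_ln_pow.
        + unfold phi, g, h. rewrite Rcpow_pred by easy. cbn beta.
          unfold Cminus. rewrite !Rcpow_plus, !RtoC_mult.
          transitivity (k t * RtoC (ln t ^ n) * Rcpow t (- l) * (Rcpow t (RtoC sigma) * Rcpow t (- RtoC sigma))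
            + K t * ((RtoC sigma + - l) * (Rcpow t (RtoC sigma) * Rcpow t (- l) * RtoC (/ t)) * RtoC (ln t ^ n)
                + Rcpow t (RtoC sigma) * Rcpow t (- l) * (RtoC (INR n) * RtoC (ln t ^ pred n) * RtoC (/ t))))%C; [ring|].
          rewrite Rcpow_opp. ring.
      - intros t [Ht Hta]. assert (Hit : inside a t) by (split; [lra|easy]). assert (Ht0 : 0 < t) by lra.
        assert (Hh : forall i, Ccont (h i) t).
        { intros i. apply Ccont_mult; [apply Ccont_mult; [now apply HKc|now apply Ccont_ln_pow]|].
          apply Ccont_mult; [now apply Ccont_Rcpow|]. apply Ccont_RtoC.
          apply (ex_derive_continuous (K := R_AbsRing) (V := R_NormedModule)). auto_derive. lra. }
        apply Ccont_plus; [|apply Ccont_plus].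
        + apply Ccont_mult; [apply Ccont_mult; [now apply Hk|now apply Ccont_ln_pow]|now apply Ccont_Rcpow].
        + apply Ccont_mult; [apply Ccont_const|]. apply Ccont_mult; [apply Hh|now apply Ccont_Rcpow].
        + apply Ccont_mult; [apply Ccont_const|]. apply Ccont_mult; [apply Hh|now apply Ccont_Rcpow].
      - apply (filterlim_C (to_upper a)). intros e He.
        set (K2 := K1 * exp (- 2 * eta * ln b)) in *.
        assert (HK2 : 0 < K2) by (apply Rmult_lt_0_compat; [easy|apply exp_pos]).
        assert (He2 : 0 < e / K2) by now apply Rdiv_lt_0_compat.
        generalize (filter_and _ _ (to_upper_from a b Hba) (HKlim _ He2)). apply filter_imp.
        intros y [[Hy _] [_ HKy]]. replace (K y * phi y - 0)%C with (K y * phi y)%C by ring.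
        rewrite Cmod_mult. apply Rle_lt_trans with (Cmod (K y) * K2).
        + apply Rmult_le_compat_l; [apply Cmod_ge_0|now apply Hphi].
        + replace e with (e / K2 * K2) by (field; lra). now apply Rmult_lt_compat_r. }
    assert (Hrest : is_CInt_gen (fun t =>
        ((RtoC sigma - l) * (h n t * Rcpow t (- l)) + RtoC (INR n) * (h (pred n) t * Rcpow t (- l))))%C
        (at_point b) (to_upper a)
        ((RtoC sigma - l) * powint (h n) b (to_upper a) l + RtoC (INR n) * powint (h (pred n)) b (to_upper a) l)%C).
    { apply is_CInt_gen_plus; [typeclasses eauto| |]; (apply is_CInt_gen_scal; [typeclasses eauto|assumption]). }
    pose proof (is_CInt_gen_minus _ _ b (to_upper a) _ _ Hbd Hrest) as HF.
    unfold is_powint.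
    replace (Phi l) with (0 - K b * phi b - ((RtoC sigma - l) * powint (h n) b (to_upper a) l + RtoC (INR n) * powint (h (pred n)) b (to_upper a) l))%C.
    2:{ rewrite HKb. unfold Phi, phi. ring. }
    revert HF. apply (is_CInt_gen_ext (fun t => b <= t /\ Rbar_lt t a) _ _ b (to_upper a)).
    - apply from_interval.
    - split; [lra|easy].
    - now apply to_upper_from.
    - intros t _. unfold mul_ln. ring. }
  assert (Hr : 0 < Rmin (Rmin d1 d2) (Re l0 - sigma)) by (repeat apply Rmin_pos; lra).
  split.
  - apply (analytic_at_ext_loc Phi).
    + apply (locally_C_intro l0 _ _ Hr). intros l Hl. symmetry. apply (powint_unique _ b (to_upper a)). now apply HPhi.
    + unfold Phi. apply analytic_at_plus.
      * apply analytic_at_scal. apply Rcpow_analytic. lra.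
      * apply analytic_at_minus; [now apply analytic_at_linear_mult|now apply analytic_at_scal].
  - apply (powint_correct _ b (to_upper a) l0 (Phi l0)). apply HPhi.
    replace (l0 - l0)%C with (RtoC 0) by ring. now rewrite Cmod_0.
Qed.

(** * The integral towards 0 *)

Definition taylor_poly (c : nat -> C) (M : nat) (t : R) : C :=
  csum (fun j => c j * RtoC (t ^ j))%C M.

Definition local_expansion (a : Rbar) (k : R -> C) (c : nat -> C) (b : R) : Prop :=
  0 < b < 1 /\ Rbar_lt b a /\ (forall t, inside a t -> Ccont k t) /\
  forall M, exists B, 0 <= B /\
    forall t, 0 < t <= b -> Cmod (k t - taylor_poly c M t) <= B * t ^ M.

Lemma Ccont_pow (j : nat) (t : R) : Ccont (fun x => RtoC (x ^ j)) t.
Proof.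
  apply Ccont_RtoC. apply (ex_derive_continuous (K := R_AbsRing) (V := R_NormedModule)). auto_derive. easy.
Qed.

Lemma Ccont_taylor_poly (c : nat -> C) (M : nat) (t : R) : Ccont (taylor_poly c M) t.
Proof.
  unfold taylor_poly. induction M as [|M IH]; simpl; [apply (Ccont_const 0%C)|].
  apply Ccont_plus; [exact IH|]. apply Ccont_mult; [apply Ccont_const|apply Ccont_pow].
Qed.

Lemma Ccont_mul_ln (n : nat) (f : R -> C) (t : R) : 0 < t -> Ccont f t -> Ccont (mul_ln n f) t.
Proof. intros Ht Hf. apply Ccont_mult; [exact Hf|now apply Ccont_ln_pow]. Qed.

Definition remainder (k : R -> C) (c : nat -> C) (n M : nat) : R -> C :=
  mul_ln n (fun t => k t - taylor_poly c M t)%C.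

Lemma left_interval (b : R) : interval_set (fun t => 0 < t <= b).
Proof.
  intros x y z Hx Hy Hz.
  assert (0 < Rmin x y) by (apply Rmin_pos; lra). assert (Rmax x y <= b) by (apply Rmax_lub; lra). lra.
Qed.

Lemma left_eventually (b : R) : 0 < b -> at_right 0 (fun t => 0 < t <= b).
Proof. intros Hb. apply (at_right_0_small _ b Hb). intros; lra. Qed.

(** Once [M >= Re l0 + 1], the factor [t^M] outweighs [t^(-l0)], the logarithms and
    [exp(d |ln t|)] with [d = 1/2] together: the integrand is bounded. *)
Lemma powint_remainder (a : Rbar) (k : R -> C) (c : nat -> C) (b : R) (n M : nat) (l0 : C) :
  local_expansion a k c b -> Re l0 + 1 <= INR M ->
  analytic_at (powint (remainder k c n M) b (at_right 0)) l0 /\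
  is_powint (remainder k c n M) b (at_right 0) l0 (powint (remainder k c n M) b (at_right 0) l0).
Proof.
  intros [Hb [Hba [Hk HB]]] HM. destruct (HB M) as [B [HB0 HB']].
  set (d := / 2). assert (Hd : 0 < d) by (unfold d; lra).
  set (K := INR (fact n) / d ^ n).
  assert (HK : 0 < K) by (apply Rdiv_lt_0_compat; [apply INR_fact_lt_0|now apply pow_lt]).
  destruct (powint_analytic (fun t => 0 < t <= b) (remainder k c n M) (fun _ => B * K) b (at_right 0)
    (B * K * 0 - B * K * b) l0 d) as [H1 H2].
  - easy.
  - apply left_interval.
  - lra.
  - apply left_eventually. lra.
  - intros; lra.
  - intros t Ht. apply Ccont_mul_ln; [lra|]. apply Ccont_minus; [|apply Ccont_taylor_poly].
    apply Hk. split; [lra|]. destruct a as [a| |]; simpl in *; [lra|easy|easy].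
  - intros t Ht. unfold remainder, mul_ln. rewrite Cmod_mult, Cmod_Rcpow. unfold Rpower.
    change (Re (- l0)) with (- Re l0).
    assert (Hln : ln t < 0) by (rewrite <- ln_1; apply ln_increasing; lra).
    apply Rle_trans with (B * t ^ M * (K * exp (d * Rabs (ln t))) * exp (- Re l0 * ln t) * exp (d * Rabs (ln t))).
    + apply Rmult_le_compat_r; [left; apply exp_pos|]. apply Rmult_le_compat_r; [left; apply exp_pos|].
      apply Rmult_le_compat; [apply Cmod_ge_0|apply Cmod_ge_0|now apply HB'|now apply Cmod_ln_pow_le].
    + rewrite <- Rpower_pow by lra. unfold Rpower. rewrite Rabs_left by easy.
      replace (B * exp (INR M * ln t) * (K * exp (d * - ln t)) * exp (- Re l0 * ln t) * exp (d * - ln t))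
        with (B * K * exp ((INR M - Re l0 - 1) * ln t)).
      2:{ replace ((INR M - Re l0 - 1) * ln t) with (INR M * ln t + d * - ln t + - Re l0 * ln t + d * - ln t)
            by (unfold d; field). rewrite !exp_plus. ring. }
      rewrite <- (Rmult_1_r (B * K)) at 2. apply Rmult_le_compat_l; [apply Rmult_le_pos; lra|].
      assert (0 <= (INR M - Re l0 - 1) * - ln t) by (apply Rmult_le_pos; lra).
      apply Rle_trans with (exp 0); [apply exp_le_mono; lra|rewrite exp_0; lra].
  - apply (is_RInt_gen_prim (fun t => 0 < t <= b) _ (fun t => B * K * t) b (at_right 0)).
    + apply left_interval.
    + lra.
    + apply left_eventually. lra.
    + intros t _. auto_derive; [easy|ring].
    + intros t _. apply continuous_const.
    + assert (Hc : continuous (fun t => B * K * t) 0).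
      { apply (ex_derive_continuous (K := R_AbsRing) (V := R_NormedModule)). auto_derive. easy. }
      intros P HP. apply filter_le_within. now apply Hc.
  - split; [exact H1|]. apply H2. replace (l0 - l0)%C with (RtoC 0) by ring. now rewrite Cmod_0.
Qed.

Lemma monomial_power (j n : nat) (l : C) (c : C) (t : R) : 0 < t ->
  (mul_ln n (fun t => c * RtoC (t ^ j)) t * Rcpow t (- l))%C
  = (c * (Rcpow t (RtoC (INR (S j)) - l - 1) * RtoC (ln t ^ n)))%C.
Proof.
  intros Ht. unfold mul_ln. rewrite <- Rcpow_nat by easy.
  replace (RtoC (INR (S j)) - l - 1)%C with (RtoC (INR j) + - l)%C by (rewrite S_INR, RtoC_plus; ring).
  rewrite Rcpow_plus. ring.
Qed.

Lemma pow_ln_cont (n : nat) (s : C) (t : R) : 0 < t -> Ccont (fun t => Rcpow t s * RtoC (ln t ^ n))%C t.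
Proof. intros Ht. apply Ccont_mult; [now apply Ccont_Rcpow|now apply Ccont_ln_pow]. Qed.

Lemma powint_monomial_0 (j n : nat) (b : R) (l c : C) :
  0 < b -> Re l < INR (S j) ->
  is_powint (mul_ln n (fun t => c * RtoC (t ^ j))%C) b (at_right 0) l
    (c * (0 - pow_ln_prim n (RtoC (INR (S j)) - l) b))%C.
Proof.
  intros Hb Hl. set (s := (RtoC (INR (S j)) - l)%C).
  assert (Hs : 0 < Re s) by (unfold s; change (0 < INR (S j) - Re l); lra).
  apply (is_CInt_gen_ext (fun t => 0 < t <= b) (fun t => c * (Rcpow t (s - 1) * RtoC (ln t ^ n)))%C _ b (at_right 0)).
  - apply left_interval.
  - lra.
  - now apply left_eventually.
  - intros t Ht. symmetry. apply monomial_power. lra.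
  - apply is_CInt_gen_scal; [typeclasses eauto|].
    apply (is_CInt_gen_prim (fun t => 0 < t <= b) _ (pow_ln_prim n s) b (at_right 0)).
    + apply left_interval.
    + lra.
    + now apply left_eventually.
    + intros t Ht. apply pow_ln_prim_derive; [|lra]. intros E. rewrite E in Hs. simpl in Hs. lra.
    + intros t Ht. apply pow_ln_cont. lra.
    + now apply pow_ln_prim_vanishes.
Qed.

Lemma powint_monomial_1 (j n : nat) (b : R) (l c : C) :
  0 < b < 1 -> l <> RtoC (INR (S j)) ->
  is_powint (mul_ln n (fun t => c * RtoC (t ^ j))%C) b (at_point 1) l
    (c * (mellin_pole n (RtoC (INR (S j)) - l) - pow_ln_prim n (RtoC (INR (S j)) - l) b))%C.
Proof.
  intros Hb Hl. set (s := (RtoC (INR (S j)) - l)%C).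
  apply (is_RInt_gen_at_point (V := C_R_NormedModule)).
  apply (is_RInt_ext (V := C_R_NormedModule) (fun t => c * (Rcpow t (s - 1) * RtoC (ln t ^ n)))%C).
  - intros t Ht. rewrite Rmin_left, Rmax_right in Ht by lra. symmetry. apply monomial_power. lra.
  - apply is_CInt_scal. rewrite <- pow_ln_prim_1.
    apply is_CInt_derive; intros t Ht; rewrite Rmin_left, Rmax_right in Ht by lra.
    + apply pow_ln_prim_derive; [|lra]. apply Cminus_neq0. now apply not_eq_sym.
    + apply pow_ln_cont. lra.
Qed.

(** Continuation in [l] of [int_b^0 k(t) (ln t)^n t^(-l) dt]: the Taylor terms
    are integrated from [b] to 1 and their integrals from 1 to 0 are replaced by
    the rational functions that continue them. *)
Definition left_part (k : R -> C) (c : nat -> C) (b : R) (n M : nat) (l : C) : C :=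
  (powint (remainder k c n M) b (at_right 0) l + powint (mul_ln n (taylor_poly c M)) b (at_point 1) l
   - csum (fun j => c j * mellin_pole n (RtoC (INR (S j)) - l)) M)%C.

Lemma powint_taylor_poly (c : nat -> C) (b : R) (n M : nat) (l0 : C) :
  0 < b < 1 ->
  analytic_at (powint (mul_ln n (taylor_poly c M)) b (at_point 1)) l0 /\
  forall l, is_powint (mul_ln n (taylor_poly c M)) b (at_point 1) l
    (powint (mul_ln n (taylor_poly c M)) b (at_point 1) l).
Proof.
  intros Hb. apply powint_proper_analytic; [easy|].
  intros t Ht. apply Ccont_mul_ln; [easy|apply Ccont_taylor_poly].
Qed.

Lemma is_powint_minus (f g : R -> C) (h : R -> C) (b : R) (F : (R -> Prop) -> Prop) {FF : Filter F} (l v w : C) :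
  (forall t, h t = f t - g t)%C -> is_powint f b F l v -> is_powint g b F l w -> is_powint h b F l (v - w)%C.
Proof.
  intros E Hf Hg. 
  apply (is_CInt_gen_ext (fun _ => True) (fun t => f t * Rcpow t (- l) - g t * Rcpow t (- l))%C _ b F).
  - easy.
  - easy.
  - now apply filter_forall.
  - intros t _. rewrite E. ring.
  - now apply is_CInt_gen_minus.
Qed.

Lemma remainder_succ (k : R -> C) (c : nat -> C) (b : R) (n M : nat) (l w : C) :
  0 < b -> Re l < INR (S M) ->
  is_powint (remainder k c n M) b (at_right 0) l w ->
  is_powint (remainder k c n (S M)) b (at_right 0) l
    (w - c M * (0 - pow_ln_prim n (RtoC (INR (S M)) - l) b))%C.
Proof.
  intros Hb Hl H.
  apply (is_powint_minus (remainder k c n M) (mul_ln n (fun t => c M * RtoC (t ^ M))%C)).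
  - typeclasses eauto.
  - intros t. unfold remainder, mul_ln, taylor_poly. cbn [csum]. ring.
  - exact H.
  - now apply powint_monomial_0.
Qed.

Lemma remainder_pred (k : R -> C) (c : nat -> C) (b : R) (n M : nat) (l w : C) :
  0 < b -> Re l < INR (S M) ->
  is_powint (remainder k c n (S M)) b (at_right 0) l w ->
  exists v, is_powint (remainder k c n M) b (at_right 0) l v.
Proof.
  intros Hb Hl H.
  exists (w - - c M * (0 - pow_ln_prim n (RtoC (INR (S M)) - l) b))%C.
  apply (is_powint_minus (remainder k c n (S M)) (mul_ln n (fun t => - c M * RtoC (t ^ M))%C)).
  - typeclasses eauto.
  - intros t. unfold remainder, mul_ln, taylor_poly. cbn [csum]. ring.
  - exact H.
  - now apply powint_monomial_0.
Qed.

Lemma Re_neq (l : C) (x : R) : Re l < x -> l <> RtoC x.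
Proof. intros H E. rewrite E in H. simpl in H. lra. Qed.

(** Moving [c_M t^M] from the remainder to the polynomial changes nothing: for
    [Re l < M + 1] the rational function is the integral over [[0,1]], the sum of
    those over [[0,b]] and [[b,1]]. *)
Lemma left_part_succ (k : R -> C) (c : nat -> C) (b : R) (n M : nat) (l w : C) :
  0 < b < 1 -> Re l < INR (S M) ->
  is_powint (remainder k c n M) b (at_right 0) l w ->
  left_part k c b n (S M) l = left_part k c b n M l.
Proof.
  intros Hb Hl H. unfold left_part.
  rewrite (powint_unique _ b (at_right 0) _ _ (remainder_succ k c b n M l w ltac:(lra) Hl H)).
  rewrite (powint_unique _ b (at_right 0) _ _ H).
  assert (HT : is_powint (mul_ln n (taylor_poly c (S M))) b (at_point 1) l
     (powint (mul_ln n (taylor_poly c M)) b (at_point 1) l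
      - - c M * (mellin_pole n (RtoC (INR (S M)) - l) - pow_ln_prim n (RtoC (INR (S M)) - l) b))%C).
  { apply (is_powint_minus (mul_ln n (taylor_poly c M)) (mul_ln n (fun t => - c M * RtoC (t ^ M))%C)).
    - typeclasses eauto.
    - intros t. unfold mul_ln, taylor_poly. cbn [csum]. ring.
    - now apply powint_taylor_poly.
    - apply powint_monomial_1; [easy|]. now apply Re_neq. }
  rewrite (powint_unique _ b (at_point 1) _ _ HT). cbn [csum]. ring.
Qed.

Lemma left_part_stable (a : Rbar) (k : R -> C) (c : nat -> C) (b : R) (n M N : nat) (l : C) :
  local_expansion a k c b -> Re l + 1 <= INR M -> (M <= N)%nat ->
  left_part k c b n N l = left_part k c b n M l.
Proof.
  intros Hloc HM HN. induction HN as [|N HN IH]; [easy|].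
  rewrite <- IH. assert (HMN : INR M <= INR N) by now apply le_INR.
  destruct (powint_remainder a k c b n N l Hloc ltac:(lra)) as [_ H].
  apply (left_part_succ k c b n N l _ (proj1 Hloc)) with (2 := H).
  rewrite S_INR. lra.
Qed.

(** In the strip every Taylor term is integrable at 0, so that the degree can be
    lowered to 0, where no term has been removed. *)
Lemma left_part_strip (k : R -> C) (c : nat -> C) (b : R) (n M : nat) (l w : C) :
  0 < b < 1 -> Re l < 1 ->
  is_powint (remainder k c n M) b (at_right 0) l w ->
  is_powint (mul_ln n k) b (at_right 0) l (left_part k c b n M l).
Proof.
  intros Hb Hl. revert w. induction M as [|M IH]; intros w H.
  - assert (E : left_part k c b n 0 l = w).
    { unfold left_part. rewrite (powint_unique _ b (at_right 0) _ _ H).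
      assert (H0 : is_powint (mul_ln n (taylor_poly c 0)) b (at_point 1) l (0 * powint (mul_ln n (taylor_poly c 0)) b (at_point 1) l)%C).
      { apply (is_CInt_gen_ext (fun _ => True) (fun t => 0 * (mul_ln n (taylor_poly c 0) t * Rcpow t (- l)))%C _ b (at_point 1)); try easy.
        - intros t _. unfold mul_ln, taylor_poly. simpl csum. ring.
        - apply is_CInt_gen_scal; [typeclasses eauto|]. now apply powint_taylor_poly. }
      rewrite (powint_unique _ b (at_point 1) _ _ H0). simpl csum. ring. }
    rewrite E. revert H. apply (is_CInt_gen_ext (fun _ => True) _ _ b (at_right 0)); try easy.
    + now apply filter_forall.
    + intros t _. unfold remainder, mul_ln, taylor_poly. simpl csum. ring.
  - assert (HS : Re l < INR (S M)) by (rewrite S_INR; pose proof (pos_INR M); lra).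
    destruct (remainder_pred k c b n M l w ltac:(lra) HS H) as [v Hv].
    rewrite (left_part_succ k c b n M l v Hb HS Hv). now apply (IH v).
Qed.

(** * The continued Mellin transform *)

(** By [left_part_stable] any degree at least [Re l + 1] gives the same value; this
    is merely a choice of one. *)
Definition level (l : C) : nat := Z.to_nat (up (Re l + 1)).

Lemma level_spec (l : C) : Re l + 1 <= INR (level l).
Proof.
  unfold level. destruct (archimed (Re l + 1)) as [H _].
  destruct (Z.le_gt_cases 0 (up (Re l + 1))) as [H0|H0].
  - rewrite INR_IZR_INZ, Z2Nat.id by easy. lra.
  - apply IZR_lt in H0. pose proof (pos_INR (Z.to_nat (up (Re l + 1)))). lra.
Qed.

Definition mellin_cont (a : Rbar) (k : R -> C) (c : nat -> C) (b : R) (n : nat) (l : C) : C :=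
  (powint (mul_ln n k) b (to_upper a) l - left_part k c b n (level l) l)%C.

Definition upper_convergent (a d : Rbar) (k : R -> C) (b : R) (n : nat) : Prop :=
  forall l, Rbar_lt d (Re l) ->
  analytic_at (powint (mul_ln n k) b (to_upper a)) l /\
  is_powint (mul_ln n k) b (to_upper a) l (powint (mul_ln n k) b (to_upper a) l).

Lemma mellin_cont_near (a : Rbar) (k : R -> C) (c : nat -> C) (b : R) (n N : nat) (l0 : C) :
  local_expansion a k c b -> Re l0 + 2 <= INR N ->
  locally l0 (fun l => mellin_cont a k c b n l = powint (mul_ln n k) b (to_upper a) l - left_part k c b n N l)%C.
Proof.
  intros Hloc HN. apply (locally_C_intro l0 1); [lra|]. intros l Hl. unfold mellin_cont. f_equal.
  pose proof (re_le_Cmod (l - l0)) as Hr. change (Re (l - l0)) with (Re l - Re l0) in Hr.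
  assert (Hr2 : Rabs (Re l - Re l0) < 1) by lra. apply Rabs_def2 in Hr2.
  pose proof (level_spec l) as HL.
  destruct (Nat.le_ge_cases (level l) N) as [H|H].
  - symmetry. now apply (left_part_stable a).
  - apply (left_part_stable a); [easy|lra|easy].
Qed.

Lemma mellin_cont_strip (a d : Rbar) (k : R -> C) (c : nat -> C) (b : R) (n : nat) (l : C) :
  local_expansion a k c b -> upper_convergent a d k b n ->
  Rbar_lt d (Re l) -> Re l < 1 ->
  is_Mellin a (mul_ln n k) (1 - l) (mellin_cont a k c b n l).
Proof.
  intros Hloc Hup Hd Hl. unfold is_Mellin, is_int0.
  replace (1 - l - 1)%C with (- l)%C by ring.
  destruct (powint_remainder a k c b n (level l) l Hloc (level_spec l)) as [_ H].
  pose proof (left_part_strip k c b n _ l _ (proj1 Hloc) Hl H) as H1.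
  destruct (Hup l Hd) as [_ H2].
  apply (is_RInt_gen_swap (V := C_R_NormedModule)) in H1; try typeclasses eauto.
  pose proof (is_RInt_gen_Chasles (V := C_R_NormedModule) _ b _ _ H1 H2) as H3.
  unfold mellin_cont.
  match type of H3 with is_RInt_gen _ _ _ ?x => replace (_ - _)%C with (x : C) end; [exact H3|].
  change (- left_part k c b n (level l) l + powint (mul_ln n k) b (to_upper a) l = powint (mul_ln n k) b (to_upper a) l - left_part k c b n (level l) l)%C. ring.
Qed.

(** * Consequences of membership in the class *)

Lemma class_K_expansion (a d : Rbar) (k : R -> C) :
  Rbar_lt 0 a -> class_K a d k -> exists c b, local_expansion a k c b.
Proof.
  intros Ha [_ [[kz Hkz] _]].
  destruct (analytic_at_taylor kz (RtoC 0) (proj2 (Hkz 0 ltac:(lra) Ha))) as [c [r [B [Hr [HB H]]]]].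
  assert (Hb : exists b, 0 < b < 1 /\ b < r /\ Rbar_lt b a).
  { destruct a as [a| |]; simpl in *; [| |easy].
    - exists (Rmin (Rmin (/ 2) (r / 2)) (a / 2)).
      assert (0 < Rmin (Rmin (/ 2) (r / 2)) (a / 2)) by (repeat apply Rmin_pos; lra).
      pose proof (Rmin_l (Rmin (/ 2) (r / 2)) (a / 2)). pose proof (Rmin_r (Rmin (/ 2) (r / 2)) (a / 2)).
      pose proof (Rmin_l (/ 2) (r / 2)). pose proof (Rmin_r (/ 2) (r / 2)). lra.
    - exists (Rmin (/ 2) (r / 2)).
      assert (0 < Rmin (/ 2) (r / 2)) by (repeat apply Rmin_pos; lra).
      pose proof (Rmin_l (/ 2) (r / 2)). pose proof (Rmin_r (/ 2) (r / 2)). lra. }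
  destruct Hb as [b [Hb [Hbr Hba]]].
  exists c, b. split; [easy|]. split; [easy|]. split.
  - intros t Ht. 
    apply (Ccont_ext_loc (fun x => kz (RtoC x))).
    + generalize (inside_open a t Ht). apply filter_imp. intros x Hx.
      symmetry. apply Hkz; [apply Rlt_le|]; apply Hx.
    + destruct (proj2 (Hkz t (Rlt_le _ _ (proj1 Ht)) (proj2 Ht))) as [c' Hc'].
      destruct (analytic_at_lim kz (RtoC t) c' Hc') as [_ HL].
      apply (filterlim_comp _ _ _ RtoC kz (locally t) (locally (RtoC t))); [|exact HL].
      apply (Ccont_RtoC (fun x => x)). apply continuous_id.
  - intros M. exists (B / r ^ M). assert (HrM : 0 < r ^ M) by now apply pow_lt.
    split; [now apply Rdiv_le_0_compat|]. intros t Ht.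
    assert (Hta : Rbar_lt t a) by (destruct a as [a| |]; simpl in *; [lra|easy|easy]).
    rewrite (proj1 (Hkz t (Rlt_le _ _ (proj1 Ht)) Hta)).
    assert (E : Cmod (RtoC t - RtoC 0) = t).
    { replace (RtoC t - RtoC 0)%C with (RtoC t) by ring. rewrite Cmod_R. apply Rabs_pos_eq. lra. }
    destruct (H (RtoC t) ltac:(lra)) as [_ HM]. specialize (HM M). rewrite E in HM.
    unfold Rdiv in HM. rewrite Rpow_mult_distr, pow_inv in HM.
    replace (taylor_poly c M t) with (csum (fun j => (RtoC t - RtoC 0) ^ j * c j)%C M).
    + eapply Rle_trans; [exact HM|]. right. field. lra.
    + unfold taylor_poly. apply csum_ext. intros j _.
      replace (RtoC t - RtoC 0)%C with (RtoC t) by ring. rewrite <- RtoC_pow. ring.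
Qed.

(** The lower limit, fixed close to 0, cancels in the difference of two integrals
    with different upper limits. *)
Lemma is_int0_upper (f : R -> C) (a : Rbar) (b : R) (l : C) :
  inside a b -> (forall t, inside a t -> Ccont f t) -> is_int0 f a l ->
  exists L : C, is_CInt_gen f (at_point b) (to_upper a) L.
Proof.
  intros Hb Hf H. apply CInt_gen_cauchy; [typeclasses eauto|]. intros e He.
  assert (He2 : 0 < e / 2) by lra.
  assert (HL : locally l (fun w => Cmod (w - l) < e / 2)) by now apply (locally_C_intro l (e / 2)).
  destruct (H _ HL) as [Q1 Q2 HQ1 HQ2 HQ].
  destruct (filter_ex _ (filter_and _ _ (left_eventually b (proj1 Hb)) HQ1)) as [x [Hx HxQ]].
  assert (Hix : inside a x).
  { split; [lra|]. destruct Hb as [_ Hb]. destruct a as [a| |]; simpl in *; [lra|easy|easy]. }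
  destruct (ex_CInt_cont f b x) as [Ix HIx].
  { intros t Ht. apply Hf. now apply (inside_interval a b x). }
  exists Q2. split; [easy|]. intros y y' Hy Hy'.
  destruct (HQ x y HxQ Hy) as [I [HI HIe]]. destruct (HQ x y' HxQ Hy') as [I' [HI' HIe']].
  exists (Ix + I)%C, (Ix + I')%C. split; [|split].
  - apply (is_RInt_Chasles (V := C_R_NormedModule) f b x y Ix I HIx HI).
  - apply (is_RInt_Chasles (V := C_R_NormedModule) f b x y' Ix I' HIx HI').
  - replace (Ix + I' - (Ix + I))%C with ((I' - l) + (l - I))%C by ring.
    eapply Rle_lt_trans; [apply Cmod_triangle|]. rewrite (Cmod_sym l I).
    assert (T1 : Cmod ((I : C) - l) < e / 2) by exact HIe.
    assert (T2 : Cmod ((I' : C) - l) < e / 2) by exact HIe'. lra.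
Qed.

(** Convergence at a single real exponent of the strip, below [Re l], is all that
    integration by parts requires. *)
Lemma class_K_upper (a d : Rbar) (k : R -> C) (c : nat -> C) (b : R) (n : nat) :
  class_K a d k -> local_expansion a k c b -> upper_convergent a d k b n.
Proof.
  intros [_ [_ [Hd1 [_ HM]]]] [Hb [Hba [Hk _]]] l Hl.
  assert (Hs : exists sigma : R, Rbar_lt d sigma /\ sigma < Re l /\ sigma < 1).
  { destruct d as [d| |]; simpl in *; [|easy|].
    - exists ((d + Rmin (Re l) 1) / 2).
      pose proof (Rmin_l (Re l) 1). pose proof (Rmin_r (Re l) 1).
      assert (d < Rmin (Re l) 1) by now apply Rmin_glb_lt. lra.
    - exists (Rmin (Re l) 1 - 1). pose proof (Rmin_l (Re l) 1). pose proof (Rmin_r (Re l) 1).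
      split; [easy|]. lra. }
  destruct Hs as [sigma [Hs1 [Hs2 Hs3]]].
  destruct (HM (RtoC sigma) Hs1 Hs3) as [v Hv]. unfold is_Mellin in Hv.
  replace (1 - RtoC sigma - 1)%C with (- RtoC sigma)%C in Hv by ring.
  assert (Hin : inside a b) by (split; [lra|easy]).
  assert (Hc : forall t, inside a t -> Ccont (fun t => k t * Rcpow t (- RtoC sigma))%C t).
  { intros t Ht. apply Ccont_mult; [now apply Hk|apply Ccont_Rcpow, Ht]. }
  destruct (is_int0_upper _ a b v Hin Hc Hv) as [L HL].
  apply (powint_upper a b k sigma L n l); try easy; lra.
Qed.

(** * Divergent terms *)

(** The modulus is unbounded near 0, on account of the power if [s < 0] and of the
    logarithm if [s = 0]. *)
Lemma divergent_term_intro (c : C) (s : R) (j : nat) :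
  c <> 0%C -> s <= 0 -> (s < 0 \/ (0 < j)%nat) -> divergent_term (c, RtoC s, j).
Proof.
  intros Hc Hs Hsj [l Hl].
  assert (HcM : 0 < Cmod c) by now apply Cmod_gt_0.
  set (A := (Cmod l + 1) / Cmod c). assert (Hl0 := Cmod_ge_0 l).
  assert (HA : 0 < A) by (apply Rdiv_lt_0_compat; lra).
  set (X := match j with O => A / - s | _ => A end).
  pose proof (proj1 (filterlim_C (at_right 0) (pl_term (c, RtoC s, j)) l) Hl 1 Rlt_0_1) as H1.
  destruct (filter_ex _ (filter_and _ _ (filter_and _ _ (ln_to_minus_infty (- 1)) (ln_to_minus_infty (- X))) H1))
    as [t [[[Ht Hln1] [_ HlnX]] HT]].
  assert (Hbig : Cmod l + 1 <= Cmod (pl_term (c, RtoC s, j) t)).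
  { simpl. rewrite !Cmod_mult, Cmod_Rcpow, Cmod_R. unfold Rpower. change (Re (RtoC s)) with s.
    rewrite <- RPow_abs, Rabs_left by lra.
    replace (Cmod l + 1) with (Cmod c * A) by (unfold A; field; lra). rewrite Rmult_assoc.
    apply Rmult_le_compat_l; [lra|].
    assert (Hexp : 1 + s * ln t <= exp (s * ln t)) by apply exp_ineq1_le.
    assert (Hsl : 0 <= s * ln t) by nra.
    destruct j as [|j].
    - simpl. rewrite Rmult_1_r. unfold X in HlnX. destruct Hsj as [Hs'|Hj]; [|lia].
      apply Rle_trans with (s * ln t); [|lra].
      apply Rmult_lt_compat_l with (r := - s) in HlnX; [|lra].
      replace (- s * - (A / - s)) with (- A) in HlnX by (field; lra). lra.
    - apply Rle_trans with (1 * (- ln t) ^ 1).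
      + unfold X in HlnX. simpl. lra.
      + apply Rmult_le_compat; [lra|simpl; lra|lra|]. apply Rle_pow; [lra|lia]. }
  pose proof (Cmod_triangle_sub (pl_term (c, RtoC s, j) t) l 0) as T.
  replace (pl_term (c, RtoC s, j) t - 0)%C with (pl_term (c, RtoC s, j) t) in T by ring.
  replace (l - 0)%C with l in T by ring. lra.
Qed.

Lemma pl_sum_cons (p : C * C * nat) (D : list (C * C * nat)) (eps : R) :
  pl_sum (p :: D) eps = (pl_term p eps + pl_sum D eps)%C.
Proof. reflexivity. Qed.

Lemma pl_sum_nil (eps : R) : pl_sum nil eps = RtoC 0.
Proof. reflexivity. Qed.

Lemma pl_sum_app (D E : list (C * C * nat)) (eps : R) :
  pl_sum (D ++ E) eps = (pl_sum D eps + pl_sum E eps)%C.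
Proof.
  induction D as [|p D IH]; [rewrite pl_sum_nil, app_nil_l; ring|].
  rewrite <- app_comm_cons, !pl_sum_cons, IH. ring.
Qed.

Lemma Cinv_neq0 (z : C) : z <> 0%C -> (/ z)%C <> 0%C.
Proof.
  intros Hz E. apply Hz. transitivity (z * (z * / z))%C; [field; easy|]. rewrite E. ring.
Qed.

Lemma pow_ln_prim_divergent (n : nat) (s : R) (c : C) :
  s < 0 -> exists D, List.Forall divergent_term D /\
    forall eps, pl_sum D eps = (c * pow_ln_prim n (RtoC s) eps)%C.
Proof.
  intros Hs. assert (Hsc : RtoC s <> 0%C) by (intros E; apply RtoC_inj in E; lra).
  revert c. induction n as [|n IH]; intros c; (destruct (classic (c = 0%C)) as [->|Hc];
    [exists nil; split; [constructor|intros eps; cbn; ring]|]).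
  - exists ((c / RtoC s, RtoC s, O)%C :: nil). split.
    + constructor; [|constructor]. apply divergent_term_intro; [|lra|now left].
      apply Cmult_neq_0; [easy|now apply Cinv_neq0].
    + intros eps. rewrite pl_sum_cons, pl_sum_nil. cbn [pl_term pow_ln_prim].
      change (ln eps ^ 0) with 1. field. easy.
  - destruct (IH (- (RtoC (INR (S n))) * c / RtoC s)%C) as [D [HD HDs]].
    exists ((c / RtoC s, RtoC s, S n)%C :: D). split.
    + constructor; [|easy]. apply divergent_term_intro; [|lra|now left].
      apply Cmult_neq_0; [easy|now apply Cinv_neq0].
    + intros eps. rewrite pl_sum_cons, HDs. unfold pl_term. cbn [pow_ln_prim]. field. easy.
Qed.

(** * The finite part *)

(** Inversion sends 0 to 0 in [C]: a polar term evaluated at its own pole is 0.  The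
    value of [left_part] at an integer is therefore already the value of its
    regular part. *)
Lemma mellin_pole_0 (n : nat) : mellin_pole n 0 = 0%C.
Proof.
  unfold mellin_pole. cbn [Cpow].
  replace (/ RtoC 0)%C with (RtoC 0); [ring|].
  unfold Cinv, RtoC. simpl. f_equal; unfold Rdiv; ring.
Qed.

(** The explicit primitive takes at 1 the value [mellin_pole]: this is how the
    rational functions of the continuation reappear as the constants of the finite
    part.  For [j + 1 = m] the primitive is a power of the logarithm, which has no
    constant term, in agreement with [mellin_pole n 0 = 0]. *)
Lemma monomial_fp (c : C) (n j m : nat) :
  exists (D : list (C * C * nat)) (R0 : R -> C),
    List.Forall divergent_term D /\ filterlim R0 (at_right 0) (locally (RtoC 0)) /\
    forall eps, 0 < eps ->
      is_CInt (fun t => mul_ln n (fun t => c * RtoC (t ^ j)) t * Rcpow t (- RtoC (INR m)))%C 1 eps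
        (- (pl_sum D eps + c * mellin_pole n (RtoC (INR (S j)) - RtoC (INR m)) + R0 eps))%C.
Proof.
  set (s := (RtoC (INR (S j)) - RtoC (INR m))%C).
  assert (Es : s = RtoC (INR (S j) - INR m)) by (unfold s; now rewrite RtoC_minus).
  assert (Hpos : forall eps t, 0 < eps -> Rmin 1 eps <= t <= Rmax 1 eps -> 0 < t).
  { intros eps t He Ht. assert (0 < Rmin 1 eps) by (apply Rmin_pos; lra). lra. }
  assert (Hint : forall (P : R -> C) eps, 0 < eps ->
     (forall t, 0 < t -> is_Cderive P t (Rcpow t (s - 1) * RtoC (ln t ^ n))%C) ->
     is_CInt (fun t => mul_ln n (fun t => c * RtoC (t ^ j)) t * Rcpow t (- RtoC (INR m)))%C 1 eps
       (c * (P eps - P 1))%C).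
  { intros P eps He HP.
    apply (is_RInt_ext (V := C_R_NormedModule) (fun t => c * (Rcpow t (s - 1) * RtoC (ln t ^ n)))%C).
    - intros t Ht. symmetry. apply monomial_power. apply (Hpos eps); [easy|lra].
    - apply is_CInt_scal. apply is_CInt_derive; intros t Ht.
      + apply HP. now apply (Hpos eps).
      + apply pow_ln_cont. now apply (Hpos eps). }
  assert (Hs0 : forall x, s = RtoC x -> x <> 0 -> s <> 0%C).
  { intros x -> Hx E. apply RtoC_inj in E. easy. }
  destruct (Nat.lt_trichotomy (S j) m) as [Hlt|[Heq|Hgt]].
  - assert (Hs : INR (S j) - INR m < 0) by (apply lt_INR in Hlt; lra).
    assert (Hsn : s <> 0%C) by (apply (Hs0 _ Es); lra).
    destruct (pow_ln_prim_divergent n _ (- c) Hs) as [D [HD HDs]]. rewrite <- Es in HDs.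
    exists D, (fun _ => RtoC 0). split; [easy|]. split; [apply filterlim_C_const; typeclasses eauto|].
    intros eps He. rewrite HDs, <- pow_ln_prim_1.
    replace (- (- c * pow_ln_prim n s eps + c * pow_ln_prim n s 1 + 0))%C
      with (c * (pow_ln_prim n s eps - pow_ln_prim n s 1))%C by ring.
    apply Hint; [easy|]. intros t Ht. now apply pow_ln_prim_derive.
  - assert (Es0 : s = 0%C) by (rewrite Es, Heq; f_equal; ring).
    assert (Hn : INR (S n) <> 0) by (apply not_0_INR; lia).
    assert (HD : exists D, List.Forall divergent_term D /\
      forall eps, pl_sum D eps = (- c * RtoC (ln eps ^ S n / INR (S n)))%C).
    { destruct (classic (c = 0%C)) as [->|Hc].
      - exists nil. split; [constructor|]. intros eps. rewrite pl_sum_nil. ring.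
      - exists ((- c * RtoC (/ INR (S n)), RtoC 0, S n)%C :: nil). split.
        + constructor; [|constructor]. apply divergent_term_intro; [|lra|right; lia].
          apply Cmult_neq_0.
          * intros E. apply Hc. replace c with (- - c)%C by ring. rewrite E. ring.
          * intros E. apply RtoC_inj in E. now apply Rinv_neq_0_compat in Hn.
        + intros eps. rewrite pl_sum_cons, pl_sum_nil. unfold pl_term.
          rewrite Rcpow_0. unfold Rdiv. rewrite RtoC_mult. ring. }
    destruct HD as [D [HD HDs]].
    exists D, (fun _ => RtoC 0). split; [easy|]. split; [apply filterlim_C_const; typeclasses eauto|].
    intros eps He. rewrite HDs, Es0, mellin_pole_0.
    replace (- (- c * RtoC (ln eps ^ S n / INR (S n)) + c * 0 + 0))%C
      with (c * (RtoC (ln eps ^ S n / INR (S n)) - RtoC (ln 1 ^ S n / INR (S n))))%C.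
    2:{ rewrite ln_1, pow_i by lia. unfold Rdiv at 2. rewrite Rmult_0_l. ring. }
    apply (Hint (fun t => RtoC (ln t ^ S n / INR (S n)))); [easy|]. intros t Ht.
    eapply is_Cderive_eq.
    + apply (is_Cderive_RtoC (fun t => ln t ^ S n / INR (S n)) t (INR (S n) * ln t ^ n * / t * / INR (S n))).
      apply (is_derive_ext (fun t => / INR (S n) * ln t ^ S n)).
      { intros x. apply Rmult_comm. }
      replace (INR (S n) * ln t ^ n * / t * / INR (S n)) with (/ INR (S n) * (INR (S n) * ln t ^ pred (S n) * / t)) by (cbn [pred]; ring).
      apply (is_derive_scal (fun t => ln t ^ S n)). now apply is_derive_ln_pow.
    + rewrite Es0. rewrite Rcpow_pred, Rcpow_0 by easy. rewrite Cmult_1_l, <- RtoC_mult. f_equal. field. split; [lra|easy].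
  - assert (Hs : 0 < INR (S j) - INR m) by (apply lt_INR in Hgt; lra).
    assert (Hsn : s <> 0%C) by (apply (Hs0 _ Es); lra).
    exists nil, (fun eps => - c * pow_ln_prim n s eps)%C. split; [constructor|]. split.
    + apply (filterlim_C_eq (at_right 0) (fun eps => - c * pow_ln_prim n s eps)%C _ (- c * 0)%C).
      * now apply filter_forall.
      * ring.
      * apply filterlim_C_scal; [typeclasses eauto|]. apply pow_ln_prim_vanishes. now rewrite Es.
    + intros eps He. rewrite pl_sum_nil, <- pow_ln_prim_1.
      replace (- (0 + c * pow_ln_prim n s 1 + - c * pow_ln_prim n s eps))%C
        with (c * (pow_ln_prim n s eps - pow_ln_prim n s 1))%C by ring.
      apply Hint; [easy|]. intros t Ht. now apply pow_ln_prim_derive.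
Qed.

Lemma taylor_poly_fp (c : nat -> C) (n m M : nat) :
  exists (D : list (C * C * nat)) (R0 : R -> C),
    List.Forall divergent_term D /\ filterlim R0 (at_right 0) (locally (RtoC 0)) /\
    forall eps, 0 < eps ->
      is_CInt (fun t => mul_ln n (taylor_poly c M) t * Rcpow t (- RtoC (INR m)))%C 1 eps
        (- (pl_sum D eps + csum (fun j => c j * mellin_pole n (RtoC (INR (S j)) - RtoC (INR m))) M + R0 eps))%C.
Proof.
  induction M as [|M [D [R0 [HD [HR HI]]]]].
  - exists nil, (fun _ => RtoC 0). split; [constructor|]. split; [apply filterlim_C_const; typeclasses eauto|].
    intros eps He. rewrite pl_sum_nil. simpl csum.
    apply (is_RInt_ext (V := C_R_NormedModule) (fun t => 0 * Rcpow t 0)%C).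
    + intros t _. change (0 * Rcpow t 0 = mul_ln n (taylor_poly c 0) t * Rcpow t (- RtoC (INR m)))%C.
      unfold mul_ln, taylor_poly. simpl csum. ring.
    + destruct (ex_CInt_cont (fun t => Rcpow t 0) 1 eps) as [I HI].
      * intros t Ht. apply Ccont_Rcpow. assert (0 < Rmin 1 eps) by (apply Rmin_pos; lra). lra.
      * replace (- (0 + 0 + 0))%C with (0 * I)%C by ring. now apply is_CInt_scal.
  - destruct (monomial_fp (c M) n M m) as [D' [R1 [HD' [HR' HI']]]].
    exists (D ++ D'), (fun eps => R0 eps + R1 eps)%C. split; [now apply Forall_app|]. split.
    + apply (filterlim_C_eq (at_right 0) (fun eps => R0 eps + R1 eps)%C _ (0 + 0)%C).
      * now apply filter_forall.
      * ring.
      * now apply filterlim_C_plus; [typeclasses eauto| |].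
    + intros eps He. rewrite pl_sum_app. cbn [csum].
      pose proof (is_RInt_plus (V := C_R_NormedModule) _ _ 1 eps _ _ (HI eps He) (HI' eps He)) as H.
      set (S0 := csum (fun j => c j * mellin_pole n (RtoC (INR (S j)) - RtoC (INR m)))%C M) in *.
      set (p := mellin_pole n (RtoC (INR (S M)) - RtoC (INR m))) in *.
      replace (- (pl_sum D eps + pl_sum D' eps + (S0 + c M * p) + (R0 eps + R1 eps)))%C
        with (- (pl_sum D eps + S0 + R0 eps) + - (pl_sum D' eps + c M * p + R1 eps))%C by ring.
      revert H. apply (is_RInt_ext (V := C_R_NormedModule)). intros t _.
      change (mul_ln n (taylor_poly c M) t * Rcpow t (- RtoC (INR m))
         + mul_ln n (fun t => c M * RtoC (t ^ M)) t * Rcpow t (- RtoC (INR m))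
         = mul_ln n (taylor_poly c (S M)) t * Rcpow t (- RtoC (INR m)))%C.
      unfold mul_ln, taylor_poly. cbn [csum]. ring.
Qed.

(** All divergence sits in the integral of the Taylor polynomial from [eps] to 1;
    the other pieces of the integral from [eps] to [A] converge. *)
Lemma is_fp_fin_left_part (a : Rbar) (k : R -> C) (c : nat -> C) (b : R) (n m M : nat) (g : R -> C) (A : R) (I : C) :
  local_expansion a k c b -> INR m + 1 <= INR M -> b < A -> Rbar_le A a ->
  (forall t, 0 < t -> g t = mul_ln n k t * Rcpow t (- RtoC (INR m)))%C ->
  is_powint (mul_ln n k) b (at_left A) (RtoC (INR m)) I ->
  is_fp_fin g A (I - left_part k c b n M (RtoC (INR m)))%C.
Proof.
  intros Hloc HM HbA HAa Hg HI.
  destruct (Hloc) as [Hb [Hba [Hk _]]].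
  set (l := RtoC (INR m)).
  set (f := fun t => (mul_ln n k t * Rcpow t (- l))%C).
  assert (Hin : inside a b) by (split; [lra|easy]).
  assert (Hf : forall t, inside a t -> Ccont f t).
  { intros t Ht. apply Ccont_mult; [apply Ccont_mul_ln; [apply Ht|now apply Hk]|apply Ccont_Rcpow, Ht]. }
  destruct (C_primitive a f b Hin Hf) as [V HV].
  assert (Hin' : forall eps, 0 < eps <= b -> inside a eps).
  { intros eps He. split; [lra|]. destruct a as [a| |]; simpl in *; [lra|easy|easy]. }
  destruct (taylor_poly_fp c n m M) as [D [R0 [HD [HR HP]]]]. fold l in HP.
  set (S0 := csum (fun j => c j * mellin_pole n (RtoC (INR (S j)) - l))%C M) in *.
  exists (fun eps => I - V eps - pl_sum D eps)%C, D. split; [easy|]. split.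
  - generalize (left_eventually b (proj1 Hb)). apply filter_imp. intros eps He.
    replace (I - V eps - pl_sum D eps + pl_sum D eps)%C with (- V eps + I)%C by ring.
    apply (is_RInt_gen_Chasles (V := C_R_NormedModule) g b (- V eps)%C I).
    + apply (is_RInt_gen_at_point (V := C_R_NormedModule)).
      apply (is_RInt_ext (V := C_R_NormedModule) f).
      * intros t Ht. symmetry. apply Hg. rewrite Rmin_left in Ht by lra. lra.
      * apply (is_RInt_swap (V := C_R_NormedModule)). now apply HV, Hin'.
    + apply (is_CInt_gen_ext (fun t => b <= t /\ Rbar_lt t A) f _ b (at_left A)).
      * apply from_interval.
      * split; [lra|easy].
      * now apply (to_upper_from (Finite A) b).
      * intros t [Ht _]. symmetry. apply Hg. lra.
      * exact HI.
  - destruct (powint_remainder a k c b n M l Hloc HM) as [_ HU].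
    assert (HT := proj2 (powint_taylor_poly c b n M l Hb) l).
    apply (is_RInt_gen_at_point (V := C_R_NormedModule)) in HT.
    apply (filterlim_C (at_right 0)). intros e He. assert (He2 : 0 < e / 2) by lra.
    generalize (filter_and _ _ (left_eventually b (proj1 Hb)) (filter_and _ _
      (proj1 (is_CInt_gen_point _ b (at_right 0) _) HU _ He2)
      (proj1 (filterlim_C (at_right 0) R0 0%C) HR _ He2))).
    apply filter_imp. intros eps [Heps [[U [HUi HUe]] HRe]].
    assert (HQ : is_CInt (fun t => mul_ln n (taylor_poly c M) t * Rcpow t (- l))%C b eps
       (powint (mul_ln n (taylor_poly c M)) b (at_point 1) l + - (pl_sum D eps + S0 + R0 eps))%C).
    { apply (is_RInt_Chasles (V := C_R_NormedModule) _ b 1 eps _ _ HT (HP eps (proj1 Heps))). }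
    assert (EV : V eps = (U + (powint (mul_ln n (taylor_poly c M)) b (at_point 1) l + - (pl_sum D eps + S0 + R0 eps)))%C).
    { apply (is_CInt_unique f b eps); [now apply HV, Hin'|].
      pose proof (is_RInt_plus (V := C_R_NormedModule) _ _ b eps _ _ HUi HQ) as H.
      revert H. apply (is_RInt_ext (V := C_R_NormedModule)). intros t _.
      change (remainder k c n M t * Rcpow t (- l) + mul_ln n (taylor_poly c M) t * Rcpow t (- l)
        = mul_ln n k t * Rcpow t (- l))%C.
      unfold remainder, mul_ln. ring. }
    unfold left_part. fold S0. rewrite EV.
    set (i0 := powint (remainder k c n M) b (at_right 0) l) in *.
    set (i1 := powint (mul_ln n (taylor_poly c M)) b (at_point 1) l) in *.
    replace (I - (U + (i1 + - (pl_sum D eps + S0 + R0 eps))) - pl_sum D eps - (I - (i0 + i1 - S0)))%C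
      with ((i0 - U) + (R0 eps - 0))%C by ring.
    eapply Rle_lt_trans; [apply Cmod_triangle|]. rewrite (Cmod_sym i0 U).
    assert (T : Cmod ((U : C) - i0) < e / 2) by exact HUe. lra.
Qed.

(** For infinite [a] the upper limit [A] enters the finite part over [[0,A]] only
    through the convergent integral from [b] to [A]. *)
Lemma is_fp_left_part (a : Rbar) (k : R -> C) (c : nat -> C) (b : R) (n m M : nat) (g : R -> C) (I : C) :
  local_expansion a k c b -> INR m + 1 <= INR M ->
  (forall t, 0 < t -> g t = mul_ln n k t * Rcpow t (- RtoC (INR m)))%C ->
  is_powint (mul_ln n k) b (to_upper a) (RtoC (INR m)) I ->
  is_fp g a (I - left_part k c b n M (RtoC (INR m)))%C.
Proof.
  intros Hloc HM Hg HI. destruct (Hloc) as [Hb [Hba [Hk _]]].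
  set (v := (I - left_part k c b n M (RtoC (INR m)))%C).
  destruct a as [a| |]; simpl in Hba; [| |easy].
  - apply (is_fp_fin_left_part a k c b n m M g a I); try easy. apply Rle_refl.
  - intros P HP. apply locally_C_elim in HP. destruct HP as [r [Hr HP]].
    change (Rbar_locally p_infty (fun y => exists w : C, is_fp_fin g y w /\ P w)).
    set (f := fun t => (mul_ln n k t * Rcpow t (- RtoC (INR m)))%C).
    assert (Hin : inside p_infty b) by (split; [lra|easy]).
    assert (Hf : forall t, inside p_infty t -> Ccont f t).
    { intros t Ht. apply Ccont_mult; [apply Ccont_mul_ln; [apply Ht|now apply Hk]|apply Ccont_Rcpow, Ht]. }
    destruct (C_primitive p_infty f b Hin Hf) as [K HK].
    assert (Hev : Rbar_locally p_infty (fun y => b < y)) by (exists b; auto).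
    generalize (filter_and _ _ Hev (proj1 (is_CInt_gen_point f b (Rbar_locally p_infty) I) HI r Hr)).
    apply filter_imp. intros y [Hy [J [HJ HJe]]].
    assert (Hiy : inside p_infty y) by (split; [lra|easy]).
    assert (EJ : K y = J) by (apply (is_CInt_unique f b y); [now apply HK|easy]).
    exists (K y - left_part k c b n M (RtoC (INR m)))%C. split.
    + apply (is_fp_fin_left_part p_infty k c b n m M g y (K y)); try easy.
      apply (is_CInt_gen_point f b (at_left y)). intros e He.
      assert (HKc := is_Cderive_cont K y _ (proj2 (HK y Hiy))).
      apply filter_le_within.
      generalize (filter_and _ _ (inside_open p_infty y Hiy) (proj1 (filterlim_C (locally y) K (K y)) HKc e He)).
      apply filter_imp. intros x [Hx Hxe]. exists (K x). split; [now apply HK|exact Hxe].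
    + apply HP. unfold v. rewrite EJ.
      match goal with |- Cmod ?x < _ => replace x with ((J : C) - I)%C by ring end. exact HJe.
Qed.

(** * Existence and uniqueness of the continuation *)

Lemma left_part_analytic (a : Rbar) (k : R -> C) (c : nat -> C) (b : R) (n N : nat) (l0 : C) :
  local_expansion a k c b -> Re l0 + 1 <= INR N ->
  (forall j, (j < N)%nat -> RtoC (INR (S j)) <> l0) ->
  analytic_at (left_part k c b n N) l0.
Proof.
  intros Hloc HN Hj. unfold left_part. apply analytic_at_minus; [apply analytic_at_plus|].
  - now apply (powint_remainder a).
  - now apply powint_taylor_poly, Hloc.
  - apply (analytic_at_csum (fun j l => c j * mellin_pole n (RtoC (INR (S j)) - l))%C).
    intros j Hj'. apply analytic_at_scal. apply mellin_pole_analytic. now apply Hj.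
Qed.

Lemma poles_isolated (l0 : C) (N : nat) :
  exists r, 0 < r /\ forall l, 0 < Cmod (l - l0) < r -> forall j, (j < N)%nat -> RtoC (INR (S j)) <> l.
Proof.
  induction N as [|N [r [Hr IH]]].
  - exists 1. split; [lra|]. intros; lia.
  - destruct (classic (RtoC (INR (S N)) = l0)) as [E|E].
    + exists r. split; [easy|]. intros l Hl j Hj El.
      destruct (Nat.eq_dec j N) as [->|Hne].
      * rewrite <- El, E in Hl. replace (l0 - l0)%C with (RtoC 0) in Hl by ring. rewrite Cmod_0 in Hl. lra.
      * apply (IH l Hl j); [lia|easy].
    + assert (Hd : 0 < Cmod (RtoC (INR (S N)) - l0)) by (apply Cmod_gt_0; now apply Cminus_neq0).
      exists (Rmin r (Cmod (RtoC (INR (S N)) - l0))). split; [now apply Rmin_pos|].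
      intros l [Hl0 Hl] j Hj El.
      destruct (Nat.eq_dec j N) as [->|Hne].
      * rewrite <- El in Hl. pose proof (Rmin_r r (Cmod (RtoC (INR (S N)) - l0))). lra.
      * apply (IH l) with (j := j); [|lia|easy]. split; [easy|].
        eapply Rlt_le_trans; [exact Hl|apply Rmin_l].
Qed.

Lemma mellin_cont_continuation (a d : Rbar) (k : R -> C) (c : nat -> C) (b : R) (n : nat) :
  Rbar_lt d 1 -> local_expansion a k c b -> upper_convergent a d k b n ->
  is_Mellin_continuation a d (mul_ln n k) (mellin_cont a k c b n).
Proof.
  intros Hd Hloc Hup. split.
  - intros l Hl1 Hl2. now apply (mellin_cont_strip a d).
  - intros l0 Hl0.
    assert (Hrho : exists rho, 0 < rho /\ forall x, 1 - rho < x -> Rbar_lt d x).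
    { destruct d as [d| |]; simpl in *; [|easy|].
      - exists (1 - d). split; [lra|]. intros; lra.
      - exists 1. split; [lra|easy]. }
    destruct Hrho as [rho [Hrho Hrho']].
    set (N := (level l0 + 2)%nat).
    assert (HN : Re l0 + 3 <= INR N).
    { unfold N. rewrite plus_INR. pose proof (level_spec l0). simpl INR. lra. }
    destruct (poles_isolated l0 N) as [r [Hr Hpoles]].
    apply (locally_C_intro l0 (Rmin (Rmin r rho) 1)).
    { repeat apply Rmin_pos; lra. }
    intros l Hl Hne.
    assert (Hlr : Cmod (l - l0) < r).
    { eapply Rlt_le_trans; [exact Hl|]. eapply Rle_trans; [apply Rmin_l|apply Rmin_l]. }
    assert (Hlrho : Cmod (l - l0) < rho).
    { eapply Rlt_le_trans; [exact Hl|]. eapply Rle_trans; [apply Rmin_l|apply Rmin_r]. }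
    assert (Hl1 : Cmod (l - l0) < 1) by (eapply Rlt_le_trans; [exact Hl|apply Rmin_r]).
    pose proof (re_le_Cmod (l - l0)) as Hre. change (Re (l - l0)) with (Re l - Re l0) in Hre.
    assert (Hre1 : Rabs (Re l - Re l0) < rho) by lra. apply Rabs_def2 in Hre1.
    assert (Hre2 : Rabs (Re l - Re l0) < 1) by lra. apply Rabs_def2 in Hre2.
    apply (analytic_at_ext_loc (fun l => powint (mul_ln n k) b (to_upper a) l - left_part k c b n N l)%C).
    + generalize (mellin_cont_near a k c b n N l Hloc ltac:(lra)). apply filter_imp. now intros z ->.
    + apply analytic_at_minus.
      * apply Hup. apply Hrho'. lra.
      * apply (left_part_analytic a); [easy|lra|]. apply Hpoles. split; [|easy].
        apply Cmod_gt_0. now apply Cminus_neq0.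
Qed.

(** The difference vanishes in the strip, and its zeros propagate along the real
    axis across the isolated singularities. *)
Lemma continuation_unique (a d : Rbar) (f : R -> C) (W1 W2 : C -> C) (x : R) :
  Rbar_lt d 1 -> 1 <= x ->
  is_Mellin_continuation a d f W1 -> is_Mellin_continuation a d f W2 ->
  exists r, 0 < r /\ forall l, 0 < Cmod (l - RtoC x) < r -> W1 l = W2 l.
Proof.
  intros Hd Hx [S1 A1] [S2 A2].
  assert (Hstrip : forall l, Rbar_lt d (Re l) -> Re l < 1 -> (W1 l - W2 l)%C = 0%C).
  { intros l Hl1 Hl2.
    assert (E : W1 l = W2 l).
    { rewrite <- (is_RInt_gen_unique (V := C_R_CompleteNormedModule) _ _ (S1 l Hl1 Hl2)).
      apply (is_RInt_gen_unique (V := C_R_CompleteNormedModule) _ _ (S2 l Hl1 Hl2)). }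
    rewrite E. ring. }
  assert (Hx0 : exists x0 : R, Rbar_lt d x0 /\ x0 < 1).
  { destruct d as [d| |]; simpl in *; [|easy|].
    - exists ((d + 1) / 2). lra.
    - exists 0. split; [easy|lra]. }
  destruct Hx0 as [x0 [Hdx0 Hx0]].
  assert (Hdle : forall y, x0 <= y -> exists e, 0 < e /\ forall z, y - e < z -> Rbar_lt d z).
  { intros y Hy. destruct d as [d| |]; simpl in *; [|easy|].
    - exists (y - d). split; [lra|]. intros; lra.
    - exists 1. split; [lra|easy]. }
  assert (Hzero : forall y, x0 <= y < 1 -> locally (RtoC y) (fun l => (W1 l - W2 l)%C = 0%C)).
  { intros y Hy. destruct (Hdle y (proj1 Hy)) as [e [He He']].
    apply (locally_C_intro _ (Rmin e (1 - y))); [apply Rmin_pos; lra|]. intros l Hl.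
    pose proof (re_le_Cmod (l - RtoC y)) as Hre. change (Re (l - RtoC y)) with (Re l - y) in Hre.
    pose proof (Rmin_l e (1 - y)). pose proof (Rmin_r e (1 - y)).
    assert (Hre1 : Rabs (Re l - y) < e) by lra. apply Rabs_def2 in Hre1.
    assert (Hre2 : Rabs (Re l - y) < 1 - y) by lra. apply Rabs_def2 in Hre2.
    apply Hstrip; [apply He'; lra|lra]. }
  destruct (identity_real_axis (fun l => W1 l - W2 l)%C x0 x) as [r [Hr H]].
  - lra.
  - intros y Hy. destruct (Rlt_dec y 1) as [Hy1|Hy1].
    + apply filter_le_within.
      assert (Hz := Hzero y (conj (proj1 Hy) Hy1)). apply locally_locally in Hz.
      revert Hz. apply filter_imp. intros l Hl.
      apply (analytic_at_ext_loc (fun _ => RtoC 0)); [|apply analytic_at_const].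
      revert Hl. apply filter_imp. now intros z ->.
    + apply Rnot_lt_le in Hy1.
      generalize (filter_and _ _ (A1 (RtoC y) Hy1) (A2 (RtoC y) Hy1)). apply filter_imp.
      intros l [H1 H2]. now apply analytic_at_minus.
  - apply Hzero. lra.
  - exists r. split; [easy|]. intros l Hl. specialize (H l Hl). cbn beta in H.
    replace (W1 l) with (W1 l - W2 l + W2 l)%C by ring. rewrite H. ring.
Qed.

(** * The regularized limit *)

Definition laurent_coef (h : nat -> C) (n : nat) (kappa : C) (z : Z) : C :=
  match z with
  | Z0 => h O
  | Zpos p => h (Pos.to_nat p)
  | Zneg p => if Nat.eq_dec (Pos.to_nat p) (S n) then kappa else 0%C
  end.

Lemma laurent_coef_nonneg (h : nat -> C) (n : nat) (kappa : C) (j : nat) :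
  laurent_coef h n kappa (Z.of_nat j) = h j.
Proof. destruct j as [|j]; simpl; [easy|]. now rewrite SuccNat2Pos.id_succ. Qed.

Lemma laurent_coef_neg (h : nat -> C) (n : nat) (kappa : C) (j : nat) :
  laurent_coef h n kappa (- Z.of_nat (S j)) = if Nat.eq_dec j n then kappa else 0%C.
Proof.
  change (- Z.of_nat (S j))%Z with (Zneg (Pos.of_succ_nat j)). unfold laurent_coef.
  rewrite SuccNat2Pos.id_succ.
  destruct (Nat.eq_dec (S j) (S n)), (Nat.eq_dec j n); first [reflexivity|lia].
Qed.

Lemma csum_single (u : nat -> C) (n N : nat) :
  (forall j, j <> n -> u j = 0%C) -> (n < N)%nat -> csum u N = u n.
Proof.
  intros Hu. induction N as [|N IH]; intros HN; [lia|]. cbn [csum].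
  destruct (Nat.eq_dec n N) as [->|Hne].
  - rewrite (csum_ext _ (fun j => 0 * 0)%C), csum_scal.
    + ring.
    + intros j Hj. rewrite Hu by lia. ring.
  - rewrite IH by lia. rewrite (Hu N) by lia. ring.
Qed.

Lemma reglim_intro (W H : C -> C) (l0 : C) (n : nat) (alpha : C) :
  locally' l0 (analytic_at W) -> analytic_at H l0 ->
  (exists r, 0 < r /\ forall l, 0 < Cmod (l - l0) < r -> W l = H l + alpha * mellin_pole n (l0 - l))%C ->
  is_reglim W l0 (H l0).
Proof.
  intros HW HH [r1 [Hr1 E]].
  apply locally_C_elim in HW. destruct HW as [r2 [Hr2 HW]].
  destruct HH as [h Hh].
  destruct (analytic_at_lim H l0 h Hh) as [_ Hlim].
  apply locally_C_elim in Hh. destruct Hh as [r3 [Hr3 Hh]].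
  set (kappa := (alpha * RtoC ((-1) ^ n * INR (fact n)) * (RtoC (-1)) ^ S n)%C).
  set (r := Rmin (Rmin r1 r2) r3).
  assert (Hrr : r <= r1 /\ r <= r2 /\ r <= r3).
  { unfold r. pose proof (Rmin_l (Rmin r1 r2) r3). pose proof (Rmin_r (Rmin r1 r2) r3).
    pose proof (Rmin_l r1 r2). pose proof (Rmin_r r1 r2). lra. }
  assert (Hne : forall l, 0 < Cmod (l - l0) -> (l - l0)%C <> 0%C) by (intros l Hl; now apply Cmod_gt_0).
  exists r, (laurent_coef h n kappa), (fun l => alpha * mellin_pole n (l0 - l))%C.
  split; [unfold r; repeat apply Rmin_pos; lra|]. split; [|split].
  - intros l Hl. apply HW; [lra|]. intros ->. replace (l0 - l0)%C with (RtoC 0) in Hl by ring.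
    rewrite Cmod_0 in Hl. lra.
  - intros l Hl. split.
    + apply is_Cseries_csum. intros e He. exists (S n). intros N HN.
      rewrite (csum_single _ n N); [|intros j Hj|lia].
      * rewrite laurent_coef_neg. destruct (Nat.eq_dec n n) as [_|]; [|easy].
        match goal with |- Cmod ?x < _ => replace x with (RtoC 0); [now rewrite Cmod_0|] end.
        unfold mellin_pole, kappa.
        replace (/ (l0 - l))%C with (RtoC (-1) * / (l - l0))%C.
        -- rewrite Cpow_mult_l. ring.
        -- replace (RtoC (-1)) with (- RtoC 1)%C by now rewrite <- RtoC_opp.
           assert (Hn := Hne l (proj1 Hl)). field. split; [|easy].
           intros E'. apply Hn. replace (l - l0)%C with (- (l0 - l))%C by ring. rewrite E'. ring.
      * rewrite laurent_coef_neg. destruct (Nat.eq_dec j n) as [|_]; [easy|]. ring.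
    + apply (is_pseries_ext (K := C_AbsRing) (V := C_NormedModule) h).
      * intros j. symmetry. apply laurent_coef_nonneg.
      * rewrite (E l) by lra.
        replace (H l + alpha * mellin_pole n (l0 - l) - alpha * mellin_pole n (l0 - l))%C with (H l) by ring.
        apply Hh. lra.
  - apply (filterlim_C_eq (locally' l0) H _ (H l0)).
    + apply (locally_C_intro l0 r1); [easy|]. intros l Hl Hne'. rewrite (E l).
      * ring.
      * split; [|easy]. apply Cmod_gt_0. now apply Cminus_neq0.
    + easy.
    + intros P HP. apply filter_le_within. now apply Hlim.
Qed.

Lemma csum_extract (u v : nat -> C) (i N : nat) :
  (forall j, j <> i -> v j = u j) -> v i = 0%C -> (i < N)%nat -> csum u N = (csum v N + u i)%C.
Proof.
  intros Huv Hv HN.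
  assert (E : csum u N = (csum v N + csum (fun j => if Nat.eq_dec j i then u i else 0) N)%C).
  { clear HN. induction N as [|N IH]; cbn [csum]; [ring|]. rewrite IH.
    destruct (Nat.eq_dec N i) as [->|Hne]; [rewrite Hv|rewrite Huv by easy]; ring. }
  rewrite E, (csum_single (fun j => if Nat.eq_dec j i then u i else 0%C) i N); [|intros j Hj|easy].
  - now destruct (Nat.eq_dec i i).
  - now destruct (Nat.eq_dec j i).
Qed.

Theorem theorem5p4 :
  forall (a d : Rbar) (k : R -> C),
    Rbar_lt 0%R a ->
    class_K a d k ->
    forall n m : nat,
      (0 < n)%nat -> (0 < m)%nat ->
      (exists W : C -> C, is_Mellin_continuation a d (mul_ln n k) W)
      /\ exists v : C,
           is_fp (fun t : R => (k t * RtoC (ln t ^ n) / RtoC (t ^ m))%C) a v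
           /\ forall W : C -> C,
                is_Mellin_continuation a d (mul_ln n k) W ->
                is_reglim W (RtoC (INR m)) v.
Proof.
  intros a d k Ha HK n m _ Hm.
  destruct (class_K_expansion a d k Ha HK) as [c [b Hloc]].
  pose proof (class_K_upper a d k c b n HK Hloc) as Hup.
  assert (Hd : Rbar_lt d 1) by apply HK.
  assert (Hcont := mellin_cont_continuation a d k c b n Hd Hloc Hup).
  split; [eexists; exact Hcont|].
  set (l0 := RtoC (INR m)).
  assert (Hm1 : 1 <= INR m) by (apply (le_INR 1); lia).
  assert (Hdm : Rbar_lt d (Re l0)).
  { apply Rbar_lt_le_trans with (1 := Hd). exact Hm1. }
  set (T := powint (mul_ln n k) b (to_upper a)).
  (* with degree m + 2 the left part is valid on the unit disc around m *)
  set (N := (m + 2)%nat).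
  assert (HN : INR N = INR m + 2) by (unfold N; rewrite plus_INR; simpl INR; ring).
  exists (T l0 - left_part k c b n N l0)%C. split.
  - apply (is_fp_left_part a k c b n m N).
    + easy.
    + lra.
    + intros t Ht. rewrite Rcpow_opp_nat by easy. reflexivity.
    + now apply Hup.
  - intros W HW.
    destruct (continuation_unique a d (mul_ln n k) W (mellin_cont a k c b n) (INR m) Hd Hm1 HW Hcont) as [r1 [Hr1 HEW]].
    assert (Hnear := mellin_cont_near a k c b n N l0 Hloc ltac:(change (Re l0) with (INR m); lra)).
    apply locally_C_elim in Hnear. destruct Hnear as [r2 [Hr2 Hnear]].
    (* the term of index m - 1 is the only one with a pole at m *)
    set (v := fun l j => if Nat.eq_dec j (pred m) then RtoC 0
                         else (c j * mellin_pole n (RtoC (INR (S j)) - l))%C).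
    set (H := fun l => (T l - (powint (remainder k c n N) b (at_right 0) l
       + powint (mul_ln n (taylor_poly c N)) b (at_point 1) l) + csum (v l) N)%C).
    assert (Hpm : S (pred m) = m) by lia.
    assert (Hsplit : forall l, (T l - left_part k c b n N l)%C = (H l + c (pred m) * mellin_pole n (l0 - l))%C).
    { intros l. unfold H, left_part.
      rewrite (csum_extract (fun j => c j * mellin_pole n (RtoC (INR (S j)) - l))%C (v l) (pred m) N).
      - rewrite Hpm. fold l0. ring.
      - intros j Hj. unfold v. now destruct (Nat.eq_dec j (pred m)).
      - unfold v. now destruct (Nat.eq_dec (pred m) (pred m)).
      - unfold N. lia. }
    assert (Ev : (T l0 - left_part k c b n N l0)%C = H l0).
    { rewrite Hsplit. replace (l0 - l0)%C with (RtoC 0) by ring. rewrite mellin_pole_0. ring. }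
    rewrite Ev. apply (reglim_intro W H l0 n (c (pred m))).
    + apply HW. exact Hm1.
    + apply analytic_at_plus; [apply analytic_at_minus; [|apply analytic_at_plus]|].
      * now apply Hup.
      * apply (powint_remainder a); [easy|]. change (Re l0) with (INR m). lra.
      * apply powint_taylor_poly, Hloc.
      * apply (analytic_at_csum (fun j l => v l j)). intros j _. unfold v.
        destruct (Nat.eq_dec j (pred m)) as [_|Hj]; [apply analytic_at_const|].
        apply analytic_at_scal, mellin_pole_analytic. intros E. apply RtoC_inj, INR_eq in E. lia.
    + exists (Rmin r1 r2). split; [now apply Rmin_pos|]. intros l Hl.
      pose proof (Rmin_l r1 r2). pose proof (Rmin_r r1 r2).
      rewrite HEW by (fold l0; lra). rewrite Hnear by lra. apply Hsplit.
Qed.
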